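(* For $i=0,1,\dots,k$ let $\mu_i$ be a probability measure on $([0,1],\mathcal{B})$ and $T_i:[0,1]\to[0,1]$ a $\mu_i$-preserving ergodic transformation such that (1) for each $i=0,\dots,k$ there is a partition $\mathcal{A}_i$ with $(T_i,\mu_i,\mathcal{A}_i)\in\mathcal{T}$; (2) for $i=1,\dots,k$, $(T_i,\mu_i,\mathcal{A}_i)$ has property B; (3) $0\le h(T_0)<h(T_1)<\cdots<h(T_k)<\infty$, where $h(T_i)$ is the Kolmogorov–Sinai entropy of $T_i$ with respect to $\mu_i$. Suppose that $T_0\times T_1\times\cdots\times T_k$ is ergodic with respect to $\mu_0\times\cdots\times\mu_k$. Then for every probability measure $\nu$ equivalent to Lebesgue measure $\lambda$ and all $f_0,\dots,f_k\in L^\infty$, $\lim_{N-M\to\infty}\frac{1}{N-M}\sum_{n=M}^{N-1}T_0^nf_0\cdot T_1^nf_1\cdots T_k^nf_k=\prod_{i=0}^k\int f_i\,d\mu_i$ in $L^2(\nu)$.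
   Context: $T^nf:=f\circ T^n$; $\lim_{N-M\to\infty}$ means convergence uniformly over all pairs $0\le M<N$ as $N-M\to\infty$. Let $X=[0,1]$, $\mathcal{B}$ Borel, $\lambda$ Lebesgue. A partition of $[0,1]$ is a finite or countable family of intervals with nonempty pairwise disjoint interiors covering $[0,1]$ up to a $\lambda$-null set. The class $\mathcal{T}$ consists of triples $(T,\mu,\mathcal{A})$ where $\mu$ is a Borel probability measure with $\frac1c\mu\le\lambda\le c\mu$ for some $c\ge1$, $T:[0,1]\to[0,1]$ is $\mu$-preserving and ergodic, and $\mathcal{A}$ is a partition such that $T|_{\mathrm{int}(I)}$ is continuous and strictly monotone for each $I\in\mathcal{A}$, $\bigvee_{j\ge0}T^{-j}\sigma(\mathcal{A})=\mathcal{B}$ mod $\lambda$, and $-\sum_{I\in\mathcal{A}}\mu(I)\log\mu(I)<\infty$. Write $\mathcal{A}^l=\bigvee_{j=0}^{l-1}T^{-j}\mathcal{A}$. $(T,\mu,\mathcal{A})\in\mathcal{T}$ has property B if there exist $c>0$ and positive reals $b_n\to0$ such that for every $l\in\mathbb{N}$, every integer $n\ge0$, every $A\in\sigma(\mathcal{A}^l)$ and every $B\in\mathcal{B}$: $\mu(A\cap T^{-(n+l)}B)\le c\mu(A)\mu(B)+b_n$. *)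

(* Defs.v *)
(* X = [0,1] is modelled inside the real line R. *)
From HB Require Import structures.
From mathcomp Require Import all_boot all_order all_algebra.
From mathcomp Require Import all_classical all_reals all_analysis.
Set Implicit Arguments. Unset Strict Implicit. Unset Printing Implicit Defensive.
Import Order.TTheory GRing.Theory Num.Theory.
Import numFieldNormedType.Exports.
Local Open Scope classical_set_scope.
Local Open Scope ring_scope.

Section Defs.
Variable R : realType.

Definition lam01 (A : set R) : \bar R :=
  (@lebesgue_measure R (A `&` `[0%R, 1%R]))%E.

Definition symdiff {T} (A B : set T) := (A `\` B) `|` (B `\` A).

Definition mpreserving {d} {X : measurableType d}
  (mu : {measure set X -> \bar R}) (f : X -> X) :=
  measurable_fun setT f /\
  forall A, measurable A -> mu (f @^-1` A) = mu A.

Definition ergodic {d} {X : measurableType d}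
  (mu : {measure set X -> \bar R}) (f : X -> X) :=
  forall A, measurable A -> mu (symdiff (f @^-1` A) A) = 0%E ->
    mu A = 0%E \/ mu A = 1%E.

Definition maps01 (T : R -> R) :=
  forall x, 0 <= x <= 1 -> 0 <= T x <= 1.

(* mu equivalent to lambda with bounded densities: (1/c) mu <= lambda <= c mu *)
Definition bdd_equiv (mu : {measure set R -> \bar R}) :=
  exists c : R, 1 <= c /\ forall A, measurable A ->
    ((c^-1)%:E * mu A <= lam01 A)%E /\ (lam01 A <= c%:E * mu A)%E.

(* a partition of [0,1]: the family (I n)_{n in J}, J a subset of nat
   (so the family is finite or countable) *)
Definition is_partition01 (J : set nat) (I : nat -> interval R) :=
  (forall n, J n -> [set` I n] `<=` `[0%R, 1%R]) /\
  (forall n, J n -> interior [set` I n] !=set0) /\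
  (forall n m, J n -> J m -> n <> m ->
      interior [set` I n] `&` interior [set` I m] = set0) /\
  lam01 (`[0%R, 1%R] `\` \bigcup_(n in J) [set` I n]) = 0%E.

Definition cont_strict_mono (T : R -> R) (I : set R) :=
  {within interior I, continuous T} /\
  ((forall x y, interior I x -> interior I y -> x < y -> T x < T y) \/
   (forall x y, interior I x -> interior I y -> x < y -> T y < T x)).

Definition refine_gen (T : R -> R) (J : set nat) (I : nat -> interval R)
  (l : option nat) : set (set R) :=
  [set S | exists j m, (if l is Some l' then (j < l')%N else True) /\ J m /\
            S = (iter j T) @^-1` [set` I m]].

Definition sigma_refine T J I l := <<s refine_gen T J I (Some l) >>.

Definition generator (T : R -> R) (J : set nat) (I : nat -> interval R) :=
  forall B : set R, measurable B ->
    exists C, <<s refine_gen T J I None >> C /\ lam01 (symdiff B C) = 0%E.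

Definition xlnx (x : R) : R := - (x * ln x).

Definition part_entropy_finite (mu : {measure set R -> \bar R})
  (J : set nat) (I : nat -> interval R) :=
  (\esum_(n in J) (xlnx (fine (mu [set` I n])))%:E < +oo)%E.

Definition classT (mu : probability R R) (T : R -> R)
  (J : set nat) (I : nat -> interval R) :=
  bdd_equiv mu /\ maps01 T /\ mpreserving mu T /\ ergodic mu T /\
  is_partition01 J I /\
  (forall n, J n -> cont_strict_mono T [set` I n]) /\
  generator T J I /\ part_entropy_finite mu J I.

Definition propertyB (mu : probability R R) (T : R -> R)
  (J : set nat) (I : nat -> interval R) :=
  exists c : R, 0 < c /\ exists b : nat -> R,
    (forall n, 0 < b n) /\ b @ \oo --> 0 /\
    forall (l n : nat) (A B : set R), (0 < l)%N ->
      sigma_refine T J I l A -> measurable B ->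
      (mu (A `&` (iter (n + l) T) @^-1` B)
        <= c%:E * mu A * mu B + (b n)%:E)%E.

Definition fin_meas_partition (m : nat) (P : 'I_m -> set R) :=
  (forall i, measurable (P i)) /\
  (forall i j, i != j -> P i `&` P j = set0) /\
  \big[setU/set0]_(i < m) P i = setT.

(* H_mu( bigvee_{j<n} T^{-j} P ) : the atoms are indexed by s : 'I_n -> 'I_m *)
Definition H_join (mu : {measure set R -> \bar R}) (T : R -> R)
  (m : nat) (P : 'I_m -> set R) (n : nat) : R :=
  \sum_(s : {ffun 'I_n -> 'I_m})
     xlnx (fine (mu (\big[setI/setT]_(j < n) ((iter j T) @^-1` P (s j))))).

Definition ent_rel (mu : {measure set R -> \bar R}) (T : R -> R)
  (m : nat) (P : 'I_m -> set R) : R :=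
  limn (fun n => (n.+1%:R)^-1 * H_join mu T P n.+1).

Definition KS_entropy (mu : {measure set R -> \bar R}) (T : R -> R) : \bar R :=
  ereal_sup [set x | exists m (P : 'I_m -> set R),
                fin_meas_partition P /\ x = (ent_rel mu T P)%:E].

Definition Linfty (f : R -> R) :=
  measurable_fun setT f /\
  exists C : R, @lebesgue_measure R
     [set x | 0 <= x <= 1 /\ C < `|f x|] = 0%E.

Definition equiv_lam (nu : {measure set R -> \bar R}) :=
  forall A, measurable A -> (nu A = 0%E <-> lam01 A = 0%E).

Definition prod_map (k : nat) (T : nat -> R -> R)
  (x : (k.+1).-tuple R) : (k.+1).-tuple R :=
  [tuple T i (tnth x i) | i < k.+1].

Definition is_product_measure (k : nat) (mu : nat -> probability R R)
  (P : probability ((k.+1).-tuple R) R) :=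
  forall A : 'I_k.+1 -> set R, (forall i, measurable (A i)) ->
    P [set x | forall i, A i (tnth x i)] = (\prod_(i < k.+1) mu i (A i))%E.

Definition erg_avg (k : nat) (T : nat -> R -> R) (f : nat -> R -> R)
  (M N : nat) (x : R) : R :=
  (N - M)%:R^-1 * \sum_(M <= n < N) \prod_(i < k.+1) f i (iter n (T i) x).

End Defs.

(* Main.v *)
(* The averages of F (T_0^n x, ..., T_k^n x) are compared with the product system.

   Let E_n be the intersection of T_0^-n A_0, ..., T_j^-n A_j, where A_i is a union of cylinders
   of T_i.  Cylinders of piecewise monotone maps are intervals, so by Shannon-McMillan in
   probability E_n is, up to small measure, a union of intervals of length at least exp (- n h),
   with h close to h(T_j).  As h(T_{j+1}) > h(T_j), the cylinders of T_{j+1} of order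
   q = (1 - 1/D) n are much shorter than that, so unions of them approximate E_n; property B
   across the gap n - q then bounds the measure of the intersection of E_n with T_{j+1}^-n A by
   a constant times the product of the measures, up to o(1).  By induction, the limsup over n of
   the measure of {x | T_i^n x is in A_i for all i <= k} is at most C mu_0(A_0) ... mu_k(A_k).

   Finally, by ergodicity of the product system the averages over a window of fixed length H are
   close to their mean outside a finite union of boxes of small product measure; by the above
   bound, the windows starting at time n are then good for most x, uniformly in large n, and
   long averages are averages of windows. *)

Require Import Defs.
From HB Require Import structures.
From mathcomp Require Import all_boot all_order all_algebra.
From mathcomp Require Import all_classical all_reals all_analysis.
From mathcomp Require Import measurable_realfun lra ring.
Set Implicit Arguments. Unset Strict Implicit. Unset Printing Implicit Defensive.
Import Order.TTheory GRing.Theory Num.Theory.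
Import numFieldNormedType.Exports.
Local Open Scope classical_set_scope.
Local Open Scope ring_scope.

(** * Probabilities and expectations as real numbers *)

Section RealProbability.
Context {R : realType} {d : measure_display} {X : measurableType d}.
Variable mu : probability X R.

(** The maps [T i] share no dynamics; they are compared only through the order of the line and the
    density bounds against Lebesgue measure. A cell of small measure is short, and a set made of few
    cells has few boundary points. So the entropy of the earlier maps is used from above, to limit
    the number of their cells, and that of the next map from below, to make its cells short; hence
    the maps are added in increasing order of entropy. The strict gap pays for shortening the cells
    to order [(1 - 1/D) n], which leaves property B a distance [n / D] over which its additive error
    dies out.

    Property B is a one-sided bound, so the induction yields an upper bound with a constant and not
    a limit. The constant is harmless because it is fixed before the window length: ergodicity of
    the product makes the bad boxes as small as desired relative to it.

    Estimates in probability suffice throughout. Those on itineraries come from one device: Markov's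
    inequality for the ratio of a sub-probability on words to their true law. The sub-probability is
    a Markov approximation in the Shannon-McMillan estimate, and a code built from another partition
    when two partitions are compared. *)

Definition pr (A : set X) : R := fine (mu A).

Lemma prE A : measurable A -> mu A = (pr A)%:E.
Proof. by move=> mA; rewrite /pr fineK// fin_num_measure. Qed.

Lemma pr_ge0 A : 0 <= pr A.
Proof. exact/fine_ge0/measure_ge0. Qed.

Lemma pr_le1 A : measurable A -> pr A <= 1.
Proof. by move=> mA; rewrite -lee_fin -prE// probability_le1. Qed.

Lemma le_pr A B : measurable A -> measurable B -> A `<=` B -> pr A <= pr B.
Proof.
by move=> mA mB AB; rewrite -lee_fin -!prE//; apply: le_measure; rewrite ?inE.
Qed.

Lemma pr0 : pr set0 = 0. Proof. by rewrite /pr measure0. Qed.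
Lemma prT : pr setT = 1. Proof. by rewrite /pr probability_setT. Qed.

Lemma prU A B : measurable A -> measurable B -> A `&` B = set0 ->
  pr (A `|` B) = pr A + pr B.
Proof.
move=> mA mB AB; apply: EFin_inj; rewrite -prE; last exact: measurableU.
by rewrite measureU// EFinD -!prE.
Qed.

Lemma prC A : measurable A -> pr (~` A) = 1 - pr A.
Proof.
move=> mA; have := prU mA (measurableC mA) (setICr A).
by rewrite setUCr prT => ->; rewrite addrAC subrr add0r.
Qed.

Lemma prID A B : measurable A -> measurable B ->
  pr A = pr (A `&` B) + pr (A `\` B).
Proof.
move=> mA mB; rewrite -prU; [by rewrite setUIDK|exact: measurableI|exact: measurableD|].
by apply/seteqP; split=> x //= [[_ Bx] [_ /(_ Bx)]].
Qed.

Lemma prU_le A B : measurable A -> measurable B -> pr (A `|` B) <= pr A + pr B.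
Proof.
move=> mA mB; rewrite -lee_fin EFinD -!prE//; last exact: measurableU.
exact: measureU2.
Qed.

Lemma le_prU A B C : measurable A -> measurable B -> measurable C ->
  C `<=` A `|` B -> pr C <= pr A + pr B.
Proof.
move=> mA mB mC CAB; apply: le_trans (prU_le mA mB).
by apply: le_pr => //; exact: measurableU.
Qed.

Lemma le_pr_bigcup_seq (I : eqType) (l : seq I) (F : I -> set X) A :
  (forall i, measurable (F i)) -> measurable A ->
  (forall x, A x -> exists2 i, i \in l & F i x) ->
  pr A <= \sum_(i <- l) pr (F i).
Proof.
move=> mF; elim: l A => [|i l IH] A mA AF.
  rewrite big_nil (_ : A = set0) ?pr0//.
  by apply/seteqP; split=> x // /AF[].
rewrite big_cons; apply: le_trans (_ : pr (F i) + pr (A `\` F i) <= _).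
  apply: le_prU => //; first exact: measurableD.
  by move=> x Ax; have [|] := pselect (F i x); [left|right].
rewrite lerD2l; apply: IH; first exact: measurableD.
move=> x [/AF[j]]; rewrite inE => /orP[/eqP ->//|jl Fj _].
by exists j.
Qed.

Lemma pr_bigcup_seq (I : eqType) (l : seq I) (F : I -> set X) A :
  uniq l -> (forall i, measurable (F i)) -> measurable A ->
  (forall i j x, F i x -> F j x -> i = j) ->
  (forall i, i \in l -> F i `<=` A) ->
  \sum_(i <- l) pr (F i) <= pr A.
Proof.
move=> + mF + dF; elim: l A => [|i l IH] A /=; first by rewrite big_nil pr_ge0.
move=> /andP[il ul] mA FA; rewrite big_cons.
have FiA : F i `<=` A by apply: FA; rewrite mem_head.
rewrite (prID mA (mF i)) (_ : A `&` F i = F i); last exact/setIidPr.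
rewrite lerD2l; apply: IH => //; first exact: measurableD.
move=> j jl x Fj; split; first by apply: FA Fj; rewrite inE jl orbT.
by move=> Fi; move: il; rewrite (dF _ _ _ Fi Fj) jl.
Qed.

Lemma pr_cvg (F : nat -> set X) A (eps : R) : (forall k, measurable (F k)) ->
  measurable A -> (forall k l, (k <= l)%N -> F k `<=` F l) ->
  A `<=` \bigcup_k F k -> 0 < eps ->
  exists K, forall k, (K <= k)%N -> pr A <= pr (F k) + eps.
Proof.
move=> mF mA ndF AF e0.
have mU : measurable (\bigcup_k F k) by exact: bigcup_measurable.
have : mu \o F @ \oo --> mu (\bigcup_k F k).
  apply: nondecreasing_cvg_mu => //.
  by move=> k l kl; apply/subsetPset; exact: ndF.
rewrite (_ : mu \o F = fun k => (pr (F k))%:E); last first.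
  by apply/funext => k /=; rewrite prE.
rewrite prE// => /fine_cvgP[_] /cvgrPdist_lt /(_ _ e0)[K _ hK].
exists K => k Kk; have := hK k Kk => /=; rewrite ltr_distl => /andP[_ h].
by apply: le_trans (ltW h); apply: le_pr.
Qed.

Lemma pr_cvg0 (F : nat -> set X) (eps : R) : (forall k, measurable (F k)) ->
  (forall k l, (k <= l)%N -> F l `<=` F k) ->
  (forall x, exists k, ~ F k x) -> 0 < eps ->
  exists K, forall k, (K <= k)%N -> pr (F k) <= eps.
Proof.
move=> mF niF F0 e0.
have [|||K hK] := @pr_cvg (fun k => ~` F k) setT eps _ measurableT _ _ e0.
- by move=> k; exact: measurableC.
- by move=> k l kl x; apply: contra_not; exact: niF.
- by move=> x _; have [k ?] := F0 x; exists k.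
- exists K => k /hK; rewrite prT prC//; lra.
Qed.

Lemma countable_fiber_measurable (S : countType) (N : X -> S) :
  (forall s, measurable (N @^-1` [set s])) ->
  forall Y : set S, measurable (N @^-1` Y).
Proof.
move=> mN Y.
rewrite (_ : N @^-1` Y = \bigcup_k (if unpickle k is Some s then
   (if `[< Y s >] then N @^-1` [set s] else set0) else set0)).
  apply: bigcup_measurable => k _; case: (unpickle k) => // s.
  by case: ifP.
apply/seteqP; split=> [x Yx|x [k _]].
  by exists (pickle (N x)) => //=; rewrite pickleK; case: asboolP.
by case: (unpickle k) => // s; case: asboolP => //= Ys ->.
Qed.

(** Summation over the atoms of [N], with finite sums only: atoms of code below [k] exhaust [B], and
    continuity from below does the rest. [Z] restricts the sums to values that [N] can take, such as
    words of a given length. *)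
Lemma countable_pr_bound (S : countType) (N : X -> S) (Z : pred S)
  (w : S -> R) (W : R) B :
  (forall s, measurable (N @^-1` [set s])) -> measurable B ->
  (forall x, Z (N x)) ->
  (forall s, Z s -> pr (B `&` N @^-1` [set s]) <= w s) ->
  (forall l, uniq l -> all Z l -> \sum_(s <- l) w s <= W) ->
  pr B <= W.
Proof.
move=> mN mB ZN Bw wW; apply/ler_addgt0Pr => e e0.
pose F k := B `&` [set x | (pickle (N x) < k)%N].
have mF k : measurable (F k).
  apply: measurableI => //.
  exact: (@countable_fiber_measurable _ _ mN [set s | (pickle s < k)%N]).
have [||K /(_ K (leqnn _)) /le_trans] := @pr_cvg F B e mF mB _ _ e0.
- by move=> k l kl x [Bx /= xk]; split => //=; exact: leq_trans kl.
- by move=> x Bx; exists (pickle (N x)).+1 => //; split => /=.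
apply; rewrite lerD2r.
pose l := [seq s <- undup (pmap unpickle (iota 0 K)) | Z s].
apply: le_trans (wW l _ _); last 2 first.
- by rewrite filter_uniq// undup_uniq.
- by apply/allP => s; rewrite mem_filter => /andP[].
apply: (@le_trans _ _ (\sum_(s <- l) pr (B `&` N @^-1` [set s]))); last first.
  by rewrite !big_seq; apply: ler_sum => s; rewrite mem_filter => /andP[/Bw].
apply: le_pr_bigcup_seq => // [s|x [Bx /= xK]]; first exact: measurableI.
exists (N x) => //; rewrite mem_filter ZN/= mem_undup mem_pmap.
by apply/mapP; exists (pickle (N x)); rewrite ?pickleK// mem_iota.
Qed.

(** A class closed under the operations used and integrable for every probability, so that no
    separate integrability conditions have to be carried along. *)
Definition bmf (f : X -> R) :=
  measurable_fun setT f /\ exists C, forall x, `|f x| <= C.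

Definition Ex (f : X -> R) : R := (\int[mu]_x f x)%R.

Lemma bmf_integrable f : bmf f -> mu.-integrable setT (EFin \o f).
Proof.
move=> [mf [C hC]]; apply: measurable_bounded_integrable => //.
  by apply: fin_num_fun_lty; exact: fin_num_measure.
by exists C; split; rewrite ?num_real// => y Cy x _ /=; exact: le_trans (ltW Cy).
Qed.

Lemma bmf_cst c : bmf (fun=> c).
Proof. by split; [exact: measurable_cst|exists `|c|]. Qed.

Lemma bmfD f g : bmf f -> bmf g -> bmf (fun x => f x + g x).
Proof.
move=> [mf [C hC]] [mg [D hD]]; split; first exact: measurable_funD.
by exists (C + D) => x; apply: le_trans (ler_normD _ _) _; exact: lerD.
Qed.

Lemma bmfM f g : bmf f -> bmf g -> bmf (fun x => f x * g x).
Proof.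
move=> [mf [C hC]] [mg [D hD]]; split; first exact: measurable_funM.
by exists (C * D) => x; rewrite normrM; exact: ler_pM.
Qed.

Lemma bmfZ c f : bmf f -> bmf (fun x => c * f x).
Proof. by move=> bf; apply: bmfM => //; exact: bmf_cst. Qed.

Lemma bmfN f : bmf f -> bmf (fun x => - f x).
Proof.
move=> bf; rewrite (_ : (fun _ => _) = (fun x => -1 * f x)); first exact: bmfZ.
by apply/funext => x; rewrite mulN1r.
Qed.

Lemma bmfB f g : bmf f -> bmf g -> bmf (fun x => f x - g x).
Proof. by move=> bf bg; apply: bmfD => //; exact: bmfN. Qed.

Lemma bmf_norm f : bmf f -> bmf (fun x => `|f x|).
Proof.
move=> [mf [C hC]]; split; first exact: measurableT_comp.
by exists C => x; rewrite normr_id.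
Qed.

Lemma bmf_max f g : bmf f -> bmf g -> bmf (fun x => Num.max (f x) (g x)).
Proof.
move=> [mf [C hC]] [mg [D hD]]; split; first exact: measurable_maxr.
exists (C + D) => x; rewrite /Num.max; case: ifP => _.
  by apply: le_trans (hD x) _; rewrite lerDr (le_trans _ (hC x)).
by apply: le_trans (hC x) _; rewrite lerDl (le_trans _ (hD x)).
Qed.

Lemma bmf_sum (I : Type) (l : seq I) (P : pred I) (F : I -> X -> R) :
  (forall i, bmf (F i)) -> bmf (fun x => \sum_(i <- l | P i) F i x).
Proof.
move=> bF; elim: l => [|i l IH].
  by under eq_fun do rewrite big_nil; exact: bmf_cst.
under eq_fun do rewrite big_cons; case: (P i) => //.
exact: bmfD.
Qed.

Lemma bmf_prod (I : Type) (l : seq I) (P : pred I) (F : I -> X -> R) :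
  (forall i, bmf (F i)) -> bmf (fun x => \prod_(i <- l | P i) F i x).
Proof.
move=> bF; elim: l => [|i l IH].
  by under eq_fun do rewrite big_nil; exact: bmf_cst.
under eq_fun do rewrite big_cons; case: (P i) => //.
exact: bmfM.
Qed.

Lemma bmf_indic A : measurable A -> bmf (\1_A).
Proof.
move=> mA; split; first exact: measurable_indic.
by exists 1 => x; rewrite indicE; case: (_ \in _); rewrite ?normr0 ?normr1.
Qed.

Lemma bmf_mulb f A : measurable A -> bmf f -> bmf (fun x => f x * \1_A x).
Proof. by move=> mA bf; apply: bmfM => //; exact: bmf_indic. Qed.

Lemma ExD f g : bmf f -> bmf g -> Ex (fun x => f x + g x) = Ex f + Ex g.
Proof. by move=> bf bg; apply: RintegralD => //; exact: bmf_integrable. Qed.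

Lemma ExZ c f : bmf f -> Ex (fun x => c * f x) = c * Ex f.
Proof. by move=> bf; apply: RintegralZl => //; exact: bmf_integrable. Qed.

Lemma ExN f : bmf f -> Ex (fun x => - f x) = - Ex f.
Proof.
move=> bf; rewrite -mulN1r -ExZ//; congr Ex; apply/funext => x.
by rewrite mulN1r.
Qed.

Lemma ExB f g : bmf f -> bmf g -> Ex (fun x => f x - g x) = Ex f - Ex g.
Proof. by move=> bf bg; rewrite ExD ?ExN//; exact: bmfN. Qed.

Lemma Ex_cst c : Ex (fun=> c) = c.
Proof. by rewrite /Ex Rintegral_cst// -/(pr _) prT mulr1. Qed.

Lemma le_Ex f g : bmf f -> bmf g -> (forall x, f x <= g x) -> Ex f <= Ex g.
Proof.
by move=> bf bg fg; apply: le_Rintegral => //; exact: bmf_integrable.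
Qed.

Lemma Ex_ge0 f : (forall x, 0 <= f x) -> 0 <= Ex f.
Proof. by move=> f0; exact: Rintegral_ge0. Qed.

Lemma Ex_indic A : measurable A -> Ex (\1_A) = pr A.
Proof. by move=> mA; rewrite /Ex /Rintegral integral_indic// setIT. Qed.

Lemma Ex_sum (I : Type) (l : seq I) (P : pred I) (F : I -> X -> R) :
  (forall i, bmf (F i)) ->
  Ex (fun x => \sum_(i <- l | P i) F i x) = \sum_(i <- l | P i) Ex (F i).
Proof.
move=> bF; elim: l => [|i l IH].
  by rewrite big_nil; under eq_fun do rewrite big_nil; rewrite Ex_cst.
rewrite big_cons; under eq_fun do rewrite big_cons; case: (P i) => //.
by rewrite ExD ?IH//; exact: bmf_sum.
Qed.

Lemma measurable_gt (f : X -> R) (a : R) : measurable_fun setT f ->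
  measurable [set x | a < f x].
Proof.
move=> mf; rewrite (_ : [set _ | _] = f @^-1` `]a, +oo[); last first.
  by apply/seteqP; split=> x /=; rewrite in_itv/= andbT.
by rewrite -[X in measurable X]setTI; exact: mf.
Qed.

Lemma measurable_lt (f : X -> R) (a : R) : measurable_fun setT f ->
  measurable [set x | f x < a].
Proof.
move=> mf; rewrite (_ : [set _ | _] = f @^-1` `]-oo, a[); last first.
  by apply/seteqP; split=> x /=; rewrite in_itv/=.
by rewrite -[X in measurable X]setTI; exact: mf.
Qed.

Lemma markov_pr f a : bmf f -> (forall x, 0 <= f x) -> 0 < a ->
  pr [set x | a < f x] <= Ex f / a.
Proof.
move=> bf f0 a0; have mA := @measurable_gt _ a (proj1 bf).
rewrite ler_pdivlMr// mulrC -Ex_indic// -ExZ; last exact: bmf_indic.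
apply: le_Ex => //; first by apply: bmfZ; exact: bmf_indic.
move=> x; rewrite indicE; have [h|h] := ltP a (f x).
  by rewrite mem_set// mulr1 ltW.
by rewrite memNset ?mulr0//=; apply/negP; rewrite -leNgt.
Qed.

End RealProbability.

Lemma bmf_comp {R : realType} {d d'} {X : measurableType d}
  {Y : measurableType d'} (f : Y -> R) (T : X -> Y) :
  measurable_fun setT T -> bmf f -> bmf (f \o T).
Proof.
move=> mT [mf [C hC]]; split; first exact: measurableT_comp.
by exists C => x /=.
Qed.

(** * Invariance of probabilities and expectations *)

Section MeasurePreserving.
Context {R : realType} {d : measure_display} {X : measurableType d}.
Variables (mu : probability X R) (T : X -> X).
Hypothesis mpT : mpreserving mu T.

Let mT : measurable_fun setT T := (proj1 mpT).

Lemma measurable_iter n : measurable_fun setT (iter n T).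
Proof.
elim: n => [|n IH] /=; first exact: measurable_id.
exact: measurableT_comp.
Qed.

Lemma preimage_iter_measurable n A : measurable A ->
  measurable (iter n T @^-1` A).
Proof. by move=> mA; rewrite -[X in measurable X]setTI; exact: measurable_iter. Qed.

Lemma pr_preimage A : measurable A -> pr mu (T @^-1` A) = pr mu A.
Proof. by move=> mA; rewrite /pr (proj2 mpT). Qed.

Lemma pr_iter n A : measurable A -> pr mu (iter n T @^-1` A) = pr mu A.
Proof.
move=> mA; elim: n => [//|n IH].
rewrite (_ : _ @^-1` _ = T @^-1` (iter n T @^-1` A)).
  by rewrite pr_preimage//; exact: preimage_iter_measurable.
by apply/seteqP; split=> x; rewrite /preimage/= -iterS iterSr.
Qed.

Lemma Ex_comp f : bmf f -> Ex mu (f \o T) = Ex mu f.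
Proof.
move=> bf; rewrite /Ex /Rintegral; congr fine.
have -> : (\int[mu]_x (f x)%:E = \int[pushforward mu T]_x (f x)%:E)%E.
  apply: eq_measure_integral => A mA _; rewrite /pushforward.
  by apply/esym; exact: (proj2 mpT).
rewrite integral_pushforward//=.
- exact/measurable_EFinP/(proj1 bf).
- by apply: bmf_integrable; exact: bmf_comp.
Qed.

Lemma Ex_iter n f : bmf f -> Ex mu (f \o iter n T) = Ex mu f.
Proof.
move=> bf; elim: n => [//|n IH]; rewrite -IH -[RHS]Ex_comp.
  by congr Ex; apply/funext => x /=; rewrite -iterS iterSr.
by apply: bmf_comp => //; exact: measurable_iter.
Qed.

End MeasurePreserving.

(** * Birkhoff averages of an ergodic transformation *)

Section Birkhoff.
Context {R : realType} {d : measure_display} {X : measurableType d}.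
Variables (mu : probability X R) (T : X -> X).
Hypotheses (mpT : mpreserving mu T) (ergT : ergodic mu T).

Let mT : measurable_fun setT T := proj1 mpT.

Definition bsum (f : X -> R) n x : R := \sum_(j < n) f (iter j T x).

Lemma bsumS f n x : bsum f n.+1 x = f x + bsum f n (T x).
Proof.
rewrite /bsum big_ord_recl; congr (_ + _); apply: eq_bigr => j _ /=.
by rewrite -iterS iterSr.
Qed.

Lemma bmf_bsum f n : bmf f -> bmf (bsum f n).
Proof.
move=> bf; apply: bmf_sum => j; apply: (bmf_comp _ bf).
exact: (measurable_iter mpT).
Qed.

Lemma bsum_sub f c n x : bsum (fun y => f y - c) n x = bsum f n x - n%:R * c.
Proof. by rewrite /bsum sumrB sumr_const card_ord mulr_natl. Qed.

Lemma bsum_opp f n x : bsum (fun y => - f y) n x = - bsum f n x.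
Proof. by rewrite /bsum sumrN. Qed.

Lemma Ex_bsum f n : bmf f -> Ex mu (bsum f n) = n%:R * Ex mu f.
Proof.
move=> bf; rewrite /bsum Ex_sum => [|j]; last first.
  by apply: (bmf_comp _ bf); exact: (measurable_iter mpT).
under eq_bigr do rewrite (Ex_iter mpT _ bf).
by rewrite sumr_const card_ord mulr_natl.
Qed.

(* [bmax f n] is the maximum of the Birkhoff sums of order at most [n]. *)
Fixpoint bmax (f : X -> R) n x : R :=
  if n is n'.+1 then Num.max 0 (f x + bmax f n' (T x)) else 0.

Lemma bmax_ge0 f n x : 0 <= bmax f n x.
Proof. by case: n => [|n] //=; rewrite le_max lexx. Qed.

Lemma bmax_nd f n x : bmax f n x <= bmax f n.+1 x.
Proof.
elim: n x => [x|n IH x]; first exact: bmax_ge0.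
change (bmax f n.+1 x) with (Num.max 0 (f x + bmax f n (T x))).
change (bmax f n.+2 x) with (Num.max 0 (f x + bmax f n.+1 (T x))).
by rewrite ge_max !le_max lexx/= lerD2l IH orbT.
Qed.

Lemma bmax_mono f x : {homo bmax f ^~ x : m n / (m <= n)%N >-> m <= n}.
Proof.
apply: homo_leq => [//|y z t yz|n]; [exact: le_trans|exact: bmax_nd].
Qed.

Lemma bsum_le_bmax f n x : bsum f n x <= bmax f n x.
Proof.
elim: n x => [x|n IH x]; first by rewrite /bsum big_ord0.
by rewrite bsumS /= le_max lerD2l IH orbT.
Qed.

Lemma bmf_bmax f n : bmf f -> bmf (bmax f n).
Proof.
move=> bf; elim: n => [|n IH] /=; first exact: bmf_cst.
apply: bmf_max; first exact: bmf_cst.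
by apply: bmfD => //; exact: (bmf_comp _ IH).
Qed.

(** Garsia's argument. Where [M = bmax f n] is positive, [M x <= f x + M (T x)]; elsewhere
    [M x = 0 <= M (T x)]. So [M - M \o T], whose mean is zero by invariance, lies below the
    integrand. *)
Lemma maximal_ergodic f n : bmf f ->
  0 <= Ex mu (fun x => f x * \1_[set y | 0 < bmax f n y] x).
Proof.
move=> bf; have bM := bmf_bmax n bf.
have mA : measurable [set y | 0 < bmax f n y].
  exact: measurable_gt (proj1 bM).
apply: (@le_trans _ _ (Ex mu (fun x => bmax f n x - bmax f n (T x)))).
  rewrite ExB//; last exact: (bmf_comp _ bM).
  have -> : Ex mu (fun x => bmax f n (T x)) = Ex mu (bmax f n).
    exact: (Ex_comp mpT bM).
  by rewrite subrr.
apply: le_Ex; first by apply: bmfB => //; exact: (bmf_comp _ bM).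
  exact: (bmf_mulb mA bf).
move=> x; rewrite indicE; have [h|h] := ltP 0 (bmax f n x).
  rewrite mem_set// mulr1; case: n h {bM mA} => [|n h]; first by rewrite ltxx.
  have := bmax_nd f n (T x); move: h.
  change (bmax f n.+1 x) with (Num.max 0 (f x + bmax f n (T x))).
  by rewrite /Num.max; case: ifP => [_ _|_]; [lra|rewrite ltxx].
rewrite memNset ?mulr0//=; last by apply/negP; rewrite -leNgt.
by have := bmax_ge0 f n (T x); lra.
Qed.

(** The sets where [bmax f n] is positive increase to a set of full measure, and discarding the
    complement from the maximal inequality costs at most the bound of [f] times its measure. *)
Lemma Ex_ge0_of_bsum f : bmf f ->
  pr mu [set x | exists n, 0 < bsum f n x] = 1 -> 0 <= Ex mu f.
Proof.
move=> bf pA; have [C fC] := proj2 bf.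
pose A := [set x | exists n, 0 < bsum f n x].
pose F n := [set y | 0 < bmax f n y].
have mF n : measurable (F n) by exact: measurable_gt (proj1 (bmf_bmax n bf)).
have mA : measurable A.
  rewrite (_ : A = \bigcup_n [set x | 0 < bsum f n x]); last first.
    by apply/seteqP; split=> x [n] //= *; exists n.
  by apply: bigcup_measurable => n _; exact: measurable_gt (proj1 (bmf_bsum n bf)).
have C0 : 0 <= C by apply: le_trans (fC point).
apply/ler_addgt0Pr => e e0.
have [|||K /(_ K (leqnn _)) hK] := @pr_cvg _ _ _ mu F A (e / (C + 1)) mF mA.
- by move=> k l kl x /= h; exact: lt_le_trans (bmax_mono _ _ kl).
- by move=> x [n h]; exists n => //=; exact: lt_le_trans (bsum_le_bmax _ _ _).
- by rewrite divr_gt0//; lra.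
rewrite pA in hK.
apply: le_trans (maximal_ergodic K bf) _.
apply: (@le_trans _ _ (Ex mu (fun x => f x + C * \1_(~` F K) x))).
  apply: le_Ex.
  - exact: (bmf_mulb (mF K) bf).
  - apply: bmfD => //; apply: bmfZ; apply: bmf_indic; exact: measurableC.
  - move=> x; rewrite !indicE in_setC.
    have := fC x; rewrite ler_norml => /andP[? ?].
    by case: (_ \in _) => /=; lra.
have bC : bmf (\1_(~` F K) : X -> R) by apply: bmf_indic; exact: measurableC.
rewrite ExD//; last exact: bmfZ.
rewrite ExZ// Ex_indic; last exact: measurableC.
rewrite prC// lerD2l.
apply: (@le_trans _ _ (C * (e / (C + 1)))).
  by apply: ler_wpM2l => //; lra.
rewrite mulrCA ger_pMr//.
by rewrite ler_pdivrMr; lra.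
Qed.

(** [B] collects the points whose averages exceed, infinitely often, some level above [c], which is
    half way between the mean and the target level. It is invariant; were it of full measure, the
    maximal inequality for [f - c] would give a mean at least [c]. So it is null, and the tail
    events [F _ N] decrease to a null set. *)
Lemma ergodic_upper f (eps : R) : bmf f -> 0 < eps -> exists N, forall n,
  (N <= n)%N -> pr mu [set x | n%:R * (Ex mu f + eps) < bsum f n x] <= eps.
Proof.
move=> bf e0.
pose F c N := \bigcup_(n in [set n | (N <= n)%N]) [set x | n%:R * c < bsum f n x].
have mF c N : measurable (F c N).
  apply: bigcup_measurable => n _.
  exact: measurable_gt (proj1 (bmf_bsum n bf)).
pose c := Ex mu f + eps / 2.
pose B := \bigcup_k \bigcap_N F (c + k.+1%:R^-1) N.
have mB : measurable B.
  by apply: bigcup_measurable => k _; exact: bigcapT_measurable.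
have [C fC] := proj2 bf.
have C0 : 0 <= C by apply: le_trans (fC point).
(* A bounded perturbation of the sums is absorbed by an arbitrarily small loss [a - b] on
   the threshold: this makes [B] exactly invariant. *)
have shift a b x y : b < a -> (forall N, F a N x) ->
    (forall n, exists2 n', ((n <= n'.+1) && (n' <= n.+1))%N &
      `|bsum f n x - bsum f n' y| <= C) ->
    forall N, F b N y.
  move=> ba Fx xy N.
  have ab : 0 < a - b by lra.
  have [K hK] : exists K : nat, C + `|b| < K%:R * (a - b).
    exists (Num.bound ((C + `|b|) / (a - b))).
    rewrite -ltr_pdivrMr//.
    by apply: archi_boundP; apply: divr_ge0; [exact: addr_ge0|exact: ltW].
  have [n /= Nn hn] := Fx (maxn N K).+1.
  have [n' /andP[nn' n'n] h] := xy n.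
  have Mn : ((maxn N K).+1 <= n)%N by [].
  exists n' => /=.
    by rewrite -ltnS; apply: leq_trans (leq_trans Mn nn'); rewrite ltnS leq_maxl.
  have : K%:R <= n%:R :> R.
    by rewrite ler_nat ltnW// (leq_trans _ Mn)// ltnS leq_maxr.
  move=> /(ler_wpM2r (ltW ab)) h2.
  have h3 : (n'%:R - n%:R) * b <= `|b|.
    rewrite (le_trans (ler_norm _))// normrM ler_piMl// ler_norml.
    have : n'%:R <= n.+1%:R :> R by rewrite ler_nat.
    have : n%:R <= n'.+1%:R :> R by rewrite ler_nat.
    by rewrite -!natr1 => *; apply/andP; split; lra.
  move: h; rewrite ler_norml => /andP[_ h].
  by move: hn hK h2 h3; rewrite !mulrBr !mulrBl; lra.
have inv : T @^-1` B = B.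
  have lt k : (c + k.+2%:R^-1 : R) < c + k.+1%:R^-1.
    by rewrite ltrD2l ltf_pV2 ?posrE ?ltr0n// ltr_nat.
  apply/seteqP; split=> x [k _ Fk]; exists k.+1 => // N _.
    apply: (shift _ _ (T x) x (lt k)) => [M|n]; first exact: Fk.
    exists n.+1; first by rewrite leqnn andbT; do 2 apply: leqW.
    by rewrite bsumS distrC addrK.
  apply: (shift _ _ x (T x) (lt k)) => [M|n]; first exact: Fk.
  case: n => [|n]; first by exists 0%N => //; rewrite /bsum !big_ord0 subrr normr0.
  exists n; first by rewrite leqnn/=; do 2 apply: leqW.
  by rewrite bsumS addrK.
have B0 : pr mu B = 0.
  have [|B0|B1] := ergT mB; first by rewrite inv /symdiff setDv setU0 measure0.
    by rewrite /pr B0.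
  exfalso; suff : 0 <= Ex mu (fun x => f x - c).
    by rewrite ExB ?Ex_cst /c//; [lra|exact: bmf_cst].
  have bg : bmf (fun x => f x - c) by apply: bmfB => //; exact: bmf_cst.
  apply: Ex_ge0_of_bsum => //; apply/eqP.
  have mD : measurable [set x | exists n, 0 < bsum (fun y => f y - c) n x].
    rewrite (_ : [set _ | _] = \bigcup_n [set x | 0 < bsum (fun y => f y - c) n x]).
      apply: bigcup_measurable => n _; exact: measurable_gt (proj1 (bmf_bsum n bg)).
    by apply/seteqP; split=> x [n] //= *; exists n.
  rewrite eq_le pr_le1//=.
  apply: (@le_trans _ _ (pr mu B)); first by rewrite /pr B1.
  apply: le_pr => // x [k _ /(_ 0%N I)[n _ /= h]]; exists n.
  rewrite bsum_sub subr_gt0; apply: le_lt_trans h; apply: ler_wpM2l => //.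
  by rewrite lerDl invr_ge0.
have [k hk] : exists k : nat, k.+1%:R^-1 < eps / 2 :> R.
  have e20 : 0 < eps / 2 by lra.
  have [k _ hk] := near_infty_natSinv_lt (PosNum e20).
  by exists k; exact: (hk k (leqnn k)).
have cap0 : pr mu (\bigcap_N F (Ex mu f + eps) N) = 0.
  apply/eqP; rewrite eq_le pr_ge0 andbT -B0.
  have mc : measurable (\bigcap_N F (Ex mu f + eps) N) by exact: bigcapT_measurable.
  apply: le_pr => // x Fx; exists k => // N _; have [n Nn h] := Fx N I.
  exists n => //; apply: le_lt_trans h; apply: ler_wpM2l => //.
  by rewrite /c; move: hk; set u := _^-1; lra.
pose A := \bigcap_N F (Ex mu f + eps) N.
have mA : measurable A by exact: bigcapT_measurable.
(* [pr_cvg0] asks for an empty intersection, so the null intersection [A] is removed first. *)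
have [|||N hN] := @pr_cvg0 _ _ _ mu (fun N => F (Ex mu f + eps) N `\` A) eps _ _ _ e0.
- by move=> N; exact: measurableD.
- by move=> N M NM x [[n /= Mn h] nA]; split => //; exists n => //=; exact: leq_trans Mn.
- move=> x; have [xA|xA] := pselect (A x); first by exists 0%N; case.
  by move: xA => /existsNP[N /not_implyP[_ h]]; exists N; case.
exists N => n Nn.
apply: (@le_trans _ _ (pr mu A + pr mu (F (Ex mu f + eps) N `\` A))); last first.
  by rewrite cap0 add0r; exact: hN.
apply: le_prU => //; first exact: measurableD.
  exact: measurable_gt (proj1 (bmf_bsum n bf)).
move=> x h; have [|xA] := pselect (A x); [by left|right; split => //].
by exists n.
Qed.

Lemma ergodic_theorem f (eps : R) : bmf f -> 0 < eps -> exists N, forall n,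
  (N <= n)%N ->
  pr mu [set x | n%:R * eps < `|bsum f n x - n%:R * Ex mu f|] <= eps.
Proof.
move=> bf e0; have e20 : 0 < eps / 2 by lra.
have [N1 h1] := ergodic_upper bf e20.
have [N2 h2] := ergodic_upper (bmfN bf) e20.
exists (maxn N1 N2) => n; rewrite geq_max => /andP[/h1 {}h1 /h2 {}h2].
have bS := bmf_bsum n bf; have bS' := bmf_bsum n (bmfN bf).
have -> : eps = eps / 2 + eps / 2 by lra.
apply: le_trans (lerD h1 h2).
apply: le_prU; [exact: measurable_gt (proj1 bS)|exact: measurable_gt (proj1 bS')| |].
  apply: measurable_gt; apply: (proj1 (bmf_norm _)).
  by apply: bmfB => //; exact: bmf_cst.
move=> x /=; rewrite bsum_opp ExN//.
have : 0 <= n%:R * eps by rewrite mulr_ge0// ltW.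
rewrite !mulrDr mulrN; case: (ler0P (bsum f n x - _)) => _ ? ?; [right|left]; lra.
Qed.

End Birkhoff.

(** * Itineraries and their laws *)

Section Asymptotics.
Context {R : realType}.

Lemma eventually_linear (C a : R) : 0 < a ->
  exists N : nat, forall n, (N <= n)%N -> C <= n%:R * a.
Proof.
move=> a0; exists (Num.bound (`|C| / a)) => n Nn.
rewrite -ler_pdivrMr//; apply: le_trans (_ : `|C| / a <= _).
  by rewrite ler_pM2r ?invr_gt0// ler_norm.
apply/ltW/(lt_le_trans (archi_boundP _)); first exact: divr_ge0 (ltW a0).
by rewrite ler_nat.
Qed.

Lemma expRN_small (a e : R) : 0 < a -> 0 < e ->
  exists N : nat, forall n, (N <= n)%N -> expR (- (n%:R * a)) <= e.
Proof.
move=> a0 e0; have [N hN] := eventually_linear e^-1 a0.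
exists N => n /hN h; rewrite expRN -[leRHS]invrK lef_pV2 ?posrE ?expR_gt0 ?invr_gt0//.
by apply: le_trans h (le_trans _ (expR_ge1Dx _)); rewrite lerDr.
Qed.

Lemma le_sum_subset (I : eqType) (l l' : seq I) (F : I -> R) :
  uniq l -> uniq l' -> {subset l <= l'} -> (forall i, 0 <= F i) ->
  \sum_(i <- l) F i <= \sum_(i <- l') F i.
Proof.
move=> ul ul' ll' F0.
rewrite (perm_big [seq i <- l' | i \in l]); last first.
  apply: uniq_perm => //; first exact: filter_uniq.
  by move=> i; rewrite mem_filter; case il: (i \in l) => //=; rewrite ll'.
rewrite big_filter [leLHS]big_mkcond; apply: ler_sum => i _.
by case: ifP.
Qed.

End Asymptotics.

Section AllNames.
Context {L : eqType}.

Fixpoint allnames (ls : seq L) n : seq (seq L) :=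
  if n is n'.+1 then [seq a :: s | s <- allnames ls n', a <- ls] else [:: [::]].

Lemma mem_allnames ls n s :
  (s \in allnames ls n) = (size s == n) && all (mem ls) s.
Proof.
elim: n s => [|n IH] [|a s] //=.
  by apply/negbTE/negP => /allpairsP[[? ?] []].
apply/allpairsP/idP => [[[s' a'] /= [+ a'l [-> ->]]]|].
  by rewrite IH eqSS => /andP[-> ->]; rewrite a'l.
by rewrite eqSS => /and3P[sn al sl]; exists (s, a); split => //=; rewrite IH sn.
Qed.

Lemma allnames_uniq ls n : uniq ls -> uniq (allnames ls n).
Proof.
move=> ul; elim: n => [//|n IH] /=; apply: allpairs_uniq => //.
by move=> [s a] [s' a'] _ _ /= [-> ->].
Qed.

Lemma sum_allnamesS {R : realType} ls n (F : seq L -> R) :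
  \sum_(s <- allnames ls n.+1) F s =
  \sum_(s <- allnames ls n) \sum_(a <- ls) F (a :: s).
Proof. by rewrite /= big_allpairs_dep. Qed.

End AllNames.

Section Subprobability.
Context {R : realType} {L : eqType}.

(** Total mass at most one on words of length [n], tested on finite lists so that an infinite
    alphabet raises no question of summability. *)
Definition subprob n (Q : seq L -> R) := forall l, uniq l ->
  all (fun s => size s == n) l -> \sum_(s <- l) Q s <= 1.

(** A finite list of words uses finitely many letters, so it is contained in the set of all words
    over a finite alphabet. *)
Lemma subprob_allnames n (Q : seq L -> R) : (forall s, 0 <= Q s) ->
  (forall ls, uniq ls -> \sum_(s <- allnames ls n) Q s <= 1) -> subprob n Q.
Proof.
move=> Q0 hQ l ul sl.
apply: le_trans (hQ (undup (flatten l)) (undup_uniq _)).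
apply: le_sum_subset => // [|s sl'].
  by apply: allnames_uniq; exact: undup_uniq.
rewrite mem_allnames (allP sl)//=; apply/allP => a as'.
by rewrite /= mem_undup; apply/flattenP; exists s.
Qed.

(** The weight of a word drawn from its last letter backwards: [r s' a] is the conditional weight of
    [a] given the word [s'] that follows it. *)
Fixpoint kprod (r : seq L -> L -> R) s : R :=
  if s is a :: s' then r s' a * kprod r s' else 1.

Definition subkernel (S : Type) (r : S -> L -> R) :=
  (forall s a, 0 <= r s a) /\
  (forall s ls, uniq ls -> \sum_(a <- ls) r s a <= 1).

Lemma kprod_ge0 r s : subkernel r -> 0 <= kprod r s.
Proof. by case=> r0 _; elim: s => //= a s IH; rewrite mulr_ge0. Qed.

Lemma subprob_kprod r n : subkernel r -> subprob n (kprod r).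
Proof.
move=> kr; apply: subprob_allnames => [s|ls ul]; first exact: kprod_ge0.
elim: n => [|n IH]; first by rewrite /= big_seq1.
rewrite sum_allnamesS; apply: le_trans IH; apply: ler_sum => s _ /=.
by rewrite -mulr_suml ler_piMl ?kprod_ge0// (proj2 kr).
Qed.

End Subprobability.

(** * Itineraries of a labelled map *)

Section Names.
Context {d : measure_display} {X : measurableType d} {L : countType}.
Variables (T : X -> X) (p : X -> L).

Fixpoint name n x : seq L :=
  if n is n'.+1 then p x :: name n' (T x) else [::].

Lemma size_name n x : size (name n x) = n.
Proof. by elim: n x => //= n IH x; rewrite IH. Qed.

Lemma nth_name a n j x : (j < n)%N -> nth a (name n x) j = p (iter j T x).
Proof.
elim: n j x => [//|n IH] [//|j] x jn /=; rewrite IH//.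
by rewrite -iterSr.
Qed.

Lemma eq_nameP n x y :
  name n x = name n y <-> forall j, (j < n)%N -> p (iter j T x) = p (iter j T y).
Proof.
split=> [xy j jn|xy].
  by rewrite -!(@nth_name (p x) n)// xy.
apply: (@eq_from_nth _ (p x)); rewrite ?size_name// => j jn.
by rewrite !nth_name// xy.
Qed.

Lemma take_name m n x : (m <= n)%N -> take m (name n x) = name m x.
Proof.
elim: m n x => [|m IH] [|n] x //=.
by rewrite ltnS => /IH ->.
Qed.

Lemma eq_name_iter m n j x y : (j + m <= n)%N -> name n x = name n y ->
  name m (iter j T x) = name m (iter j T y).
Proof.
move=> jmn /eq_nameP xy; apply/eq_nameP => i im; rewrite -!iterD; apply: xy.
by rewrite (leq_trans _ jmn)// addnC ltn_add2l.
Qed.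

End Names.

Section NameMeasure.
Context {R : realType} {d : measure_display} {X : measurableType d} {L : countType}.
Variables (mu : probability X R) (T : X -> X) (p : X -> L).
Hypotheses (mpT : mpreserving mu T) (mp : forall a, measurable (p @^-1` [set a])).

Notation name := (name T p).

Lemma measurable_name1 n s : measurable (name n @^-1` [set s]).
Proof.
elim: n s => [|n IH] s /=.
  case: s => [|a s].
    by rewrite (_ : _ @^-1` _ = setT)//; apply/seteqP; split.
  by rewrite (_ : _ @^-1` _ = set0)//; apply/seteqP; split.
case: s => [|a s]; first by rewrite (_ : _ @^-1` _ = set0)//; apply/seteqP; split.
rewrite (_ : _ @^-1` _ = p @^-1` [set a] `&` T @^-1` (name n @^-1` [set s])).
  apply: measurableI => //; rewrite -[X in measurable X]setTI.
  exact: (proj1 mpT).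
by apply/seteqP; split=> x /= [-> ->].
Qed.

Lemma measurable_name n (Y : set (seq L)) : measurable (name n @^-1` Y).
Proof. exact: (@countable_fiber_measurable _ _ _ _ (@measurable_name1 n)). Qed.

Lemma measurable_fun_name n d' (Y : measurableType d') (phi : seq L -> Y) :
  measurable_fun setT (fun x => phi (name n x)).
Proof.
move=> _ B _; rewrite setTI.
exact: (@measurable_name n [set s | B (phi s)]).
Qed.

Definition pname (s : seq L) : R := pr mu (name (size s) @^-1` [set s]).

Lemma pname_ge0 s : 0 <= pname s. Proof. exact: pr_ge0. Qed.

Lemma pname_le1 s : pname s <= 1.
Proof. by apply: pr_le1; exact: measurable_name1. Qed.

Lemma pname_nil : pname [::] = 1.
Proof.
rewrite /pname (_ : _ @^-1` _ = setT) ?prT//.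
by apply/seteqP; split.
Qed.

(** The cells of the words [a :: s] are disjoint parts of the preimage under [T] of the cell of [s],
    which has the same measure by invariance. *)
Lemma sum_pname_cons s ls : uniq ls ->
  \sum_(a <- ls) pname (a :: s) <= pname s.
Proof.
move=> ul; rewrite /pname -(pr_preimage mpT (measurable_name1 _ _)).
apply: pr_bigcup_seq => //.
- by move=> a; exact: measurable_name1.
- by rewrite -[X in measurable X]setTI; apply: (proj1 mpT) => //; exact: measurable_name1.
- by move=> a b x /= [<- _] [].
- by move=> a _ x /= [].
Qed.

Lemma pname_cons a s : pname (a :: s) <= pname s.
Proof. by have := @sum_pname_cons s [:: a] isT; rewrite big_seq1. Qed.

Lemma sum_pname n ls : uniq ls -> \sum_(s <- allnames ls n) pname s <= 1.
Proof.
move=> ul; elim: n => [|n IH]; first by rewrite big_seq1 pname_nil.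
rewrite sum_allnamesS; apply: le_trans IH; apply: ler_sum => s _.
exact: sum_pname_cons.
Qed.

Lemma pname0_null n : pr mu [set x | pname (name n x) = 0] = 0.
Proof.
apply/eqP; rewrite eq_le pr_ge0 andbT.
apply: (@countable_pr_bound _ _ _ mu _ (name n) (fun s => size s == n) (fun=> 0)).
- exact: measurable_name1.
- exact: (@measurable_name n [set s | pname s = 0]).
- by move=> x; rewrite size_name.
- move=> s /eqP sn; have [s0|s0] := eqVneq (pname s) 0.
    apply: (@le_trans _ _ (pname s)); last by rewrite s0.
    rewrite /pname sn; apply: le_pr => [||x []//].
      apply: measurableI; last exact: measurable_name1.
      exact: (@measurable_name n [set s | pname s = 0]).
    exact: measurable_name1.
  rewrite (_ : _ `&` _ = set0) ?pr0//; apply/seteqP; split=> x //= [+ xs].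
  by rewrite xs; apply/eqP.
- by move=> l _ _; rewrite big1.
Qed.

(* Markov's inequality for the likelihood ratio of [Q] and the true law of the names *)
Lemma shannon_markov n (Q : seq L -> R) t : (forall s, 0 <= Q s) -> subprob n Q ->
  pr mu [set x | pname (name n x) < expR (- t) * Q (name n x)] <= expR (- t).
Proof.
move=> Q0 sQ.
have mB := @measurable_name n [set s | pname s < expR (- t) * Q s].
apply: (@countable_pr_bound _ _ _ mu _ (name n) (fun s => size s == n)
   (fun s => expR (- t) * Q s)) => //.
- exact: measurable_name1.
- by move=> x; rewrite size_name.
- move=> s /eqP sn; have [h|h] := ltP (pname s) (expR (- t) * Q s).
    apply: le_trans (ltW h); rewrite /pname sn; apply: le_pr => [||x []//].
      by apply: measurableI => //; exact: measurable_name1.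
    exact: measurable_name1.
  rewrite (_ : _ `&` _ = set0) ?pr0 ?mulr_ge0 ?expR_ge0//.
  apply/seteqP; split=> x //= [+ xs]; rewrite xs.
  by apply/negP; rewrite -leNgt.
- move=> l ul sl; rewrite -mulr_sumr ler_piMr ?expR_ge0//.
  exact: sQ.
Qed.

End NameMeasure.

(** * Shannon-McMillan in probability for finite partitions *)

Lemma le_Ex_ae {R : realType} {d} {X : measurableType d} (mu : probability X R)
  (f g : X -> R) (N : set X) : bmf f -> bmf g -> measurable N -> pr mu N = 0 ->
  (forall x, ~ N x -> f x <= g x) -> Ex mu f <= Ex mu g.
Proof.
move=> bf bg mN N0 fg; have [C hC] := proj2 (bmfB bf bg).
have bN : bmf (\1_N : X -> R) by exact: bmf_indic.
apply: (@le_trans _ _ (Ex mu (fun x => g x + C * \1_N x))).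
  apply: le_Ex => //; first by apply: bmfD => //; exact: bmfZ.
  move=> x; rewrite indicE; have [Nx|Nx] := pselect (N x).
    by rewrite mem_set// mulr1; have := ler_norm (f x - g x); have := hC x; lra.
  by rewrite memNset// mulr0 addr0; exact: fg.
by rewrite ExD ?ExZ ?Ex_indic// ?N0 ?mulr0 ?addr0//; exact: bmfZ.
Qed.

Section Entropy.
Context {R : realType} {d : measure_display} {X : measurableType d} {L : countType}.
Variables (mu : probability X R) (T : X -> X) (p : X -> L) (ls : seq L).
Hypotheses (mpT : mpreserving mu T) (ergT : ergodic mu T).
Hypotheses (mp : forall a, measurable (p @^-1` [set a])).
Hypotheses (uls : uniq ls) (pls : forall x, p x \in ls).

Notation name := (name T p).
Notation pname := (pname mu T p).

Lemma name_allnames n x : name n x \in allnames ls n.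
Proof.
rewrite mem_allnames size_name eqxx/=.
by elim: n x => //= n IH x; rewrite pls IH.
Qed.

Lemma bmf_name n (phi : seq L -> R) : bmf (fun x => phi (name n x)).
Proof.
split; first exact: (measurable_fun_name mpT mp).
exists (\sum_(s <- allnames ls n) `|phi s|) => x.
rewrite (big_rem (name n x)) ?name_allnames//= lerDl.
by apply: sumr_ge0 => s _; exact: normr_ge0.
Qed.

Lemma Ex_name n (phi : seq L -> R) :
  Ex mu (fun x => phi (name n x)) = \sum_(s <- allnames ls n) phi s * pname s.
Proof.
have mS s : measurable (name n @^-1` [set s]) by exact: (measurable_name1 mpT mp).
transitivity (Ex mu (fun x => \sum_(s <- allnames ls n)
    phi s * \1_(name n @^-1` [set s]) x)).
  congr Ex; apply/funext => x; have ul := allnames_uniq n uls.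
  rewrite (bigD1_seq (name n x)) ?name_allnames//= indicE mem_set// mulr1.
  rewrite big1 ?addr0// => s sx; rewrite indicE memNset ?mulr0//=.
  by apply/nesym/eqP.
rewrite Ex_sum => [|s]; last by apply: bmfZ; exact: bmf_indic.
rewrite !big_seq; apply: eq_bigr => s; rewrite mem_allnames => /andP[/eqP sn _].
by rewrite ExZ ?Ex_indic//; [rewrite /pname sn|exact: bmf_indic].
Qed.

Definition info n x : R := - ln (pname (name n x)).
Definition entropy n : R := Ex mu (info n).

Lemma bmf_info n : bmf (info n).
Proof. exact: (bmf_name n (fun s => - ln (pname s))). Qed.

Lemma info_ge0 n x : 0 <= info n x.
Proof. by rewrite oppr_ge0; apply: ln_le0; exact: pname_le1. Qed.

Lemma entropy_ge0 n : 0 <= entropy n.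
Proof. by apply: Ex_ge0 => x; exact: info_ge0. Qed.

Lemma entropy0 : entropy 0 = 0.
Proof.
rewrite /entropy -[RHS](Ex_cst mu); congr Ex; apply/funext => x.
by rewrite /info /= pname_nil ln1 oppr0.
Qed.

(* Names grow at their head, so this order-[l] Markov approximation conditions each symbol
   on the [l] symbols that follow it. *)
Definition markov_kernel l s a := pname (a :: take l s) / pname (take l s).

Lemma subkernel_markov l : subkernel (markov_kernel l).
Proof.
split=> [s a|s as_ uas]; first by rewrite divr_ge0 ?pname_ge0.
rewrite -mulr_suml; have [s0|s0] := eqVneq (pname (take l s)) 0.
  by rewrite s0 invr0 mulr0.
rewrite ler_pdivrMr ?mul1r; first exact: sum_pname_cons.
by rewrite lt_neqAle eq_sym s0 pname_ge0.
Qed.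

(** Up to the length of the memory the conditional probabilities telescope. Division by zero is
    harmless: if a word is null, so is every word extending it at the head. *)
Lemma kprod_markov_short l s : (size s <= l)%N ->
  kprod (markov_kernel l) s = pname s.
Proof.
elim: s => [|a s IH] /= sl; first by rewrite pname_nil.
rewrite IH ?(ltnW sl)// /markov_kernel take_oversize ?(ltnW sl)//.
have [s0|s0] := eqVneq (pname s) 0; last by rewrite divfK.
by rewrite s0 mulr0; apply/eqP; rewrite eq_le pname_ge0 -s0 pname_cons.
Qed.

Lemma pname_iter_gt0 n x : 0 < pname (name n.+1 x) -> 0 < pname (name n (T x)).
Proof. by move=> h; apply: lt_le_trans h _; exact: pname_cons. Qed.

Definition cond_info l x := info l.+1 x - info l (T x).
(** Minus the logarithm of the order-[l] Markov weight of the itinerary of length [n + l]: the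
    information of its last [l] symbols plus a Birkhoff sum, to which the ergodic theorem
    applies. *)
Definition markov_info l n x := info l (iter n T x) + bsum T (cond_info l) n x.

Lemma bmf_cond_info l : bmf (cond_info l).
Proof.
by apply: bmfB; [exact: bmf_info|exact: bmf_comp (proj1 mpT) (bmf_info l)].
Qed.

Lemma bmf_markov_info l n : bmf (markov_info l n).
Proof.
apply: bmfD; last exact/(bmf_bsum mpT)/bmf_cond_info.
by apply: bmf_comp (bmf_info l); exact: (measurable_iter mpT).
Qed.

Lemma Ex_cond_info l : Ex mu (cond_info l) = entropy l.+1 - entropy l.
Proof.
rewrite ExB; [|exact: bmf_info|exact: bmf_comp (proj1 mpT) (bmf_info l)].
by rewrite -[X in _ - X]/(Ex mu (info l \o T)) (Ex_comp mpT (bmf_info l)).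
Qed.

Lemma Ex_markov_info l n : Ex mu (markov_info l n) =
  entropy l + n%:R * (entropy l.+1 - entropy l).
Proof.
have bi : bmf (info l \o iter n T).
  by apply: bmf_comp (bmf_info l); exact: (measurable_iter mpT).
rewrite ExD//; last exact/(bmf_bsum mpT)/bmf_cond_info.
rewrite (Ex_bsum mpT _ (bmf_cond_info l)) Ex_cond_info.
by rewrite -[X in X + _]/(Ex mu (info l \o iter n T)) (Ex_iter mpT n (bmf_info l)).
Qed.

Lemma kprod_markov l n x : 0 < pname (name (n + l) x) ->
  kprod (markov_kernel l) (name (n + l) x) = expR (- markov_info l n x).
Proof.
elim: n x => [|n IH] x px.
  rewrite add0n kprod_markov_short ?size_name// /markov_info /bsum big_ord0.
  by rewrite addr0 /info opprK lnK.
rewrite addSn /= IH ?pname_iter_gt0// /markov_kernel.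
rewrite take_name ?leq_addl// -/(name l.+1 x).
(* Dropping letters at the end of a word can only enlarge its cell, so a prefix of a word of
   positive probability has positive probability; the logarithms can then be inverted. *)
have p1 : 0 < pname (name l.+1 x).
  have : (l.+1 <= n.+1 + l)%N by rewrite addSn ltnS leq_addl.
  move=> /(@take_name _ _ _ T p) <-; move: px; rewrite addSn /=.
  move: (name (n + l) (T x)) => s.
  have {}IH s' b : pname (rcons s' b) <= pname s'.
    rewrite /pname size_rcons; apply: le_pr => [||y ys].
    - exact: (measurable_name1 mpT mp).
    - exact: (measurable_name1 mpT mp).
    - have := @take_name _ _ _ T p (size s') (size s').+1 y (leqnSn _).
      rewrite (ys : name (size s').+1 y = _) -cats1.
      by rewrite take_size_cat// => <-.
  elim/last_ind: s => [|s b IHs] //; rewrite -rcons_cons => h.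
  have := IHs (lt_le_trans h (IH _ _)).
  move=> h1; rewrite -cats1; case: (ltnP l (size s)) => ls'.
    by rewrite takel_cat // ltnW.
  move: ls'; rewrite leq_eqVlt => /orP[/eqP <-|ls'].
    by rewrite take_size_cat//; exact: lt_le_trans h (IH _ _).
  by rewrite take_oversize ?cats1 // size_rcons.
have p2 := pname_iter_gt0 p1.
have -> : markov_info l n.+1 x = cond_info l x + markov_info l n (T x).
  by rewrite /markov_info bsumS iterSr addrCA.
rewrite [in RHS]opprD [in RHS]expRD; congr (_ * _).
by rewrite /cond_info /info opprB opprK addrC expRD expRN !lnK.
Qed.

(** This is [shannon_markov] for the Markov approximation, whose weight is
    [expR (- markov_info l n x)] off the null words. *)
Lemma markov_info_upper l n t :
  pr mu [set x | markov_info l n x + t < info (n + l) x] <= expR (- t).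
Proof.
have mW := proj1 (bmf_markov_info l n); have mY := proj1 (bmf_info (n + l)).
have mN : measurable [set x | pname (name (n + l) x) = 0].
  exact: (measurable_name mpT mp _ [set s | pname s = 0]).
have mB : measurable [set x | pname (name (n + l) x) <
    expR (- t) * kprod (markov_kernel l) (name (n + l) x)].
  exact: (measurable_name mpT mp _ [set s | pname s < expR (- t) * kprod _ s]).
have Q0 s := kprod_ge0 s (subkernel_markov l).
apply: le_trans (shannon_markov mpT mp t Q0 (subprob_kprod (subkernel_markov l) (n := n + l))).
rewrite -[leRHS]add0r -(pname0_null mpT mp (n + l)); apply: le_prU => //.
  have m1 : measurable_fun setT (fun x => info (n + l) x - markov_info l n x).
    exact: measurable_funB.
  rewrite (_ : [set _ | _] = [set x | t < info (n + l) x - markov_info l n x]).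
    exact: measurable_gt m1.
  by apply/seteqP; split=> x /=; rewrite ltrBrDl.
move=> x /= h; have [p0|p0] := eqVneq (pname (name (n + l) x)) 0; [by left|right].
have px : 0 < pname (name (n + l) x) by rewrite lt_neqAle eq_sym p0 pname_ge0.
rewrite kprod_markov// -expRD -[ltLHS](lnK px) ltr_expR.
by move: h; rewrite /info; lra.
Qed.

(** The ratio of the Markov weight to the true probability has mean at most one, and
    [Num.max 0 u <= expR u] for its logarithm [u]. *)
Lemma Ex_markov_excess l n :
  Ex mu (fun x => Num.max 0 (info (n + l) x - markov_info l n x)) <= 1.
Proof.
pose phi s := kprod (markov_kernel l) s / pname s.
apply: (@le_trans _ _ (Ex mu (fun x => phi (name (n + l) x)))).
  have mN : measurable [set x | pname (name (n + l) x) = 0].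
    exact: (measurable_name mpT mp _ [set s | pname s = 0]).
  apply: (le_Ex_ae _ _ mN (pname0_null mpT mp (n + l))).
  - apply: bmf_max; first exact: bmf_cst.
    by apply: bmfB; [exact: bmf_info|exact: bmf_markov_info].
  - exact: bmf_name.
  - move=> x /= /eqP p0.
    have px : 0 < pname (name (n + l) x) by rewrite lt_neqAle eq_sym p0 pname_ge0.
    rewrite /phi kprod_markov// -[X in _ / X](lnK px) -expRN -expRD.
    rewrite ge_max expR_ge0/= addrC.
    by apply: le_trans (expR_ge1Dx _); rewrite lerDr.
rewrite Ex_name; have sQ := subprob_kprod (subkernel_markov l) (n := n + l).
apply: le_trans (sQ (allnames ls (n + l)) (allnames_uniq _ uls) _).
  apply: ler_sum => s _; rewrite /phi -mulrA ler_piMr ?kprod_ge0//.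
    exact: subkernel_markov.
  have [->|s0] := eqVneq (pname s) 0; first by rewrite mulr0.
  by rewrite mulVf.
by apply/allP => s; rewrite mem_allnames => /andP[].
Qed.

(** The negative part of a variable is its positive part minus the variable: the mean deficit is the
    difference of the means plus the mean excess, and the latter is at most 1. *)
Lemma Ex_markov_deficit l n :
  Ex mu (fun x => Num.max 0 (markov_info l n x - info (n + l) x)) <=
  entropy l + n%:R * (entropy l.+1 - entropy l) - entropy (n + l) + 1.
Proof.
have bW := bmf_markov_info l n; have bY := bmf_info (n + l).
have bE : bmf (fun x => Num.max 0 (info (n + l) x - markov_info l n x)).
  by apply: bmf_max; [exact: bmf_cst|exact: bmfB].
apply: le_trans (lerD (lexx _) (Ex_markov_excess l n)).
rewrite -Ex_markov_info -ExB// -ExD//; last exact: bmfB.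
apply: le_Ex.
- by apply: bmf_max; [exact: bmf_cst|exact: bmfB].
- by apply: bmfD => //; exact: bmfB.
- by move=> x; rewrite /Num.max; do 2 case: ifP => //; lra.
Qed.

(** Being below every increment, this number gives [n%:R * entropy_rate <= entropy n] by summation;
    an increment close to it gives the matching upper bound through [entropy_le]. Thus it is the
    usual limit, see [cvg_entropy]. *)
Definition entropy_rate : R := inf (range (fun l => entropy l.+1 - entropy l)).

Lemma entropy_le l n :
  entropy (n + l) <= entropy l + n%:R * (entropy l.+1 - entropy l) + 1.
Proof.
have : 0 <= Ex mu (fun x => Num.max 0 (markov_info l n x - info (n + l) x)).
  by apply: Ex_ge0 => x; rewrite le_max lexx.
by move=> h; have := Ex_markov_deficit l n; lra.
Qed.

(** By [entropy_le] a negative increment would force [entropy] to become negative along large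
    orders. *)
Lemma entropy_incr_ge0 l : 0 <= entropy l.+1 - entropy l.
Proof.
rewrite leNgt; apply/negP => h.
have a0 : 0 < - (entropy l.+1 - entropy l) by lra.
have [N /(_ N (leqnn _)) hN] := eventually_linear (entropy l + 2) a0.
by have := entropy_le l N; have := entropy_ge0 (N + l); lra.
Qed.

Lemma has_inf_entropy_incr :
  has_inf (range (fun l => entropy l.+1 - entropy l)).
Proof.
split; first by exists (entropy 1 - entropy 0), 0%N.
by exists 0 => _ [l _ <-]; exact: entropy_incr_ge0.
Qed.

Lemma entropy_rate_le l : entropy_rate <= entropy l.+1 - entropy l.
Proof. by apply: ge_inf; [exact: (proj2 has_inf_entropy_incr)|exists l]. Qed.

Lemma entropy_rate_adherent e : 0 < e ->
  exists l, entropy l.+1 - entropy l < entropy_rate + e.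
Proof.
move=> e0; have [_ [l _ <-] h] := inf_adherent e0 has_inf_entropy_incr.
by exists l.
Qed.

Lemma entropy_rate_lower n : n%:R * entropy_rate <= entropy n.
Proof.
elim: n => [|n IH]; first by rewrite mul0r entropy0.
by rewrite -natr1 mulrDl mul1r; have := entropy_rate_le n; lra.
Qed.

Lemma cvg_entropy :
  (fun n => n.+1%:R^-1 * entropy n.+1) @ \oo --> entropy_rate.
Proof.
apply/cvgrPdist_le => e e0.
have [l hl] := @entropy_rate_adherent (e / 2) ltac:(lra).
have e20 : 0 < e / 2 by lra.
have [N hN] := eventually_linear (entropy l + 1) e20.
exists (N + l)%N => // n /= Nln.
have n0 : 0 < n.+1%:R :> R by rewrite ltr0n.
rewrite distrC ler_norml; apply/andP; split.
  rewrite lerBrDl mulrC ler_pdivlMr//.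
  have := entropy_rate_lower n.+1.
  have : 0 <= e * n.+1%:R by rewrite mulr_ge0// ltW.
  by rewrite mulrBl; lra.
rewrite lerBlDl mulrC ler_pdivrMr//.
have ln : (l <= n.+1)%N by rewrite leqW// (leq_trans _ Nln)// leq_addl.
have := entropy_le l (n.+1 - l); rewrite subnK//.
have := hN n.+1 (leqW (leq_trans (leq_addr _ _) Nln)).
have : (n.+1 - l)%:R * (entropy l.+1 - entropy l) <=
   n.+1%:R * (entropy_rate + e / 2).
  apply: ler_pM => //; [exact: entropy_incr_ge0| |exact: ltW].
  by rewrite ler_nat leq_subr.
by rewrite !mulrDr mulrDl; lra.
Qed.

(** For a memory [l] whose increment is close to the rate, the information exceeds [markov_info] by
    more than [n%:R * (e / 4)] with exponentially small probability only, and the Birkhoff sum in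
    [markov_info] is close to its mean. *)
Lemma smb_upper (e : R) : 0 < e -> exists N, forall n, (N <= n)%N ->
  pr mu [set x | n%:R * (entropy_rate + e) < info n x] <= e.
Proof.
move=> e0; have e4 : 0 < e / 4 by lra.
have [l hl] := entropy_rate_adherent e4.
have [C hC] := proj2 (bmf_info l).
have [N1 hN1] := ergodic_theorem mpT ergT (bmf_cond_info l) e4.
have [N2 hN2] := eventually_linear C e4.
have [N3 hN3] := expRN_small e4 e4.
have h0 : 0 <= entropy_rate.
  by apply: lb_le_inf (proj1 has_inf_entropy_incr) _ => _ [m _ <-]; exact: entropy_incr_ge0.
exists (maxn N1 (maxn N2 N3) + l)%N => n' nn'.
have [n nE] : exists n, n' = (n + l)%N.
  by exists (n' - l)%N; rewrite subnK// (leq_trans _ nn')// leq_addl.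
move: nn'; rewrite {n'}nE leq_add2r !geq_max => /and3P[/hN1 {}hN1 /hN2 {}hN2 /hN3 {}hN3].
have := markov_info_upper l n (n%:R * (e / 4)).
set B1 := [set x | _]; set B2 := [set x | _] in hN1 => hB1.
have mB1 : measurable B1.
  have m1 : measurable_fun setT (fun x => info (n + l) x - markov_info l n x).
    by apply: measurable_funB; [exact: proj1 (bmf_info _)|exact: proj1 (bmf_markov_info _ _)].
  rewrite (_ : B1 = [set x | n%:R * (e / 4) < info (n + l) x - markov_info l n x]).
    exact: measurable_gt m1.
  by apply/seteqP; split=> x; rewrite /B1/= ltrBrDl.
have mB2 : measurable B2.
  apply: measurable_gt; apply: (proj1 (bmf_norm _)); apply: bmfB; last exact: bmf_cst.
  exact: (bmf_bsum mpT) (bmf_cond_info l).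
apply: (@le_trans _ _ (pr mu B1 + pr mu B2)); last by lra.
apply: le_prU => //; first exact: measurable_gt (proj1 (bmf_info _)).
move=> x /= h; have [|nB1] := pselect (B1 x); [by left|right].
rewrite /B2 /= Ex_cond_info ltNge; apply/negP => h2; apply: nB1; rewrite /B1/=.
apply: le_lt_trans h; rewrite /markov_info.
have := hC (iter n T x); rewrite ler_norml => /andP[_ h3].
move: h2; rewrite ler_norml => /andP[_ h2].
have : n%:R * (entropy l.+1 - entropy l) <= n%:R * (entropy_rate + e / 4).
  by apply: ler_wpM2l => //; exact: ltW.
have : 0 <= l%:R * (entropy_rate + e) by rewrite mulr_ge0//; lra.
by rewrite natrD mulrDl !mulrDr; lra.
Qed.

(** The ergodic theorem bounds [markov_info] from below; that the information is not much smaller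
    follows from its small mean deficit by Markov's inequality. *)
Lemma smb_lower (e : R) : 0 < e -> exists N, forall n, (N <= n)%N ->
  pr mu [set x | info n x < n%:R * (entropy_rate - e)] <= e.
Proof.
move=> e0; have e4 : 0 < e / 4 by lra.
(* The increment and the bounded terms each contribute [n%:R * (e * e / 16)] to the mean deficit;
   dividing by the level [n%:R * (e / 4)] leaves probability [e / 2]. *)
have e16 : 0 < e * e / 16 by rewrite divr_gt0// mulr_gt0.
have [l hl] := entropy_rate_adherent e16.
have [N1 hN1] := ergodic_theorem mpT ergT (bmf_cond_info l) e4.
have h0 : 0 <= entropy_rate.
  by apply: lb_le_inf (proj1 has_inf_entropy_incr) _ => _ [m _ <-]; exact: entropy_incr_ge0.
have [N2 hN2] := eventually_linear (l%:R * entropy_rate) e4.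
have [N3 hN3] := eventually_linear (entropy l + 1) e16.
exists (maxn 1 (maxn N1 (maxn N2 N3)) + l)%N => n' nn'.
have [n nE] : exists n, n' = (n + l)%N.
  by exists (n' - l)%N; rewrite subnK// (leq_trans _ nn')// leq_addl.
move: nn'; rewrite {n'}nE leq_add2r !geq_max => /and4P[n0 /hN1 {}hN1 /hN2 {}hN2 /hN3 {}hN3].
have {}n0 : 0 < n%:R :> R by rewrite ltr0n.
have bW := bmf_markov_info l n; have bY := bmf_info (n + l).
have bD : bmf (fun x => Num.max 0 (markov_info l n x - info (n + l) x)).
  by apply: bmf_max; [exact: bmf_cst|exact: bmfB].
have := @markov_pr _ _ _ mu _ (n%:R * (e / 4)) bD _ _.
set B1 := [set x | _]; set B2 := [set x | _] in hN1 => hB1.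
have {}hB1 : pr mu B1 <= e / 2.
  apply: le_trans (hB1 _ _) _; first by move=> x; rewrite le_max lexx.
    exact: mulr_gt0.
  rewrite ler_pdivrMr ?mulr_gt0//; apply: le_trans (Ex_markov_deficit l n) _.
  have := entropy_rate_lower (n + l).
  have : n%:R * (entropy l.+1 - entropy l) <= n%:R * (entropy_rate + e * e / 16).
    by apply: ler_wpM2l; [exact: ltW|exact: ltW].
  have : 0 <= l%:R * entropy_rate by rewrite mulr_ge0.
  have -> : e / 2 * (n%:R * (e / 4)) = n%:R * (e * e / 16) + n%:R * (e * e / 16) by field.
  by rewrite natrD mulrDl !mulrDr; lra.
have mB1 : measurable B1 by exact: measurable_gt (proj1 bD).
have mB2 : measurable B2.
  apply: measurable_gt; apply: (proj1 (bmf_norm _)); apply: bmfB; last exact: bmf_cst.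
  exact: (bmf_bsum mpT) (bmf_cond_info l).
apply: (@le_trans _ _ (pr mu B1 + pr mu B2)); last by lra.
apply: le_prU => //; first exact: measurable_lt (proj1 bY).
move=> x /= h; have [|nB1] := pselect (B1 x); [by left|right].
rewrite /B2 /= Ex_cond_info ltNge; apply/negP => h2; apply: nB1; rewrite /B1/=.
rewrite lt_max; apply/orP; right.
move: h2; rewrite ler_norml => /andP[h2 _].
have := info_ge0 l (iter n T x); rewrite /markov_info.
have : n%:R * entropy_rate <= n%:R * (entropy l.+1 - entropy l).
  by apply: ler_wpM2l; [exact: ltW|exact: entropy_rate_le].
have : 0 <= l%:R * e by rewrite mulr_ge0// ltW.
have : 0 < n%:R * (e / 4) by rewrite mulr_gt0.
by move: h; rewrite natrD mulrDl !mulrDr; lra.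
Qed.

End Entropy.

(** * Information of one partition relative to another *)

Section Comparison.
Context {R : realType} {d : measure_display} {X : measurableType d}.
Variables (mu : probability X R) (T : X -> X).
Hypothesis mpT : mpreserving mu T.

Lemma le_pname {L L' : countType} (p : X -> L) (q : X -> L') n m x :
  (forall a, measurable (p @^-1` [set a])) ->
  (forall a, measurable (q @^-1` [set a])) ->
  (forall y, name T p n y = name T p n x -> name T q m y = name T q m x) ->
  pname mu T p (name T p n x) <= pname mu T q (name T q m x).
Proof.
move=> mp mq h; rewrite /pname !size_name; apply: le_pr => //.
- exact: (measurable_name1 mpT mp).
- exact: (measurable_name1 mpT mq).
Qed.

Lemma bsum_markov f (a : R) n : bmf f -> (forall x, 0 <= f x) -> 0 < a ->
  (0 < n)%N -> pr mu [set x | n%:R * a < bsum T f n x] <= Ex mu f / a.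
Proof.
move=> bf f0 a0 n0; have n0' : 0 < n%:R :> R by rewrite ltr0n.
apply: le_trans (markov_pr mu (bmf_bsum mpT n bf) _ _) _.
- by move=> x; apply: sumr_ge0.
- exact: mulr_gt0.
rewrite (Ex_bsum mpT n bf) ler_pdivrMr ?mulr_gt0//.
by rewrite le_eqVlt; apply/orP; left; apply/eqP; field; lra.
Qed.

Lemma pr_iter_null (N : set X) n : measurable N -> pr mu N = 0 ->
  pr mu [set x | exists2 j, (j < n)%N & N (iter j T x)] = 0.
Proof.
move=> mN N0; apply/eqP; rewrite eq_le pr_ge0 andbT.
have mi j : measurable (iter j T @^-1` N) by exact: (preimage_iter_measurable mpT).
apply: le_trans (le_pr_bigcup_seq mu (l := iota 0 n) (F := fun j => iter j T @^-1` N) mi _ _) _.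
- rewrite (_ : [set _ | _] = \bigcup_(j in [set j | (j < n)%N]) iter j T @^-1` N).
    by apply: bigcup_measurable.
  by apply/seteqP; split=> x [j jn Nj]; exists j.
- by move=> x /= [j jn Nj]; exists j => //; rewrite mem_iota.
- by rewrite big1// => j _; rewrite (pr_iter mpT).
Qed.

End Comparison.

Section Relative.
Context {R : realType} {d : measure_display} {X : measurableType d}.
Context {A B : countType}.
Variables (mu : probability X R) (T : X -> X) (al : X -> A) (be : X -> B).
Hypothesis mpT : mpreserving mu T.
Hypotheses (mal : forall a, measurable (al @^-1` [set a])).
Hypotheses (mbe : forall b, measurable (be @^-1` [set b])).
Variable r : B -> A -> R.
Hypothesis kr : subkernel r.

Definition joint x := (al x, be x).

Lemma measurable_joint c : measurable (joint @^-1` [set c]).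
Proof.
case: c => a b; rewrite (_ : _ @^-1` _ = al @^-1` [set a] `&` be @^-1` [set b]).
  exact: measurableI.
by apply/seteqP; split=> x; rewrite /joint /= => -[-> ->].
Qed.

Definition rprod (s : seq (A * B)) : R := \prod_(c <- s) r c.2 c.1.

Lemma rprod_ge0 s : 0 <= rprod s.
Proof. by apply: prodr_ge0 => c _; exact: (proj1 kr). Qed.

(** The weight [w] is arbitrary so that the induction can absorb the first letter of the [B]-word
    into it. *)
Lemma sum_rprod as_ bs (w : seq B -> R) n : uniq as_ -> (forall u, 0 <= w u) ->
  \sum_(s <- allnames [seq (a, b) | b <- bs, a <- as_] n)
     w (map snd s) * rprod s <= \sum_(u <- allnames bs n) w u.
Proof.
move=> ua; elim: n w => [|n IH] w w0.
  by rewrite /= !big_seq1 /= /rprod big_nil mulr1.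
rewrite !sum_allnamesS.
apply: le_trans (IH (fun u => \sum_(b <- bs) w (b :: u)) _); last first.
  by move=> u; apply: sumr_ge0.
apply: ler_sum => s _; rewrite big_allpairs_dep mulr_suml.
apply: ler_sum => b _; rewrite /rprod; under eq_bigr do rewrite big_cons /= mulrCA mulrC.
rewrite -mulr_sumr ler_piMr//; first by rewrite mulr_ge0//; exact: rprod_ge0.
exact: (proj2 kr).
Qed.

Lemma subprob_relative n :
  subprob n (fun s => pname mu T be (map snd s) * rprod s).
Proof.
move=> l ul sl.
pose as_ := undup (map fst (flatten l)); pose bs := undup (map snd (flatten l)).
have w0 u : 0 <= pname mu T be u by exact: pname_ge0.
apply: le_trans (sum_pname mpT mbe n (undup_uniq (map snd (flatten l)))).
apply: le_trans (sum_rprod bs n (undup_uniq (map fst (flatten l))) w0).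
apply: le_sum_subset => //.
- apply: allnames_uniq; apply: allpairs_uniq; rewrite ?undup_uniq//.
  by move=> [? ?] [? ?] _ _ /= [-> ->].
- move=> s sl'; rewrite mem_allnames (allP sl)//=; apply/allP => -[a b] abs.
  have abl : (a, b) \in flatten l by apply/flattenP; exists s.
  apply/allpairsP; exists (b, a) => /=; split => //; rewrite mem_undup.
    by apply/mapP; exists (a, b).
  by apply/mapP; exists (a, b).
- by move=> s; rewrite mulr_ge0// rprod_ge0.
Qed.

Lemma name_joint n x : map snd (name T joint n x) = name T be n x.
Proof. by elim: n x => //= n IH x; rewrite IH. Qed.

Lemma rprod_joint n x : rprod (name T joint n x) =
  \prod_(j < n) r (be (iter j T x)) (al (iter j T x)).
Proof.
elim: n x => [|n IH] x; rewrite /rprod ?big_nil ?big_ord0//= big_cons.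
rewrite -/(rprod _) IH big_ord_recl; congr (_ * _).
by apply: eq_bigr => j _ /=; rewrite -iterS iterSr.
Qed.

(** The joint itinerary is coded by the true law of the [be]-word followed by one letter of [al] at
    a time, given the current letter of [be] only. So its information is, mostly, at most that of
    [be] plus the sum of the costs [- ln r]. Both comparisons of partitions below rest on this. *)
Lemma relative_shannon n t :
  pr mu [set x | pname mu T joint (name T joint n x) < expR (- t) *
    (pname mu T be (name T be n x) *
     \prod_(j < n) r (be (iter j T x)) (al (iter j T x)))] <= expR (- t).
Proof.
have Q0 s : 0 <= pname mu T be (map snd s) * rprod s.
  by rewrite mulr_ge0 ?pname_ge0 ?rprod_ge0.
have := shannon_markov mpT measurable_joint t Q0 (@subprob_relative n).
apply: le_trans; rewrite le_eqVlt; apply/orP; left; apply/eqP; congr (pr mu _).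
by apply/seteqP; split=> x /=; rewrite name_joint rprod_joint.
Qed.

End Relative.

(** * Upper bound for the information of a countable partition *)

Section NameInfo.
Context {R : realType} {d : measure_display} {X : measurableType d}.
Variables (mu : probability X R) (T : X -> X) (al : X -> nat).
Hypotheses (mpT : mpreserving mu T) (ergT : ergodic mu T).
Hypotheses (mal : forall a, measurable (al @^-1` [set a])).

(** All labels from [K] on are merged into the single letter [K]; the alphabet becomes finite, as
    [smb_upper] and the definition of entropy require. *)
Definition coarsen K x : 'I_K.+1 := inord (minn (al x) K).

Lemma measurable_coarsen K b : measurable (coarsen K @^-1` [set b]).
Proof.
exact: (countable_fiber_measurable mal [set a | inord (minn a K) = b :> 'I_K.+1]).
Qed.

Let palpha a := pr mu (al @^-1` [set a]).

Lemma sum_palpha ls : uniq ls -> \sum_(a <- ls) palpha a <= 1.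
Proof.
move=> ul; rewrite -(prT mu); apply: pr_bigcup_seq => //.
by move=> a b x /= <- <-.
Qed.

(** Recovers a label from its coarsening: a letter below [K] is the label itself, and for the merged
    letter the unconditional law of the label serves as a guess. *)
Definition tail_kernel K (b : 'I_K.+1) a : R :=
  if (a < K)%N then (a == b)%:R else if b == K :> nat then palpha a else 0.

Lemma subkernel_tail K : subkernel (@tail_kernel K).
Proof.
split=> [b a|b ls ul]; rewrite /tail_kernel.
  by case: ifP => _; [rewrite ler0n|case: ifP => _ //; exact: pr_ge0].
have [bK|bK] := eqVneq (b : nat) K.
  apply: le_trans (sum_palpha ul); apply: ler_sum => a _; case: ifPn => // aK.
  rewrite (_ : _ == _ = false) ?pr_ge0//; apply/negbTE; rewrite neq_ltn.
  by rewrite bK aK.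
apply: (@le_trans _ _ (\sum_(a <- ls) (a == b)%:R)).
  by apply: ler_sum => a _; case: ifP => // _; exact: ler0n.
rewrite -natr_sum -[leRHS]/(1%:R) ler_nat.
elim: ls ul => [_|a ls IH /= /andP[al_ ul]]; first by rewrite big_nil.
rewrite big_cons; have [ab|ab] := eqVneq a b; last by rewrite add0n IH.
rewrite big_seq big1 => [//|a' a'l]; apply/eqP; rewrite eqb0.
by apply/negP => /eqP a'b; move: al_; rewrite ab -a'b a'l.
Qed.

(** The cost [- ln] of the true label under [tail_kernel]. *)
Definition tail_info K x : R :=
  if (K <= al x)%N then - ln (palpha (al x)) else 0.

Lemma tail_info_ge0 K x : 0 <= tail_info K x.
Proof.
rewrite /tail_info; case: ifP => // _; rewrite oppr_ge0; apply: ln_le0.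
exact: pr_le1.
Qed.

(** The cost may be unbounded, so Markov's inequality is applied to the truncations [psi M]. Along a
    fixed orbit segment they are eventually exact, and continuity from below concludes. *)
Lemma tail_info_markov K (I a : R) n : 0 < a -> (0 < n)%N ->
  (forall M, \sum_(K <= b < M) xlnx (palpha b) <= I) ->
  pr mu [set x | n%:R * a < bsum T (tail_info K) n x] <= I / a.
Proof.
move=> a0 n0 hI.
pose psi M x : R := if (K <= al x < M)%N then - ln (palpha (al x)) else 0.
have mal' Y : measurable (al @^-1` Y) by exact: countable_fiber_measurable.
have psi0 M x : 0 <= psi M x.
  by have := tail_info_ge0 K x; rewrite /psi /tail_info; case: (K <= _)%N => //=; case: ifP.
have psiE M x : psi M x = \sum_(K <= b < M) - ln (palpha b) * \1_(al @^-1` [set b]) x.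
  rewrite /psi; case: ifPn => [h|h].
    rewrite (bigD1_seq (al x)) ?mem_index_iota ?iota_uniq//= indicE mem_set// mulr1.
    by rewrite big1 ?addr0// => b bx; rewrite indicE memNset ?mulr0//=; exact/nesym/eqP.
  rewrite big_seq big1// => b; rewrite mem_index_iota => bK.
  rewrite indicE memNset ?mulr0//= => xb.
  by move: h; rewrite xb bK.
have bpsi M : bmf (psi M).
  rewrite (_ : psi M = fun x => \sum_(K <= b < M) - ln (palpha b) * \1_(al @^-1` [set b]) x).
    by apply: bmf_sum => b; apply: bmfZ; exact: bmf_indic.
  by apply/funext => x; exact: psiE.
have Epsi M : Ex mu (psi M) <= I.
  rewrite (_ : psi M = fun x => \sum_(K <= b < M) - ln (palpha b) * \1_(al @^-1` [set b]) x);
    last by apply/funext => x; exact: psiE.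
  rewrite Ex_sum; last by move=> b; apply: bmfZ; exact: bmf_indic.
  apply: le_trans (hI M); apply: ler_sum => b _.
  by rewrite ExZ ?Ex_indic//; [rewrite /xlnx mulNr mulrC|exact: bmf_indic].
pose F M := [set x | n%:R * a < bsum T (psi M) n x].
have mtail : measurable_fun setT (tail_info K).
  move=> _ B mB; rewrite setTI.
  exact: (mal' [set b | B (if (K <= b)%N then - ln (palpha b) else 0)]).
have mF M : measurable (F M) by exact: measurable_gt (proj1 (bmf_bsum mpT n (bpsi M))).
have mb : measurable_fun setT (bsum T (tail_info K) n).
  apply: measurable_sum => j; apply: (measurableT_comp mtail).
  exact: (measurable_iter mpT).
have psi_le M x : psi M x <= tail_info K x.
  have := tail_info_ge0 K x; rewrite /psi /tail_info.
  by case: (K <= _)%N => //=; case: ifP.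
apply/ler_addgt0Pr => e e0.
have [||M /(_ M (leqnn _)) hM] := pr_cvg mu mF (measurable_gt (n%:R * a) mb) _ _ e0.
- move=> M M' MM' x; rewrite /F /= => h; apply: lt_le_trans h _; apply: ler_sum => j _.
  rewrite /psi; case: ifPn => [/andP[h1 h2]|_]; last exact: (psi0 M' (iter j T x)).
  by rewrite h1 (leq_trans h2 MM').
- move=> x /= h; exists (\max_(j < n) (al (iter j T x)).+1)%N => //; rewrite /F /=.
  apply: (lt_le_trans h); apply: ler_sum => j _; rewrite /tail_info /psi.
  case: ifP => //= _; rewrite (_ : (_ < _)%N)//.
  exact: (leq_bigmax (F := fun j : 'I_n => (al (iter j T x)).+1)).
apply: (le_trans hM); rewrite lerD2r.
apply: le_trans (bsum_markov mpT (bpsi M) (psi0 M) a0 n0) _.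
by rewrite ler_pM2r ?invr_gt0.
Qed.

(** The information of [al] is at most that of the pair of [al] and a coarsening, hence mostly at
    most that of the coarsening, of rate at most [h], plus the accumulated [tail_info]. *)
Lemma name_info_upper (h e : R) : 0 < e ->
  (forall e, 0 < e -> exists K, forall M, \sum_(K <= b < M) xlnx (palpha b) <= e) ->
  (forall K, entropy_rate mu T (coarsen K) <= h) ->
  exists N, forall n, (N <= n)%N ->
  pr mu [set x | pname mu T al (name T al n x) < expR (- (n%:R * (h + e)))] <= e.
Proof.
move=> e0 tail hh.
have e4 : 0 < e / 4 by lra.
(* With mean at most the square of [e / 4], the average cost exceeds [e / 4] with probability at
   most [e / 4]. *)
have [K hK] := tail (e / 4 * (e / 4)) (mulr_gt0 e4 e4).
pose be := coarsen K; have mbe := @measurable_coarsen K.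
have be_enum x : be x \in enum 'I_K.+1 by rewrite mem_enum.
have [N1 hN1] := smb_upper mpT ergT mbe (enum_uniq 'I_K.+1) be_enum e4.
have [N2 hN2] := expRN_small e4 e4.
exists (maxn 1 (maxn N1 N2)) => n.
rewrite !geq_max => /and3P[n0 /hN1 {}hN1 /hN2 {}hN2].
have := tail_info_markov e4 n0 hK; rewrite mulfK ?lt0r_neq0// => hT.
have := relative_shannon mpT mal mbe (@subkernel_tail K) n (n%:R * (e / 4)).
set B1 := [set x | _] in hN1; set B2 := [set x | _] in hT; set B3 := [set x | _] => hB3.
pose N0 := [set x | palpha (al x) = 0].
have mN0 : measurable N0 by exact: (countable_fiber_measurable mal [set a | palpha a = 0]).
have N00 : pr mu N0 = 0.
  have := pname0_null mpT mal 1; rewrite /pname /=; congr (pr mu _ = 0).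
  apply/seteqP; split=> x; rewrite /N0 /palpha /=; congr (pr mu _ = 0);
    by apply/seteqP; split=> y /= [] // ->.
pose N1' := [set x | exists2 j, (j < n)%N & N0 (iter j T x)].
pose N2' := [set x | pname mu T be (name T be n x) = 0].
have N1'0 : pr mu N1' = 0 by exact: (pr_iter_null mpT).
have N2'0 : pr mu N2' = 0 by exact: (pname0_null mpT mbe).
have mB1 : measurable B1 by exact: measurable_gt (proj1 (bmf_info mpT mbe be_enum n)).
have mtail : measurable_fun setT (tail_info K).
  move=> _ B mB; rewrite setTI.
  exact: (countable_fiber_measurable mal [set b | B (if (K <= b)%N then - ln (palpha b) else 0)]).
have mB2 : measurable B2.
  apply: measurable_gt.
  apply: measurable_sum => j; apply: (measurableT_comp mtail).
  exact: (measurable_iter mpT).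
have mj := measurable_joint mal mbe.
have mB3 : measurable B3.
  rewrite (_ : B3 = name T (joint al be) n @^-1` [set s | pname mu T (joint al be) s <
    expR (- (n%:R * (e / 4))) * (pname mu T be (map snd s) * rprod (@tail_kernel K) s)]).
    exact: (measurable_name mpT mj).
  by apply/seteqP; split=> x /=; rewrite name_joint rprod_joint.
have mN1' : measurable N1'.
  rewrite (_ : N1' = \bigcup_(j in [set j | (j < n)%N]) iter j T @^-1` N0).
    by apply: bigcup_measurable => j _; exact: (preimage_iter_measurable mpT).
  by apply/seteqP; split=> x [j jn Nj]; exists j.
have mN2' : measurable N2' by exact: (measurable_name mpT mbe _ [set s | pname mu T be s = 0]).
apply: (@le_trans _ _ (pr mu ((B1 `|` B2) `|` B3) + pr mu (N1' `|` N2'))); last first.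
  have := prU_le mu mN1' mN2'; have := prU_le mu mB1 mB2.
  have := prU_le mu (measurableU _ _ mB1 mB2) mB3; lra.
apply: le_prU.
- by apply: measurableU => //; exact: measurableU.
- exact: measurableU.
- exact: (measurable_name mpT mal _ [set s | pname mu T al s < expR (- (n%:R * (h + e)))]).
move=> x /= hx.
have [|nB1] := pselect (B1 x); first by left; left; left.
have [|nB2] := pselect (B2 x); first by left; left; right.
have [|nN1] := pselect (N1' x); first by right; left.
have [|nN2] := pselect (N2' x); first by right; right.
left; right; rewrite /B3 /=.
apply: (@le_lt_trans _ _ (pname mu T al (name T al n x))).
  apply: (le_pname mpT mj mal) => y /eq_nameP hy; apply/eq_nameP => j jn.
  by have [] := hy j jn.
apply: lt_le_trans hx _.
have p0 : 0 < pname mu T be (name T be n x).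
  by rewrite lt_neqAle pname_ge0 andbT eq_sym; apply/eqP.
have h1 : expR (- (n%:R * (h + e / 4))) <= pname mu T be (name T be n x).
  rewrite -[leRHS](lnK p0) ler_expR; move/negP: nB1; rewrite -leNgt /info.
  have : n%:R * (entropy_rate mu T be + e / 4) <= n%:R * (h + e / 4).
    by apply: ler_wpM2l => //; rewrite lerD2r; exact: hh.
  lra.
have h2 : expR (- (n%:R * (e / 4))) <= \prod_(j < n)
    tail_kernel (be (iter j T x)) (al (iter j T x)).
  apply: (@le_trans _ _ (expR (- bsum T (tail_info K) n x))).
    by rewrite ler_expR lerN2 leNgt; apply/negP.
  rewrite /bsum -sumrN expR_sum; apply: ler_prod => j _.
  rewrite expR_ge0/= /tail_info /tail_kernel.
  have vbe : be (iter j T x) = minn (al (iter j T x)) K :> nat.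
    by rewrite /be /coarsen inordK// ltnS geq_minr.
  case: leqP => hKa; last first.
    by rewrite oppr0 expR0 vbe (minn_idPl (ltnW hKa)) eqxx.
  rewrite vbe (minn_idPr hKa) eqxx opprK lnK// posrE lt_neqAle pr_ge0 andbT eq_sym.
  by apply/eqP => z; apply: nN1; exists j.
apply: (@le_trans _ _ (expR (- (n%:R * (e / 4))) *
   (expR (- (n%:R * (h + e / 4))) * expR (- (n%:R * (e / 4)))))); last first.
  rewrite ler_pM2l ?expR_gt0//; apply: ler_pM => //; exact: expR_ge0.
rewrite -!expRD ler_expR.
have : 0 <= n%:R * (e / 4) by rewrite mulr_ge0// ltW.
by rewrite !mulrDr; lra.
Qed.

End NameInfo.

(** * Lower bound from a finite partition that is nearly determined by the labels *)

Section NameInfoLower.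
Context {R : realType} {d : measure_display} {X : measurableType d}.
Context {L : countType}.
Variables (mu : probability X R) (T : X -> X) (al : X -> nat) (P : X -> L) (ls : seq L).
Hypotheses (mpT : mpreserving mu T) (ergT : ergodic mu T).
Hypotheses (mal : forall a, measurable (al @^-1` [set a])).
Hypotheses (mP : forall a, measurable (P @^-1` [set a])).
Hypotheses (uls : uniq ls) (Pls : forall x, P x \in ls).

(** The guess gets weight [1 - dl] and the rest is spread evenly over the alphabet, so that a wrong
    guess has a finite cost and a right one costs almost nothing. *)
Definition guess_kernel (g : seq nat -> L) (dl : R) b a : R :=
  (a == g b)%:R * (1 - dl) + (a \in ls)%:R * (dl / (size ls)%:R).

Lemma sum_indic_le (Q : pred L) (l : seq L) : uniq l -> (0 < size ls)%N ->
  {subset Q <= ls} -> \sum_(a <- l) (a \in Q)%:R <= (size ls)%:R :> R.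
Proof.
move=> ul s0 Qls; rewrite -natr_sum ler_nat -big_mkcond/= sum1_count.
rewrite -size_filter; apply: uniq_leq_size; first exact: filter_uniq.
by move=> a; rewrite mem_filter => /andP[/Qls].
Qed.

Lemma subkernel_guess g dl : 0 <= dl <= 1 -> subkernel (guess_kernel g dl).
Proof.
move=> /andP[d0 d1]; have s0 : (0 < size ls)%N.
  by have := Pls point; case: (ls).
split=> [b a|b l ul]; rewrite /guess_kernel.
  by rewrite addr_ge0// mulr_ge0 ?ler0n ?subr_ge0// divr_ge0.
rewrite big_split/= -!mulr_suml.
have h1 : \sum_(a <- l) (a == g b)%:R <= 1 :> R.
  rewrite -natr_sum -[leRHS]/(1%:R) ler_nat -big_mkcond/= sum1_count.
  by rewrite (count_uniq_mem _ ul) leq_b1.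
have h2 := sum_indic_le ul s0 (fun _ => id).
apply: (@le_trans _ _ (1 * (1 - dl) + (size ls)%:R * (dl / (size ls)%:R))).
  by apply: lerD; apply: ler_wpM2r; rewrite ?subr_ge0// divr_ge0.
by rewrite mulrCA divff ?pnatr_eq0 -?lt0n// mul1r mulr1 subrK.
Qed.

(** An [al]-itinerary of length [n + l] determines the [n] blocks from which [P] is guessed. Coding
    the [P]-itinerary from them costs little, so the [al]-itinerary carries nearly all of its
    information, which [smb_lower] bounds from below. *)
Lemma name_info_lower (h e : R) : 0 < e ->
  (forall e, 0 < e -> exists l g,
     pr mu [set x | P x <> g (name T al l x)] <= e) ->
  h <= entropy_rate mu T P ->
  exists N, forall n, (N <= n)%N ->
  pr mu [set x | expR (- (n%:R * (h - e))) < pname mu T al (name T al n x)] <= e.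
Proof.
move=> e0 approx hh; have e8 : 0 < e / 8 by lra.
have s0 : (0 < size ls)%N by have := Pls point; case: (ls).
have s0' : 0 < (size ls)%:R :> R by rewrite ltr0n.
(* the guess is wrong with conditional probability [dl], and wrong more often than
   with frequency [th] only on a set of measure at most [e / 8] *)
pose dl : R := 1 - expR (- (e / 8)).
have dl0 : 0 < dl by rewrite subr_gt0 expR_lt1 oppr_lt0.
have dl1 : dl <= 1 by rewrite gerBl expR_ge0.
(* A bound for the cost of a wrong guess; the added 1 makes it positive, for the division in
   [th]. *)
pose v : R := - ln (dl / (size ls)%:R) + 1.
have v0 : 0 < v.
  rewrite /v ltr_wpDl// oppr_ge0; apply: ln_le0; rewrite ler_pdivrMr// mul1r.
  by apply: le_trans dl1 _; rewrite ler1n.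
pose th := e / 8 / v; have th0 : 0 < th by rewrite divr_gt0.
have [l [g hg]] := approx (th * (e / 8)) (mulr_gt0 th0 e8).
pose be := name T al l.
have mbe b : measurable (be @^-1` [set b]) by exact: (measurable_name1 mpT mal).
pose E := [set x | P x <> g (be x)].
have mE : measurable E.
  rewrite (_ : E = joint P be @^-1` [set c | c.1 <> g c.2]) //.
  exact: (countable_fiber_measurable (measurable_joint mP mbe)).
have dl01 : 0 <= dl <= 1 by rewrite ltW.
have kr := subkernel_guess g dl01.
have bE : bmf (\1_E : X -> R) by exact: bmf_indic.
have [N1 hN1] := smb_lower mpT ergT mP uls Pls e8.
have [N2 hN2] := expRN_small e8 e8.
have [N3 hN3] := eventually_linear (l%:R * (h - e)) e8.
exists (maxn 1 (maxn N1 (maxn N2 N3)) + l)%N => n' nn'.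
have [n nE] : exists n, n' = (n + l)%N.
  by exists (n' - l)%N; rewrite subnK// (leq_trans _ nn')// leq_addl.
move: nn'; rewrite {n'}nE leq_add2r !geq_max.
move=> /and4P[n0 /hN1 {}hN1 /hN2 {}hN2 /hN3 {}hN3].
have := relative_shannon mpT mP mbe kr n (n%:R * (e / 8)).
have := bsum_markov mpT bE (fun x => _) th0 n0; move=> /(_ ltac:(by move=> x; rewrite indicE ler0n)).
rewrite Ex_indic//.
set B1 := [set x | _] in hN1; set B2 := [set x | _] => hB2; set B3 := [set x | _] => hB3.
have {}hB2 : pr mu B2 <= e / 8.
  by apply: le_trans hB2 _; rewrite ler_pdivrMr// mulrC.
pose N0 := [set x | pname mu T P (name T P n x) = 0].
have N00 : pr mu N0 = 0 by exact: (pname0_null mpT mP).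
have mj := measurable_joint mP mbe.
have mB1 : measurable B1 by exact: measurable_lt (proj1 (bmf_info mpT mP Pls n)).
have mB2 : measurable B2 by exact: measurable_gt (proj1 (bmf_bsum mpT n bE)).
have mB3 : measurable B3.
  rewrite (_ : B3 = name T (joint P be) n @^-1` [set s | pname mu T (joint P be) s <
    expR (- (n%:R * (e / 8))) * (pname mu T be (map snd s) * rprod (guess_kernel g dl) s)]).
    exact: (measurable_name mpT mj).
  by apply/seteqP; split=> x /=; rewrite name_joint rprod_joint.
have mN0 : measurable N0 by exact: (measurable_name mpT mP _ [set s | pname mu T P s = 0]).
apply: (@le_trans _ _ (pr mu ((B1 `|` B2) `|` B3) + pr mu N0)); last first.
  have := prU_le mu mB1 mB2.
  have := prU_le mu (measurableU _ _ mB1 mB2) mB3; lra.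
apply: le_prU => //.
- by apply: measurableU => //; exact: measurableU.
- exact: (measurable_name mpT mal _ [set s | expR (- ((n + l)%:R * (h - e))) < pname mu T al s]).
move=> x /= hx.
have [|nB1] := pselect (B1 x); first by left; left; left.
have [|nB2] := pselect (B2 x); first by left; left; right.
have [|nN0] := pselect (N0 x); first by right.
left; right; rewrite /B3 /=.
have p0 : 0 < pname mu T P (name T P n x).
  by rewrite lt_neqAle pname_ge0 andbT eq_sym; apply/eqP.
apply: (@le_lt_trans _ _ (pname mu T P (name T P n x))).
  apply: (le_pname mpT mj mP) => y /eq_nameP hy; apply/eq_nameP => j jn.
  by have [] := hy j jn.
apply: (@le_lt_trans _ _ (expR (- (n%:R * (h - e / 8))))).
  rewrite -[leLHS](lnK p0) ler_expR; move/negP: nB1; rewrite -leNgt /info.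
  have : n%:R * (h - e / 8) <= n%:R * (entropy_rate mu T P - e / 8).
    by apply: ler_wpM2l => //; rewrite lerD2r.
  lra.
have h1 : expR (- ((n + l)%:R * (h - e))) < pname mu T be (name T be n x).
  apply: lt_le_trans hx _; apply: (le_pname mpT mal mbe) => y hy.
  apply/eq_nameP => j jn; apply: eq_name_iter hy.
  by rewrite leq_add2r ltnW.
have h2 : expR (- (n%:R * (e / 8) + v * (n%:R * th))) <= \prod_(j < n)
    guess_kernel g dl (be (iter j T x)) (P (iter j T x)).
  apply: (@le_trans _ _ (expR (- (n%:R * (e / 8) + v * bsum T (\1_E) n x)))).
    rewrite ler_expR lerN2 lerD2l ler_pM2l// leNgt; exact/negP.
  rewrite (_ : - _ = \sum_(j < n) - (e / 8 + v * \1_E (iter j T x))); last first.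
    rewrite sumrN big_split/= sumr_const card_ord -mulr_sumr /bsum mulr_natl.
    by [].
  rewrite expR_sum; apply: ler_prod => j _; rewrite expR_ge0/= /guess_kernel Pls mul1r.
  rewrite indicE; have [jE|jE] := pselect (E (iter j T x)).
    rewrite mem_set// mulr1 (_ : _ == _ = false) ?mul0r ?add0r; last exact/eqP.
    rewrite -[leRHS]lnK ?posrE ?divr_gt0// ler_expR /v; lra.
  have PE : P (iter j T x) = g (be (iter j T x)) by exact: contrapT.
  rewrite memNset// mulr0 addr0 (introT eqP PE).
  rewrite mul1r (_ : 1 - dl = expR (- (e / 8))) ?lerDl ?divr_ge0//; first exact: ltW.
  by rewrite /dl opprB addrC subrK.
apply: (@lt_le_trans _ _ (expR (- (n%:R * (e / 8))) *
   (expR (- ((n + l)%:R * (h - e))) * expR (- (n%:R * (e / 8) + v * (n%:R * th)))))); last first.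
  rewrite ler_pM2l ?expR_gt0//; apply: ler_pM; rewrite ?expR_ge0//; exact: ltW.
rewrite -!expRD ltr_expR.
have -> : v * (n%:R * th) = n%:R * (e / 8) by rewrite mulrCA /th [v * _]mulrC divfK ?lt0r_neq0.
have : 0 < n%:R * (e / 8) by rewrite mulr_gt0// ltr0n.
by rewrite natrD mulrDl !mulrBr in hN3 *; lra.
Qed.

End NameInfoLower.

(** * Kolmogorov-Sinai entropy *)

Section KSEntropy.
Context {R : realType}.
Variables (mu : probability R R) (T : R -> R).
Hypotheses (mpT : mpreserving mu T) (ergT : ergodic mu T).

Lemma sum_ffun_names m n (F : seq 'I_m -> R) : 'I_m ->
  \sum_(s : {ffun 'I_n -> 'I_m}) F [seq s j | j <- enum 'I_n] =
  \sum_(u <- allnames (enum 'I_m) n) F u.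
Proof.
move=> a0; rewrite -(big_map (fun s : {ffun 'I_n -> 'I_m} => [seq s j | j <- enum 'I_n]) xpredT F).
apply: perm_big; apply: uniq_perm.
- rewrite map_inj_uniq ?index_enum_uniq// => s s' ss'; apply/ffunP => j.
  have /= := congr1 (fun u => nth a0 u j) ss'.
  by rewrite !(nth_map j) -?enumT ?size_enum_ord// !nth_ord_enum.
- by apply: allnames_uniq; exact: enum_uniq.
- move=> u; rewrite mem_allnames; apply/mapP/andP => [[s _ ->]|[/eqP un _]].
    split; first by rewrite size_map size_enum_ord.
    by apply/allP => a _; rewrite /= mem_enum.
  exists [ffun j : 'I_n => nth a0 u j]; first exact: mem_index_enum.
  apply: (@eq_from_nth _ a0); first by rewrite size_map size_enum_ord.
  rewrite un => j jn; rewrite (nth_map (Ordinal jn)) ?size_enum_ord//.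
  by rewrite ffunE nth_enum_ord.
Qed.

Section Labelled.
Variables (m : nat) (p : R -> 'I_m).
Hypothesis mp : forall a, measurable (p @^-1` [set a]).

Let fibers i := p @^-1` [set i].

Lemma cylinder_name n (s : {ffun 'I_n -> 'I_m}) :
  \big[setI/setT]_(j < n) (iter j T @^-1` fibers (s j)) =
  name T p n @^-1` [set [seq s j | j <- enum 'I_n]].
Proof.
rewrite -bigcap_seq; apply/seteqP; split=> x /= h.
  apply: (@eq_from_nth _ (p x)); first by rewrite size_name size_map size_enum_ord.
  rewrite size_name => j jn; rewrite nth_name// (nth_map (Ordinal jn)) ?size_enum_ord//.
  have := h (Ordinal jn); rewrite /fibers /= mem_index_enum => /(_ isT) ->.
  by congr (s _); apply: val_inj; rewrite /= nth_enum_ord.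
move=> j _; rewrite /fibers/= -(@nth_name _ _ _ T p (p x) n j x (ltn_ord j)) h.
rewrite (nth_map j) ?size_enum_ord//.
by congr (s _); apply: val_inj; rewrite /= nth_enum_ord.
Qed.

Let pl x : p x \in enum 'I_m. Proof. by rewrite mem_enum. Qed.

Lemma H_joinE n : H_join mu T fibers n = entropy mu T p n.
Proof.
rewrite /entropy (Ex_name mpT mp (enum_uniq 'I_m) pl n (fun s => - ln (pname mu T p s))).
rewrite -(sum_ffun_names n (fun s => - ln (pname mu T p s) * pname mu T p s) (p point)).
apply: eq_bigr => s _; rewrite cylinder_name /xlnx /pname size_map size_enum_ord.
by rewrite mulNr mulrC.
Qed.

Lemma ent_relE : ent_rel mu T fibers = entropy_rate mu T p.
Proof.
rewrite /ent_rel; apply/cvg_lim => //.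
rewrite (_ : (fun _ => _) = fun n => n.+1%:R^-1 * entropy mu T p n.+1).
  by apply: (cvg_entropy mpT mp (enum_uniq _)) => x; exact: pl.
by apply/funext => n; rewrite H_joinE.
Qed.

Lemma entropy_rate_le_KS : ((entropy_rate mu T p)%:E <= KS_entropy mu T)%E.
Proof.
apply: ereal_sup_ubound; exists m, fibers; split; last by rewrite ent_relE.
split; first exact: mp; split.
  move=> i j ij; apply/seteqP; split=> x //; rewrite /fibers /= => -[-> /eqP].
  by rewrite (negbTE ij).
rewrite -bigcup_seq; apply/seteqP; split=> x // _.
by exists (p x) => //=; rewrite mem_index_enum.
Qed.

End Labelled.

Lemma lt_KS_entropy (h : R) : (h%:E < KS_entropy mu T)%E ->
  exists m (p : R -> 'I_m), (forall a, measurable (p @^-1` [set a])) /\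
    h < entropy_rate mu T p.
Proof.
move=> /ereal_sup_gt[_ [m [P [[mP [dP cP]] ->]]]].
rewrite lte_fin => hP.
have exP x : exists i, P i x.
  have : (\big[setU/set0]_(i < m) P i) x by rewrite cP.
  by rewrite -bigcup_seq => -[i _ Pi]; exists i.
pose p x := sval (cid (exP x)).
have pP i : p @^-1` [set i] = P i.
  apply/seteqP; split=> x /=; rewrite /p; case: cid => j /= Pj; first by move=> <-.
  move=> Pi; apply: contrapT => /eqP ji; have := dP _ _ ji.
  by move=> /seteqP[/(_ x) PP _]; apply: PP.
have mp a : measurable (p @^-1` [set a]) by rewrite pP.
exists m, p; split => //; rewrite -ent_relE//.
by rewrite (_ : (fun i => _) = P)//; apply/funext.
Qed.

End KSEntropy.

(** * Partitions into intervals of monotonicity *)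

Section Tails.
Context {R : realType}.

Lemma bounded_series_tail (a : nat -> R) (C e : R) : (forall n, 0 <= a n) ->
  (forall n, \sum_(0 <= b < n) a b <= C) -> 0 < e ->
  exists K, forall M, \sum_(K <= b < M) a b <= e.
Proof.
move=> a0 aC e0; pose s n := \sum_(0 <= b < n) a b.
have hs : has_sup (range s).
  by split; [exists (s 0%N), 0%N|exists C => _ [n _ <-]; exact: aC].
have [_ [K _ <-] hK] := sup_adherent e0 hs.
exists K => M; have [KM|MK] := leqP K M; last by rewrite big_geq ?ltW// ltnW.
have : s M <= sup (range s) by apply: sup_upper_bound => //; exists M.
by rewrite /s in hK *; rewrite (big_cat_nat (n := K))//=; lra.
Qed.

End Tails.

Section Intervals.
Context {R : realType}.

Lemma interval_interior (i : interval R) x y z :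
  y \in i -> z \in i -> y < x < z -> interior [set` i] x.
Proof.
move=> yi zi /andP[yx xz]; rewrite /interior.
apply: (@filterS _ _ _ `]y, z[%classic).
  move=> t /=; rewrite in_itv/= => /andP[yt tz].
  by apply: (@interval_is_interval _ i y z) => //; rewrite !ltW.
apply: open_nbhs_nbhs; split; first exact: interval_open.
by rewrite /= in_itv/= yx.
Qed.

(** A point of an interval outside its interior is its minimum or its maximum. *)
Lemma interval_boundary_null (i : interval R) :
  lebesgue_measure ([set` i] `\` interior [set` i]) = 0%E.
Proof.
apply/countable_lebesgue_measure0.
pose A1 := [set x : R | x \in i /\ forall y, y \in i -> x <= y].
pose A2 := [set x : R | x \in i /\ forall y, y \in i -> y <= x].
have sub1 (A : set R) : (forall x y, A x -> A y -> x = y) -> finite_set A.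
  move=> h; have [->|/set0P[x Ax]] := eqVneq A set0; first by [].
  by apply: (@sub_finite_set _ _ [set x]) => // y Ay; exact: h.
apply: finite_set_countable; apply: (@sub_finite_set _ _ (A1 `|` A2)); last first.
  rewrite finite_setU; split; apply: sub1 => x y [xi hx] [yi hy]; apply/eqP;
    by rewrite eq_le ?(hx _ yi) ?(hy _ xi).
move=> x [/= xi xo].
have [h|] := pselect (forall y, y \in i -> x <= y); first by left.
move=> /existsNP[y /not_implyP[yi /negP]]; rewrite -ltNge => yx.
right; split => // z zi; rewrite leNgt; apply/negP => xz; apply: xo.
by apply: (interval_interior yi zi); rewrite yx.
Qed.

End Intervals.

Section Lam01.
Context {R : realType}.

Lemma lam01_itv (a b : R) : a <= b -> (lam01 `[a, b]%classic <= (b - a)%:E)%E.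
Proof.
move=> ab; rewrite /lam01; apply: (@le_trans _ _ (lebesgue_measure `[a, b]%classic)).
  by apply: le_measure => //; rewrite ?inE//; exact: measurableI.
by rewrite lebesgue_measure_itv/= lte_fin; case: ltP => // _; rewrite lee_fin subr_ge0.
Qed.

Lemma lam01_itv_eq (a b : R) : a <= b -> 0 <= a -> b <= 1 ->
  lam01 `[a, b]%classic = (b - a)%:E.
Proof.
move=> ab a0 b1; rewrite /lam01 (_ : _ `&` _ = `[a, b]%classic); last first.
  apply/setIidPl => x /=; rewrite !in_itv/= => /andP[ax xb].
  by rewrite (le_trans a0 ax) (le_trans xb b1).
rewrite lebesgue_measure_itv/= lte_fin; case: ltP => // ba.
by rewrite (le_anti (_ : a <= b <= a)) ?subrr ?ab.
Qed.

End Lam01.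

Section MonotoneSystem.
Context {R : realType}.
Variables (mu : probability R R) (T : R -> R) (J : set nat) (I : nat -> interval R).
Hypothesis clT : classT mu T J I.

Let bdmu : bdd_equiv mu. Proof. by case: clT. Qed.
Let mpT : mpreserving mu T. Proof. by case: clT => _ [_ []]. Qed.
Let ergT : ergodic mu T. Proof. by case: clT => _ [_ [_ []]]. Qed.
Let partI : is_partition01 J I. Proof. by case: clT => _ [_ [_ [_ []]]]. Qed.
Let monoT m : J m -> cont_strict_mono T [set` I m].
Proof. by case: clT => _ [_ [_ [_ [_ [h _]]]]]; exact: h. Qed.
Let genT : generator T J I. Proof. by case: clT => _ [_ [_ [_ [_ [_ []]]]]]. Qed.
Let entT : part_entropy_finite mu J I. Proof. by case: clT => _ [_ [_ [_ [_ [_ []]]]]]. Qed.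

Lemma lam01_null A : measurable A -> lam01 A = 0%E -> pr mu A = 0.
Proof.
case: bdmu => c [c1 h] mA A0.
have : ((c^-1)%:E * (pr mu A)%:E <= 0)%E.
  by rewrite -A0 -(prE mu mA); exact: (h A mA).1.
rewrite -EFinM lee_fin; have := pr_ge0 mu A => p0.
by rewrite pmulr_rle0 ?invr_gt0 ?(lt_le_trans ltr01)// => h'; apply/eqP; rewrite eq_le h'.
Qed.

(** Label [m.+1] marks the interior of [I m], where [T] is known to be monotone and different pieces
    are disjoint; label 0 marks the null remainder made of endpoints, gaps and the outside of the
    unit interval. *)
Let ilabel_spec (x : R) n := (exists2 m, J m /\ interior [set` I m] x & n = m.+1) \/
  ((forall m, J m -> ~ interior [set` I m] x) /\ n = 0%N).

Let ilabel_ex (x : R) : exists n, ilabel_spec x n.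
Proof.
have [[m [Jm Im]]|h] := pselect (exists m, J m /\ interior [set` I m] x).
  by exists m.+1; left; exists m.
by exists 0%N; right; split => // m Jm Im; apply: h; exists m.
Qed.

Definition ilabel (x : R) : nat := sval (cid (ilabel_ex x)).

Lemma ilabelP x : ilabel_spec x (ilabel x).
Proof. exact: (svalP (cid (ilabel_ex x))). Qed.

Lemma ilabelS x m : ilabel x = m.+1 <-> J m /\ interior [set` I m] x.
Proof.
have [[m' [Jm' Im'] ->]|[h ->]] := ilabelP x; last by split => // -[/h].
split=> [[<-]//|[Jm Im]]; congr _.+1; apply: contrapT => mm'.
have [_ [_ [/(_ _ _ Jm' Jm mm') + _]]] := partI.
by move=> /seteqP[/(_ x) hx _]; apply: hx.
Qed.

Lemma measurable_ilabel a : measurable (ilabel @^-1` [set a]).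
Proof.
have mS m : measurable (ilabel @^-1` [set m.+1]).
  have [Jm|Jm] := pselect (J m).
    rewrite (_ : _ @^-1` _ = interior [set` I m]).
      by apply: open_measurable; exact: open_interior.
    by apply/seteqP; split=> x /=; [move=> /ilabelS[]|move=> ?; exact/ilabelS].
  rewrite (_ : _ @^-1` _ = set0)//; apply/seteqP; split=> x //= /ilabelS[].
  by [].
case: a => [|m]; last exact: mS.
rewrite (_ : _ @^-1` _ = ~` \bigcup_m (ilabel @^-1` [set m.+1])).
  by apply: measurableC; exact: bigcup_measurable.
apply/seteqP; split=> x /=; first by move=> x0 [m _] /=; rewrite x0.
by move=> h; case E : (ilabel x) => [|m] //; exfalso; apply: h; exists m.
Qed.

Let boundary := \bigcup_(m in J) ([set` I m] `\` interior [set` I m]).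

Let mboundary : measurable boundary.
Proof.
apply: bigcup_measurable => m _; apply: measurableD; first exact: measurable_itv.
by apply: open_measurable; exact: open_interior.
Qed.

Let boundary_null : pr mu boundary = 0.
Proof.
apply: lam01_null => //; rewrite /lam01.
apply/eqP; rewrite eq_le measure_ge0 andbT.
have mE m : measurable ([set` I m] `\` interior [set` I m]).
  apply: measurableD; first exact: measurable_itv.
  by apply: open_measurable; exact: open_interior.
apply: (@le_trans _ _ (\sum_(m <oo) lebesgue_measure ([set` I m] `\` interior [set` I m]))%E).
  apply: measure_sigma_subadditive => //; first exact: measurableI.
  by move=> x [[m Jm xm] _]; exists m.
by rewrite eseries0// => m _ _; exact: interval_boundary_null.
Qed.

Lemma itv_ilabel x m : J m -> [set` I m] x -> ~ boundary x -> ilabel x = m.+1.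
Proof.
move=> Jm xm nb; apply/ilabelS; split => //; apply: contrapT => h.
by apply: nb; exists m.
Qed.

Lemma ilabel_itv x m : ilabel x = m.+1 -> [set` I m] x.
Proof. by move=> /ilabelS[_]; exact: interior_subset. Qed.

Lemma pr_unit : pr mu `[0, 1]%classic = 1.
Proof.
have : pr mu (~` `[0, 1]%classic) = 0.
  apply: lam01_null; first exact: measurableC.
  by rewrite /lam01 setICl measure0.
by rewrite prC//; lra.
Qed.

Lemma pr_ilabel0 : pr mu (ilabel @^-1` [set 0%N]) = 0.
Proof.
pose A := `[0, 1]%classic `\` \bigcup_(n in J) [set` I n].
have mA : measurable A.
  by apply: measurableD => //; apply: bigcup_measurable => m _; exact: measurable_itv.
have A0 : pr mu A = 0.
  by apply: lam01_null => //; case: partI => _ [_ []].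
have mC : measurable (~` `[0 : R, 1]%classic) by exact: measurableC.
apply/eqP; rewrite eq_le pr_ge0 andbT.
have -> : 0 = pr mu (A `|` ~` `[0, 1]%classic) + pr mu boundary.
  rewrite boundary_null addr0; apply/esym/eqP; rewrite eq_le pr_ge0 andbT.
  by apply: le_trans (prU_le mu mA mC) _; rewrite A0 prC// pr_unit; lra.
apply: le_prU => //; [exact: measurableU|exact: measurable_ilabel|].
move=> x /= x0; have [xb|xb] := pselect (boundary x); [by right|left].
have [x01|x01] := pselect (`[0, 1]%classic x); [left|by right].
by split => // -[m Jm xm]; move: x0; rewrite (itv_ilabel Jm xm xb).
Qed.

Notation lname := (name T ilabel).

Lemma lname0_null n : pr mu [set x | 0%N \in lname n x] = 0.
Proof.
rewrite -[RHS](pr_iter_null mpT n (measurable_ilabel 0%N) pr_ilabel0).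
congr (pr mu _); apply/seteqP; split=> x /=.
  move=> /(nthP 0%N)[j]; rewrite size_name => jn; rewrite nth_name// => h.
  by exists j.
by move=> [j jn h]; apply/(nthP 0%N); exists j; rewrite ?size_name// nth_name.
Qed.

Lemma measurable_lname0 n : measurable [set x | 0%N \in lname n x].
Proof.
rewrite (_ : [set _ | _] = name T ilabel n @^-1` [set s : seq nat | 0%N \in s])//.
exact: (measurable_name mpT measurable_ilabel).
Qed.

(** A point between two points of the same piece lies in that piece, and its image lies between
    theirs, in reversed order on a decreasing piece. Label 0 is excluded because its fibre need not
    be convex. *)
Lemma cell_convex n s x y z : 0%N \notin s -> lname n x = s -> lname n z = s ->
  x < y < z -> lname n y = s.
Proof.
elim: n s x y z => [|n IH] s x y z s0 /= xs zs /andP[xy yz].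
  by rewrite -xs.
case: s s0 xs zs => // -[|m] s; rewrite !inE//= => s0 [xm xs] [zm zs].
have [Jm xi] := (ilabelS x m).1 xm; have [_ zi] := (ilabelS z m).1 zm.
have yi : interior [set` I m] y.
  by apply: (interval_interior (interior_subset xi) (interior_subset zi)); rewrite xy.
rewrite ((ilabelS y m).2 (conj Jm yi)); congr (_ :: _).
have [_ [inc|dec]] := monoT Jm.
  by apply: (IH _ (T x) _ (T z)) => //; rewrite !inc.
by apply: (IH _ (T z) _ (T x)) => //; rewrite !dec.
Qed.

Let apx B := measurable B /\ forall e, 0 < e ->
  exists l S, pr mu (symdiff B (lname l @^-1` S)) <= e.

Let mname l S : measurable (lname l @^-1` S).
Proof. exact: (measurable_name mpT measurable_ilabel). Qed.

Let msymdiff (A B : set R) : measurable A -> measurable B -> measurable (symdiff A B).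
Proof. by move=> mA mB; apply: measurableU; exact: measurableD. Qed.

Let apxC B : apx B -> apx (~` B).
Proof.
move=> [mB hB]; split; first exact: measurableC.
move=> e /hB[l [S h]]; exists l, (~` S); move: h; congr (pr mu _ <= e).
rewrite /symdiff preimage_setC; apply/seteqP; split=> x /=;
  (case=> -[h1 h2]; [right|left]; split => //; exact: contrapT).
Qed.

Let name_lift l m S : (l <= m)%N -> exists S', lname l @^-1` S = lname m @^-1` S'.
Proof.
move=> lm; exists [set s | S (take l s)]; apply/seteqP; split=> x /=;
  by rewrite take_name.
Qed.

Let apxU A B : apx A -> apx B -> apx (A `|` B).
Proof.
move=> [mA hA] [mB hB]; split; first exact: measurableU.
move=> e e0; have e2 : 0 < e / 2 by lra.
have [l [S h]] := hA _ e2; have [l' [S' h']] := hB _ e2.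
have [S1 E1] := name_lift S (leq_maxl l l').
have [S2 E2] := name_lift S' (leq_maxr l l').
exists (maxn l l'), (S1 `|` S2); rewrite preimage_setU -E1 -E2.
apply: (@le_trans _ _ (pr mu (symdiff A (lname l @^-1` S)) +
  pr mu (symdiff B (lname l' @^-1` S')))); last by lra.
apply: le_prU; [exact: msymdiff|exact: msymdiff| |].
  by apply: msymdiff; exact: measurableU.
rewrite /symdiff => x /= [[[Ax|Bx] /not_orP[h1 h2]]|[[h1|h1] /not_orP[h2 h3]]].
- by left; left.
- by right; left.
- by left; right.
- by right; right.
Qed.

Let apx0 : apx set0.
Proof.
split=> // e e0; exists 0%N, set0; rewrite preimage_set0 /symdiff setD0 setU0 pr0.
exact: ltW.
Qed.

Let apx_bigcup (F : nat -> set R) : (forall k, apx (F k)) -> apx (\bigcup_k F k).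
Proof.
move=> hF; have mF k : measurable (F k) by case: (hF k).
have mU : measurable (\bigcup_k F k) by exact: bigcup_measurable.
split=> // e e0; have e2 : 0 < e / 2 by lra.
pose G k := \big[setU/set0]_(j < k) F j.
have mG k : measurable (G k) by apply: bigsetU_measurable.
have GE k x : G k x <-> exists2 j, (j < k)%N & F j x.
  rewrite /G -bigcup_seq; split=> [[j _ Fj]|[j jk Fj]].
    by exists j.
  by exists (Ordinal jk) => //=; rewrite mem_index_enum.
have apxG k : apx (G k).
  elim: k => [|k IH]; rewrite /G; first by rewrite big_ord0.
  by rewrite big_ord_recr; exact: apxU.
have [||K /(_ K (leqnn _)) hK] := pr_cvg mu mG mU _ _ e2.
- by move=> k l kl x /GE[j jk Fj]; apply/GE; exists j => //; exact: leq_trans kl.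
- by move=> x [j _ Fj]; exists j.+1 => //; apply/GE; exists j.
have [_ /(_ _ e2)[l [S h]]] := apxG K.
have GU : G K `<=` \bigcup_k F k by move=> x /GE[j _ Fj]; exists j.
exists l, S; have := prID mu mU (mG K); rewrite ((setIidPr _ _).2 GU) => hD.
apply: (@le_trans _ _ (pr mu ((\bigcup_k F k) `\` G K) +
   pr mu (symdiff (G K) (lname l @^-1` S)))); last by lra.
apply: le_prU; [exact: measurableD|exact: msymdiff|exact: msymdiff|].
rewrite /symdiff => x [[Ux nS]|[Sx nU]].
  by have [Gx|Gx] := pselect (G K x); [right; left|left].
by right; right; split => // /GU.
Qed.

(** The approximable sets [apx] form a sigma-algebra. It contains the preimages of the partition
    intervals, which differ from unions of cells by preimages of endpoints; by the generator
    property this reaches [B] up to a null set. *)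
Lemma name_approx B (e : R) : measurable B -> 0 < e ->
  exists l S, pr mu (symdiff B (lname l @^-1` S)) <= e.
Proof.
move=> mB; have [C [sC hC]] := genT mB.
have : apx C.
  move: C sC {hC}; apply: smallest_sub.
    by split; [exact: apx0|move=> A; rewrite setTD; exact: apxC|exact: apx_bigcup].
  move=> _ [j [m [_ [Jm ->]]]].
  have mP : measurable (iter j T @^-1` [set` I m]).
    by apply: (preimage_iter_measurable mpT); exact: measurable_itv.
  split=> // e' e'0; exists j.+1, [set s | nth 0%N s j = m.+1].
  apply: le_trans (ltW e'0).
  have := pr_iter mpT j mboundary; rewrite boundary_null => <-.
  apply: le_pr; [exact: msymdiff|exact: (preimage_iter_measurable mpT)|].
  rewrite /symdiff => x [[h1 h2]|[h1 h2]].
    apply: contrapT => nb; apply: h2; rewrite /preimage /mkset nth_name//.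
    exact: itv_ilabel.
  exfalso; apply: h2; apply: ilabel_itv.
  by move: h1; rewrite /preimage /mkset nth_name.
move=> [mC hC'] /hC'[l [S h]]; exists l, S; apply: le_trans h.
have n0 : pr mu (symdiff B C) = 0 by apply: lam01_null => //; exact: msymdiff.
rewrite -[leRHS]add0r -n0; apply: le_prU; [exact: msymdiff|exact: msymdiff|exact: msymdiff|].
rewrite /symdiff => x /= [[h1 h2]|[h1 h2]].
  by have [Cx|Cx] := pselect (C x); [right; left|left; left].
by have [Cx|Cx] := pselect (C x); [left; right|right; right].
Qed.

(** Each fibre of [p] is approximated within [e / m%:R] by words of one common length, and [g] picks
    any letter whose approximating set contains the word. It errs only where one of the
    approximations does. *)
Lemma guess_approx m (p : R -> 'I_m) (e : R) :
  (forall a, measurable (p @^-1` [set a])) -> 0 < e ->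
  exists l g, pr mu [set x | p x <> g (lname l x)] <= e.
Proof.
move=> mp e0; have m0 : 0 < m%:R :> R.
  by rewrite ltr0n; case: m {mp} p => // p; case: (p point).
have em : 0 < e / m%:R by rewrite divr_gt0.
have /choice[lS hlS] (a : 'I_m) : exists lS : nat * set (seq nat),
    pr mu (symdiff (p @^-1` [set a]) (lname lS.1 @^-1` lS.2)) <= e / m%:R.
  by have [l [S h]] := name_approx (mp a) em; exists (l, S).
pose l := \max_a (lS a).1.
have /choice[S hS] (a : 'I_m) : exists S : set (seq nat), lname (lS a).1 @^-1` (lS a).2 = lname l @^-1` S.
  by apply: name_lift; exact: (leq_bigmax (F := fun a => (lS a).1)).
pose g s := if [pick a | `[< S a s >]] is Some a then a else p point.
exists l, g; pose F a := symdiff (p @^-1` [set a]) (lname l @^-1` S a).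
have mF a : measurable (F a) by exact: msymdiff.
apply: (@le_trans _ _ (\sum_a pr mu (F a))); last first.
  apply: (@le_trans _ _ (\sum_(a < m) e / m%:R)).
    by apply: ler_sum => a _; rewrite /F -hS; exact: hlS.
  by rewrite sumr_const card_ord -[leLHS]mulr_natr divfK ?lt0r_neq0.
apply: le_pr_bigcup_seq => //.
  rewrite (_ : [set _ | _] = joint p (lname l) @^-1` [set c | c.1 <> g c.2])//.
  have ml := measurable_name1 mpT measurable_ilabel.
  exact: (countable_fiber_measurable (measurable_joint mp (ml l))).
move=> x /= h; apply: contrapT => hn.
have nF a : ~ F a x by move=> Fa; apply: hn; exists a => //; rewrite mem_index_enum.
have Sx : S (p x) (lname l x).
  by apply: contrapT => nS; apply: (nF (p x)); left.
apply: h; rewrite /g; case: pickP => [a /asboolP Sa|/(_ (p x))/asboolP//].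
by apply: contrapT => pa; apply: (nF a); right.
Qed.

(** Label 0 has no mass and label [m.+1] has the mass of [I m], so the partial sums are bounded by
    the finite entropy of the partition. *)
Lemma label_entropy_tail (e : R) : 0 < e -> exists K, forall M,
  \sum_(K <= b < M) xlnx (pr mu (ilabel @^-1` [set b])) <= e.
Proof.
have mI m : measurable [set` I m] by exact: measurable_itv.
have x0 (A : set R) : measurable A -> 0 <= xlnx (pr mu A).
  move=> mA; rewrite /xlnx oppr_ge0 mulr_ge0_le0 ?pr_ge0//.
  by apply: ln_le0; exact: pr_le1.
have pE m : J m -> pr mu (ilabel @^-1` [set m.+1]) = pr mu [set` I m].
  move=> Jm; apply/eqP; rewrite eq_le; apply/andP; split.
    by apply: le_pr => //; [exact: measurable_ilabel|move=> x; exact: ilabel_itv].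
  rewrite -[leRHS]addr0 -boundary_null.
  apply: le_prU => //; first exact: measurable_ilabel.
  move=> x xm; have [xb|xb] := pselect (boundary x); [by right|left].
  exact: itv_ilabel.
apply: (@bounded_series_tail _ _ (fine (\esum_(n in J) (xlnx (fine (mu [set` I n])))%:E))).
  by move=> n; apply: x0; exact: measurable_ilabel.
have xJ n : (0 <= (xlnx (fine (mu [set` I n])))%:E)%E.
  by rewrite lee_fin; exact: (x0 _ (mI n)).
case=> [|n]; first by rewrite big_geq// fine_ge0// esum_ge0.
rewrite -lee_fin fineK; last first.
  by rewrite ge0_fin_numE; [exact: entT|exact: esum_ge0].
rewrite big_nat_recl//= pr_ilabel0 {1}/xlnx mul0r oppr0 add0r.
rewrite (_ : J = [set x | `[< J x >]]); last by apply/seteqP; split=> x /= /asboolP.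
rewrite -nneseries_esum; last by move=> *; exact: xJ.
apply: le_trans (@nneseries_lim_ge _ _ _ _ n _); last by move=> *; exact: xJ.
rewrite -sumEFin [leRHS]big_mkcond; apply: lee_sum => m _.
case: asboolP => [Jm|Jm]; first by rewrite pE.
rewrite (_ : _ @^-1` _ = set0) ?pr0 /xlnx ?mul0r ?oppr0//.
by apply/seteqP; split=> x //= /ilabelS[].
Qed.

Lemma cell_upper (h e : R) : (KS_entropy mu T <= h%:E)%E -> 0 < e ->
  exists N, forall n, (N <= n)%N ->
  pr mu [set x | pname mu T ilabel (lname n x) < expR (- (n%:R * (h + e)))] <= e.
Proof.
move=> hh e0; apply: (name_info_upper mpT ergT measurable_ilabel e0 label_entropy_tail) => K.
rewrite -lee_fin; apply: le_trans hh; apply: (entropy_rate_le_KS mpT).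
exact: measurable_coarsen measurable_ilabel K.
Qed.

Lemma cell_lower (h e : R) : (h%:E < KS_entropy mu T)%E -> 0 < e ->
  exists N, forall n, (N <= n)%N ->
  pr mu [set x | expR (- (n%:R * (h - e))) < pname mu T ilabel (lname n x)] <= e.
Proof.
move=> /(lt_KS_entropy mpT)[m [p [mp hp]]] e0.
apply: (name_info_lower mpT ergT measurable_ilabel mp (enum_uniq 'I_m) _ e0 _ (ltW hp)).
  by move=> x; rewrite mem_enum.
by move=> e'; exact: guess_approx.
Qed.

(** A set of itineraries is turned into a member [D] of the sigma-algebra of property B by replacing
    labels with whole intervals; there are countably many words, and the change concerns only the
    null sets of label 0 and of orbits through endpoints. *)
Lemma name_propertyB : propertyB mu T J I -> exists c b, [/\ 0 < c,
  b @ \oo --> 0 & forall q n S A, (0 < q)%N -> measurable A ->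
  pr mu (lname q @^-1` S `&` iter (n + q) T @^-1` A) <=
    c * pr mu (lname q @^-1` S) * pr mu A + b n].
Proof.
move=> [c [c0 [b [b0 [bcv hB]]]]]; exists c, b; split => // q n S A q0 mA.
(* The predecessor undoes the shift of the labels; words containing 0 are discarded by [good]. *)
pose cyl s := \big[setI/setT]_(j < q) (iter j T @^-1` [set` I (nth 0%N s j).-1]).
have cylE s x : cyl s x <-> forall j, (j < q)%N -> [set` I (nth 0%N s j).-1] (iter j T x).
  rewrite /cyl -bigcap_seq; split=> [h j jq|h j _].
    by apply: (h (Ordinal jq)); rewrite /= mem_index_enum.
  exact: h.
pose good s := [/\ S s, size s = q & forall j, (j < q)%N ->
   exists2 m, J m & nth 0%N s j = m.+1].
have [u uK] : exists u : nat -> seq nat, forall s, exists k, u k = s.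
  by exists (fun k => odflt [::] (unpickle k)) => s; exists (pickle s); rewrite pickleK.
pose D := \bigcup_k (if `[< good (u k) >] then cyl (u k) else set0).
have DE x : D x <-> exists2 s, good s & cyl s x.
  split=> [[k _]|[s gs cs]]; first by case: asboolP => // gs cs; exists (u k).
  by have [k ks] := uK s; exists k => //; rewrite ks; case: asboolP.
have sD : sigma_refine T J I q D.
  have [sa0 saC saU] := smallest_sigma_algebra setT (refine_gen T J I (Some q)).
  apply: (saU) => k; case: asboolP => [[_ _ gs]|_]; last exact: sa0.
  rewrite /cyl; elim/big_ind: _ => [|A1 A2 h1 h2|j _].
  - by have := saC _ sa0; rewrite setD0.
  - rewrite (_ : A1 `&` A2 = setT `\` ((setT `\` A1) `|` (setT `\` A2))).
      apply: (saC); rewrite -bigcup2E; apply: (saU) => -[|[|?]] /=; [exact: (saC _ h1)|exact: (saC _ h2)|exact: sa0].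
    by rewrite !setTD setCU !setCK.
  - by apply: sub_sigma_algebra; have [m Jm ->] := gs j (ltn_ord j); exists j, m.
have mcyl s : measurable (cyl s).
  rewrite /cyl; apply: bigsetI_measurable => j _.
  by apply: (preimage_iter_measurable mpT); exact: measurable_itv.
have mD : measurable D.
  by apply: bigcup_measurable => k _; case: asboolP.
have SD : lname q @^-1` S `<=` D `|` [set x | 0%N \in lname q x].
  move=> x Sx; have [h|h] := pselect (0%N \in lname q x); [by right|left].
  have lab j : (j < q)%N -> exists2 m, J m &
      nth 0%N (lname q x) j = m.+1 /\ [set` I m] (iter j T x).
    move=> jq; rewrite nth_name//; case E : (ilabel (iter j T x)) => [|m].
      by exfalso; apply: h; apply/(nthP 0%N); exists j; rewrite ?size_name// nth_name.
    by exists m; [case: ((ilabelS _ _).1 E)|split; last exact: ilabel_itv].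
  apply/DE; exists (lname q x).
    by split=> //; [exact: size_name|move=> j /lab[m Jm []]; exists m].
  by apply/cylE => j /lab[m Jm [-> h']].
pose bd := [set x | exists2 j, (j < q)%N & boundary (iter j T x)].
have mbd : measurable bd.
  rewrite (_ : bd = \bigcup_(j in [set j | (j < q)%N]) iter j T @^-1` boundary).
    by apply: bigcup_measurable => j _; exact: (preimage_iter_measurable mpT).
  by apply/seteqP; split=> x [j jn Nj]; exists j.
have bd0 : pr mu bd = 0 by exact: (pr_iter_null mpT).
have DS : D `<=` lname q @^-1` S `|` bd.
  move=> x /DE[s [Ss sq gs] /cylE cs]; have [xb|xb] := pselect (bd x); [by right|left].
  change (S (lname q x)); suff <- : s = lname q x by [].
  apply: (@eq_from_nth _ 0%N); rewrite sq ?size_name// => j jq.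
  rewrite nth_name//; have [m Jm sm] := gs j jq; rewrite sm; apply/esym.
  by apply: itv_ilabel => //; [have := cs j jq; rewrite sm|move=> h; apply: xb; exists j].
have pD : pr mu D <= pr mu (lname q @^-1` S).
  by rewrite -[leRHS]addr0 -bd0; exact: le_prU.
have mA' : measurable (iter (n + q) T @^-1` A) by exact: (preimage_iter_measurable mpT).
have := hB q n D A q0 sD mA.
have mDA : measurable (D `&` iter (n + q) T @^-1` A) by exact: measurableI.
rewrite (prE _ mDA) (prE _ mD) (prE _ mA) -!EFinM -EFinD lee_fin => hDA.
apply: (@le_trans _ _ (pr mu (D `&` iter (n + q) T @^-1` A))).
  rewrite -[leRHS]addr0 -(lname0_null q); apply: le_prU => //.
  - exact: measurable_lname0.
  - exact: measurableI.
  - by move=> x [/SD[Dx|?] Ax]; [left|right].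
apply: le_trans hDA _; rewrite lerD2r ler_wpM2r ?pr_ge0// ler_wpM2l//.
exact: ltW.
Qed.

End MonotoneSystem.

(** * Quasi-independence of the coordinates along orbits *)

Section ThickSets.
Context {R : realType}.

(* The sets [E n] have asymptotically negligible outer boundary at scale [exp (- n h)]. *)
Definition thick (mu : probability R R) (E : nat -> set R) (h : R) :=
  forall e, 0 < e -> exists N, forall n, (N <= n)%N -> exists B,
    [/\ measurable B, pr mu B <= e & forall x y, 0 <= x <= 1 -> 0 <= y <= 1 ->
      E n x -> ~ E n y -> `|x - y| <= expR (- (n%:R * h)) -> B y].

Lemma thickI mu E F h : thick mu E h -> thick mu F h ->
  thick mu (fun n => E n `&` F n) h.
Proof.
move=> tE tF e e0; have e2 : 0 < e / 2 by lra.
have [N1 h1] := tE _ e2; have [N2 h2] := tF _ e2.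
exists (maxn N1 N2) => n; rewrite geq_max => /andP[/h1[B [mB Be hB]] /h2[B' [mB' Be' hB']]].
exists (B `|` B'); split; first exact: measurableU.
  by apply: le_trans (prU_le mu mB mB') _; lra.
move=> x y x01 y01 [Ex Fx] nEF xy.
have [Ey|Ey] := pselect (E n y); last by left; exact: hB xy.
by right; apply: hB' xy => // Fy; apply: nEF.
Qed.

Lemma thick_le mu nu E h (C : R) : 0 < C ->
  (forall A, measurable A -> pr nu A <= C * pr mu A) ->
  thick mu E h -> thick nu E h.
Proof.
move=> C0 hC tE e e0; have [N hN] := tE (e / C) (divr_gt0 e0 C0).
exists N => n /hN[B [mB Be hB]]; exists B; split => //.
by apply: le_trans (hC _ mB) _; rewrite mulrC -ler_pdivlMr.
Qed.

End ThickSets.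

Section Equivalence.
Context {R : realType}.

Lemma lam01_fin (A : set R) : measurable A -> lam01 A \is a fin_num.
Proof.
move=> mA; rewrite /lam01 ge0_fin_numE//.
apply: (@le_lt_trans _ _ (lebesgue_measure `[0 : R, 1]%classic)).
  by apply: le_measure => //; rewrite ?inE//; exact: measurableI.
by rewrite lebesgue_measure_itv/= lte_fin ltr01 oppr0 adde0 ltry.
Qed.

Lemma bdd_equivP (mu : probability R R) : bdd_equiv mu -> exists c : R, 1 <= c /\
  forall A, measurable A ->
    pr mu A <= c * fine (lam01 A) /\ fine (lam01 A) <= c * pr mu A.
Proof.
case=> c [c1 h]; exists c; split => // A mA.
have c0 : 0 < c by apply: lt_le_trans c1.
split.
  have : ((c^-1)%:E * (pr mu A)%:E <= (fine (lam01 A))%:E)%E.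
    by rewrite -(prE mu mA) fineK ?lam01_fin//; exact: (h A mA).1.
  by rewrite -EFinM lee_fin ler_pdivrMl.
rewrite -lee_fin EFinM -(prE mu mA) fineK ?lam01_fin//; exact: (h A mA).2.
Qed.

Lemma bdd_equiv_le (mu nu : probability R R) : bdd_equiv mu -> bdd_equiv nu ->
  exists C : R, 0 < C /\ forall A, measurable A -> pr nu A <= C * pr mu A.
Proof.
move=> /bdd_equivP[c [c1 hc]] /bdd_equivP[c' [c'1 hc']]; exists (c' * c).
split=> [|A mA]; first by rewrite mulr_gt0// (lt_le_trans ltr01).
apply: le_trans (proj1 (hc' A mA)) _; rewrite -mulrA ler_wpM2l//.
  exact: le_trans c'1.
exact: (proj2 (hc A mA)).
Qed.

Lemma pr_itv_le (mu : probability R R) : bdd_equiv mu -> exists c : R, 1 <= c /\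
  (forall a b : R, a <= b -> pr mu `[a, b]%classic <= c * (b - a)) /\
  (forall (a b : R) (A : set R), a <= b -> 0 <= a -> b <= 1 -> measurable A ->
     `[a, b]%classic `<=` A -> b - a <= c * pr mu A).
Proof.
move=> /bdd_equivP[c [c1 hc]]; have c0 : 0 <= c by exact: le_trans c1.
exists c; split => //; split.
  move=> a b ab; have mI : measurable `[a, b]%classic by exact: measurable_itv.
  apply: le_trans (proj1 (hc _ mI)) _; apply: ler_wpM2l => //.
  by rewrite -lee_fin fineK ?lam01_fin//; exact: lam01_itv.
move=> a b A ab a0 b1 mA abA; have mI : measurable `[a, b]%classic by exact: measurable_itv.
have := proj2 (hc _ mI); rewrite lam01_itv_eq// => /le_trans; apply.
by apply: ler_wpM2l => //; exact: le_pr.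
Qed.

End Equivalence.

(** * Collars of the cells of a piecewise monotone map *)

Section ThickCells.
Context {R : realType}.
Variables (mu : probability R R) (T : R -> R) (J : set nat) (I : nat -> interval R).
Hypothesis clT : classT mu T J I.

Let bdmu : bdd_equiv mu. Proof. by case: clT. Qed.
Let mpT : mpreserving mu T. Proof. by case: clT => _ [_ []]. Qed.

Notation label := (ilabel J I).
Notation lname := (name T label).
Let mlab : forall a, measurable (label @^-1` [set a]) := measurable_ilabel clT.

(** The set at time [n] is a union of cells of order [n + l]. A point outside it that is close to a
    point inside lies in a cell missing the latter, so it is close to an end of its own convex cell.
    Most of the mass is in cells of measure at least [th], and their collars of width [rho] have
    total measure at most [2 * c * rho / th]. *)
Lemma thick_cells (h h' : R) l S : (KS_entropy mu T <= h%:E)%E -> h < h' ->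
  thick mu (fun n => iter n T @^-1` (lname l @^-1` S)) h'.
Proof.
move=> KSh hh' e0' e0; pose e := (h' - h) / 2.
have ep : 0 < e by rewrite /e; lra.
have ee2 : 0 < e0' / 2 by lra.
have [N1 hN1] : exists N1, forall n, (N1 <= n)%N -> pr mu
    [set x | pname mu T label (lname n x) < expR (- (n%:R * (h + e)))] <= e0' / 2.
  (* [cell_upper] uses one number both as loss in the exponent and as probability, hence the
     minimum. *)
  have [N h1] := cell_upper clT KSh (e := Num.min e (e0' / 2)) ltac:(by rewrite lt_min ep ee2).
  exists N => n /h1 {}h1; apply: le_trans (le_trans h1 _); last by rewrite ge_min lexx orbT.
  apply: le_pr => [||x /=].
  - exact: (measurable_name mpT mlab _ [set s | pname mu T label s < expR (- (n%:R * (h + e)))]).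
  - exact: (measurable_name mpT mlab _ [set s | pname mu T label s < expR (- (n%:R * (h + Num.min e (e0' / 2))))]).
  - move=> h2; apply: lt_le_trans h2 _; rewrite ler_expR lerN2; apply: ler_wpM2l => //.
    by rewrite lerD2l ge_min lexx.
have [c [c1 [hc _]]] := pr_itv_le bdmu.
have c0 : 0 < c by exact: lt_le_trans c1.
(* Two collars per cell, the density bound [c], and the factor for passing from order [n] to order
   [n + l]; since [h' = h + e + e], what remains of [rho / th] is [expR (- (n%:R * e))]. *)
pose K := 2 * c * expR (l%:R * (h + e)).
have K0 : 0 < K by rewrite /K !mulr_gt0// expR_gt0.
have [N2 hN2] := expRN_small ep (divr_gt0 ee2 K0).
exists (maxn N1 N2) => n; rewrite geq_max => /andP[n1 /hN2 {}hN2].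
have {}hN1 := hN1 (n + l)%N (leq_trans n1 (leq_addr _ _)).
set m := (n + l)%N in hN1.
set rho := expR (- (n%:R * h')); set th := expR (- (m%:R * (h + e))).
have rho0 : 0 < rho by exact: expR_gt0.
have th0 : 0 < th by exact: expR_gt0.
have crho0 : 0 < 2 * c * rho by rewrite !mulr_gt0.
have crt0 : 0 <= 2 * c * rho / th by rewrite divr_ge0 ?ltW.
pose U := `[0 : R, 1]%classic.
have mU : measurable U by exact: measurable_itv.
pose C s := U `&` lname m @^-1` [set s].
have mC s : measurable (C s).
  by apply: measurableI => //; exact: (measurable_name1 mpT mlab).
have C01 s x : C s x -> 0 <= x <= 1 by case; rewrite /U/= in_itv.
have infC s x : C s x -> inf (C s) <= x.
  by move=> Cx; apply: ge_inf => //; exists 0 => y /C01/andP[].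
have supC s x : C s x -> x <= sup (C s).
  by move=> Cx; apply: ub_le_sup => //; exists 1 => y /C01/andP[].
pose W s := C s `&` (`[inf (C s), inf (C s) + rho]%classic `|` `[sup (C s) - rho, sup (C s)]%classic).
have mW s : measurable (W s).
  by apply: measurableI => //; apply: measurableU; exact: measurable_itv.
pose V := [set x | W (lname m x) x /\ th <= pname mu T label (lname m x)].
have mV : measurable V.
  have [u uK] : exists u : nat -> seq nat, forall s, exists k, u k = s.
    by exists (fun k => odflt [::] (unpickle k)) => s; exists (pickle s); rewrite pickleK.
  rewrite (_ : V = \bigcup_k (if th <= pname mu T label (u k) then W (u k) else set0)).
    by apply: bigcup_measurable => k _; case: ifP.
  apply/seteqP; split=> x.
    by move=> [Wx hx]; have [k kx] := uK (lname m x); exists k => //; rewrite kx hx.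
  move=> [k _]; case: ifP => // hk Wx; case: (Wx) => -[_ /= xk] _.
  by rewrite /V /= xk.
have pV : pr mu V <= e0' / 2.
  apply: (@countable_pr_bound _ _ _ mu _ (lname m) (fun s => size s == m)
    (fun s => (2 * c * rho / th) * pname mu T label s)) => //.
  - exact: (measurable_name1 mpT mlab).
  - by move=> x; rewrite size_name.
  - move=> s sm; have [hs|hs] := leP th (pname mu T label s); last first.
      have -> : V `&` lname m @^-1` [set s] = set0.
        apply/seteqP; split=> x //= [[_ h1] h2]; rewrite h2 in h1.
        by move: hs; rewrite ltNge h1.
      by rewrite pr0 mulr_ge0 ?pname_ge0.
    (* The collar is charged to the measure of its cell, which is at least [th]; summing the charges
       replaces counting the cells. *)
    apply: (@le_trans _ _ (2 * c * rho)); last first.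
      by rewrite -[leRHS]mulrA ler_peMr ?(ltW crho0)// mulrC ler_pdivlMr// mul1r.
    apply: (@le_trans _ _ (pr mu `[inf (C s), inf (C s) + rho]%classic +
                          pr mu `[sup (C s) - rho, sup (C s)]%classic)).
      apply: le_prU; [exact: measurable_itv|exact: measurable_itv| |].
        by apply: measurableI => //; exact: (measurable_name1 mpT mlab).
      by move=> x [[[_ h1] _] h2]; rewrite h2 in h1.
    have := hc (inf (C s)) (inf (C s) + rho) ltac:(lra).
    by have := hc (sup (C s) - rho) (sup (C s)) ltac:(lra); lra.
  - move=> s us ss; rewrite -mulr_sumr.
    apply: (@le_trans _ _ (2 * c * rho / th)).
      rewrite ler_piMr//.
      apply: (subprob_allnames (pname_ge0 mu T label) (sum_pname mpT mlab m)) => //.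
    apply: (@le_trans _ _ (K * expR (- (n%:R * e)))); last first.
      by rewrite mulrC -ler_pdivlMr.
    rewrite /K -!mulrA !ler_pM2l// -expRD /rho /th -expRN -expRD ler_expR.
    have -> : h' = h + e + e by rewrite /e; lra.
    by rewrite /m natrD opprK mulrDl !mulrDr; lra.
exists (([set x | pname mu T label (lname m x) < th] `|` V) `|` [set x | 0%N \in lname m x]).
have m1 : measurable [set x | pname mu T label (lname m x) < th].
  exact: (measurable_name mpT mlab _ [set s | pname mu T label s < th]).
have m2 := measurable_lname0 clT m.
split; first by do 2 apply: measurableU => //.
  apply: le_trans (prU_le mu (measurableU _ _ m1 mV) m2) _.
  by rewrite (lname0_null clT) addr0; apply: le_trans (prU_le mu m1 mV) _; rewrite /th; lra.
move=> x y x01 y01 Ex nEy xy.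
have [|ny0] := boolP (0%N \in lname m y); first by right.
left; have [|yth] := ltP (pname mu T label (lname m y)) th; first by left.
right; set s := lname m y in ny0 yth *.
have xs : lname m x <> s.
  move=> xs; apply: nEy; rewrite /preimage /mkset.
  by rewrite -(eq_name_iter (leqnn m) xs).
have Cy : C s y by split => //; rewrite /U/= in_itv.
split => //; split => //.
have xny : x <> y by move=> xy'; apply: xs; rewrite xy'.
have [xy'|yx'|//] := ltgtP x y.
  left; rewrite /= in_itv/= infC//=.
  suff : x <= inf (C s) by move: xy; rewrite ler_norml => /andP[]; lra.
  apply: lb_le_inf; first by exists y.
  move=> z [_ /= zs]; rewrite leNgt; apply/negP => zx; apply: xs.
  by apply: (cell_convex clT (x := z) (z := y)) => //; rewrite zx.
right; rewrite /= in_itv/= supC// andbT.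
suff : sup (C s) <= x by move: xy; rewrite ler_norml => /andP[]; lra.
apply: ge_sup; first by exists y.
move=> z [_ /= zs]; rewrite leNgt; apply/negP => zx; apply: xs.
by apply: (cell_convex clT (x := y) (z := z)) => //; rewrite zx andbT.
Qed.

End ThickCells.

(** * Decoupling a thick set from the image at time [n] *)

Section QuasiIndependence.
Context {R : realType}.
Variables (mu : probability R R) (T : R -> R) (J : set nat) (I : nat -> interval R).
Hypotheses (clT : classT mu T J I) (pB : propertyB mu T J I).

Let bdmu : bdd_equiv mu. Proof. by case: clT. Qed.
Let mpT : mpreserving mu T. Proof. by case: clT => _ [_ []]. Qed.

Notation label := (ilabel J I).
Notation lname := (name T label).
Let mlab : forall a, measurable (label @^-1` [set a]) := measurable_ilabel clT.

(* [E n] is covered, up to a small set, by the cylinders of order [q = n - n %/ D] that meet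
   it; at the given entropies those are much shorter than the boundary scale of [E n], and
   the remaining gap [n %/ D] lets property B decouple them from [T^-n A]. *)
Lemma thick_quasi_independent (h h2 : R) : 0 <= h -> h < h2 ->
  (h2%:E < KS_entropy mu T)%E ->
  exists C : R, 0 <= C /\ forall E, (forall n, measurable (E n)) -> thick mu E h ->
  forall A, measurable A -> forall e, 0 < e -> exists N, forall n, (N <= n)%N ->
  pr mu (E n `&` iter n T @^-1` A) <= C * pr mu (E n) * pr mu A + e.
Proof.
move=> h0 hh2 KS; have [c [b [c0 bcv hB]]] := name_propertyB clT pB.
exists c; split; first exact: ltW.
move=> E mE tE A mA e' e'0.
have [c' [c'1 [_ hc']]] := pr_itv_le bdmu.
have c'0 : 0 < c' by exact: lt_le_trans c'1.
(* Three losses are to be paid for: the deviation [d1] in [cell_lower], the shortening from [n] to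
   [q n], and the density constant [c']. *)
pose e := (h2 - h) / 3; have e0 : 0 < e by rewrite /e; lra.
have h20 : 0 < h2 by lra.
(* [D] is large enough for the shortening to cost at most [n%:R * e], and at least 2 so that [q n]
   is at least half of [n]. *)
pose D := (Num.bound (h2 / e)).+2.
have hD : h2 <= D%:R * e.
  rewrite -ler_pdivrMr//; apply: le_trans (ltW (archi_boundP _)) _.
    by rewrite divr_ge0 ?ltW.
  by rewrite ler_nat /D; do 2 apply: leqW.
have D0 : 0 < D%:R :> R by rewrite ltr0n.
pose q n := (n - n %/ D)%N.
have qE n : (n %/ D + q n)%N = n by rewrite /q subnKC// leq_div.
have qD n : (n %/ D)%:R * h2 <= n%:R * e.
  apply: le_trans (_ : (n %/ D)%:R * (D%:R * e) <= _).
    by rewrite ler_wpM2l.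
  by rewrite mulrA ler_pM2r// -natrM ler_nat leq_divM.
have qhalf n : (n <= 2 * q n)%N.
  rewrite -{1}(qE n) mul2n -addnn leq_add2r /q leq_subRL ?leq_div// addnn -muln2.
  by apply: leq_trans (leq_divM n D); rewrite leq_mul2l orbT.
(* The final error is [d] from the cover, [c * d] from the excess of [DD] over [E n], and [d] from
   the additive term of property B. *)
pose d := e' / (3 * (c + 1)).
have d0 : 0 < d by rewrite divr_gt0// mulr_gt0//; lra.
pose d1 := Num.min d e.
have d10 : 0 < d1 by rewrite lt_min d0 e0.
have [N1 hN1] := cell_lower clT KS d10.
have [N2 hN2] := tE _ d0.
have [N3 hN3] := eventually_linear (ln c') e0.
have [N4 _ hN4] : \forall n \near \oo, `|b n| < d.
  by move/cvgrPdist_lt: bcv => /(_ _ d0); under eq_near do rewrite sub0r normrN.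
exists (maxn 1 (maxn (2 * N1) (maxn N2 (maxn N3 (D * N4))))) => n.
rewrite !geq_max => /and5P[n0 n1 /hN2[B [mB Bd hBB]] /hN3 {}hN3 n4].
have qN1 : (N1 <= q n)%N by rewrite -(@leq_pmul2l 2)// (leq_trans n1 (qhalf n)).
have q0 : (0 < q n)%N by rewrite -(@ltn_pmul2l 2)// muln0 (leq_trans n0 (qhalf n)).
have {}hN4 : b (n %/ D)%N <= d.
  apply: le_trans (ler_norm _) (ltW (hN4 _ _)) => /=.
  by rewrite leq_divRL// mulnC.
pose small s := pname mu T label s <= expR (- ((q n)%:R * (h2 - d1))).
pose S := [set s | exists x, [/\ E n x, 0 <= x <= 1, lname (q n) x = s, 0%N \notin s & small s]].
pose DD := lname (q n) @^-1` S.
have mDD : measurable DD by exact: (measurable_name mpT mlab).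
pose G := [set x | expR (- ((q n)%:R * (h2 - d1))) < pname mu T label (lname (q n) x)].
have mG : measurable G.
  exact: (measurable_name mpT mlab _ [set s | expR (- ((q n)%:R * (h2 - d1))) < pname mu T label s]).
have pG : pr mu G <= d.
  by apply: le_trans (hN1 _ qN1) _; rewrite ge_min lexx.
pose Z := [set x | 0%N \in lname (q n) x] `|` ~` `[0 : R, 1]%classic.
have m1 := measurable_lname0 clT (q n).
have m2 : measurable (~` `[0 : R, 1]%classic) by exact: measurableC.
have mZ : measurable Z by exact: measurableU.
have pZ : pr mu Z = 0.
  apply/eqP; rewrite eq_le pr_ge0 andbT; apply: le_trans (prU_le mu m1 m2) _.
  by rewrite (lname0_null clT) prC ?(pr_unit clT) ?subrr ?addr0.
have mTA : measurable (iter n T @^-1` A) by exact: (preimage_iter_measurable mpT).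
have cover : pr mu (E n `&` iter n T @^-1` A) <= pr mu (DD `&` iter n T @^-1` A) + d.
  have mDA : measurable (DD `&` iter n T @^-1` A) by exact: measurableI.
  have mGZ : measurable (G `|` Z) by exact: measurableU.
  apply: (@le_trans _ _ (pr mu (DD `&` iter n T @^-1` A) + pr mu (G `|` Z))); last first.
    by rewrite lerD2l; apply: le_trans (prU_le mu mG mZ) _; rewrite pZ addr0.
  apply: le_prU => //; first exact: measurableI.
  move=> x [Ex Ax]; have [|nG] := pselect (G x); first by right; left.
  have [|nZ] := pselect (Z x); first by right; right.
  left; split => //; exists x; split => //.
  - by apply: contrapT => x01; apply: nZ; right; rewrite /= in_itv.
  - by apply/negP => x0; apply: nZ; left.
  - by rewrite /small leNgt; apply/negP.
(* A cell containing [x] and [y] contains the segment between them, so its small measure bounds the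
   length of the segment through the density constant. *)
have diam s x y : small s -> 0%N \notin s -> lname (q n) x = s -> lname (q n) y = s ->
    0 <= x -> y <= 1 -> x <= y -> y - x <= expR (- (n%:R * h)).
  move=> ss s0 xs ys x0 y1 xy.
  apply: le_trans (hc' x y (lname (q n) @^-1` [set s]) xy x0 y1 _ _) _.
  - exact: (measurable_name1 mpT mlab).
  - move=> z /=; rewrite in_itv/= !le_eqVlt => /andP[/predU1P[<-//|xz] /predU1P[->//|zy]].
    by apply: (cell_convex clT (x := x) (z := y)) => //; rewrite xz zy.
  rewrite -[X in X * _](lnK c'0).
  have -> : pr mu (lname (q n) @^-1` [set s]) = pname mu T label s.
    by rewrite /pname -xs size_name.
  apply: (@le_trans _ _ (expR (ln c') * expR (- ((q n)%:R * (h2 - d1))))).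
    by rewrite ler_pM2l ?expR_gt0.
  rewrite -expRD ler_expR.
  have : (q n)%:R * (h2 - e) <= (q n)%:R * (h2 - d1).
    by apply: ler_wpM2l => //; rewrite lerD2l lerN2 ge_min lexx orbT.
  have := qD n; have : n%:R = (n %/ D)%:R + (q n)%:R :> R by rewrite -natrD qE.
  have : 0 <= (n %/ D)%:R * e by rewrite mulr_ge0// ltW.
  have -> : h = h2 - e - e - e by rewrite /e; lra.
  rewrite !mulrBr => he hq hqD hd; rewrite hq in hN3 hqD *.
  by rewrite !mulrDl in hN3 hqD *; lra.
(* A point of [DD] shares a short cell with a point of [E n]; if it is not in [E n] itself,
   thickness puts it in the small set [B]. *)
have pDD : pr mu DD <= pr mu (E n) + d.
  have mBZ : measurable (B `|` Z) by exact: measurableU.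
  apply: (@le_trans _ _ (pr mu (E n) + pr mu (B `|` Z))); last first.
    by rewrite lerD2l; apply: le_trans (prU_le mu mB mZ) _; rewrite pZ addr0.
  apply: le_prU => // y [x [Ex x01 xy y0 ys]].
  have [|nE] := pselect (E n y); [by left|right].
  have [|nZ] := pselect (Z y); [by right|left].
  have y01 : 0 <= y <= 1.
    by apply: contrapT => y01; apply: nZ; right; rewrite /= in_itv.
  apply: (hBB x y) => //.
  move: (x01) (y01) => /andP[x0 x1] /andP[yy0 y1].
  have [xy'|yx'] := leP x y.
    by rewrite distrC ger0_norm ?subr_ge0//; apply: (diam (lname (q n) y)).
  rewrite ger0_norm; last by rewrite subr_ge0 ltW.
  apply: (diam (lname (q n) y)) => //; exact: ltW.
have := hB (q n) (n %/ D)%N S A q0 mA; rewrite qE => hDA.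
have p1 := pr_le1 mu mA; have p0 := pr_ge0 mu A.
apply: le_trans cover _.
have hfin : c * pr mu DD * pr mu A <= c * pr mu (E n) * pr mu A + c * d.
  apply: (@le_trans _ _ (c * (pr mu (E n) + d) * pr mu A)).
    by rewrite ler_wpM2r// ler_wpM2l// ltW.
  rewrite mulrDr mulrDl lerD2l ler_piMr// mulr_ge0// ltW//.
have : 3 * (c + 1) * d = e' by rewrite /d mulrC divfK// gt_eqF// mulr_gt0//; lra.
have : 0 <= c * d by rewrite mulr_ge0// ltW.
by rewrite -/DD in hDA; lra.
Qed.

End QuasiIndependence.

(** * Visits to several sets at once, along the different maps *)

Section Boxes.
Context {R : realType}.
Variables (k : nat) (mu : nat -> probability R R) (T : nat -> R -> R).
Variables (J : nat -> set nat) (I : nat -> nat -> interval R).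
Hypothesis clT : forall i, (i <= k)%N -> classT (mu i) (T i) (J i) (I i).
Hypothesis pB : forall i, (1 <= i <= k)%N -> propertyB (mu i) (T i) (J i) (I i).
Hypothesis KSlt : forall i, (i < k)%N ->
  (KS_entropy (mu i) (T i) < KS_entropy (mu i.+1) (T i.+1))%E.
Hypothesis KS0 : (0 <= KS_entropy (mu 0%N) (T 0%N))%E.

Let bdmu i : (i <= k)%N -> bdd_equiv (mu i). Proof. by move=> /clT[]. Qed.
Let mpT i : (i <= k)%N -> mpreserving (mu i) (T i).
Proof. by move=> /clT[_ [_ []]]. Qed.

Fixpoint box (A : nat -> set R) j n : set R :=
  if j is j'.+1 then box A j' n `&` iter n (T j) @^-1` A j else iter n (T 0%N) @^-1` A 0%N.

Lemma boxP A j n x : box A j n x <-> forall i, (i <= j)%N -> A i (iter n (T i) x).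
Proof.
elim: j => [|j IH] /=.
  by split=> [h i|]; [rewrite leqn0 => /eqP ->|exact].
split=> [[/IH h Aj] i|h].
  by rewrite leq_eqVlt => /predU1P[->//|]; exact: h.
by split; [apply/IH => i ij; apply: h; exact: leqW|exact: h].
Qed.

Lemma measurable_box A j n : (j <= k)%N -> (forall i, measurable (A i)) ->
  measurable (box A j n).
Proof.
move=> + mA; elim: j => [|j IH] jk /=; first exact: (preimage_iter_measurable (mpT jk)).
apply: measurableI; first by apply: IH; exact: ltnW.
exact: (preimage_iter_measurable (mpT jk)).
Qed.

Lemma KS_mono i j : (i <= j)%N -> (j <= k)%N ->
  (KS_entropy (mu i) (T i) <= KS_entropy (mu j) (T j))%E.
Proof.
elim: j => [|j IH]; first by rewrite leqn0 => /eqP ->.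
rewrite leq_eqVlt => /predU1P[->//|ij jk].
by apply: le_trans (IH ij (ltnW jk)) (ltW (KSlt jk)).
Qed.

Lemma box_bound j : (j <= k)%N -> exists C : R, 0 <= C /\
  forall A, (forall i, measurable (A i)) -> forall e, 0 < e ->
  exists N, forall n, (N <= n)%N ->
  pr (mu 0%N) (box A j n) <= C * \prod_(i < j.+1) pr (mu i) (A i) + e.
Proof.
elim: j => [|j IH] jk.
  exists 1; split => // A mA e e0; exists 0%N => n _ /=.
  by rewrite (pr_iter (mpT jk))// big_ord1 mul1r lerDl ltW.
have [C [C0 hC]] := IH (ltnW jk).
have KSj := KSlt jk.
have KSj0 : (0 <= KS_entropy (mu j) (T j))%E.
  by apply: le_trans KS0 (KS_mono (leq0n _) (ltnW jk)).
have [h hE] : exists h : R, KS_entropy (mu j) (T j) = h%:E.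
  exists (fine (KS_entropy (mu j) (T j))); rewrite fineK// ge0_fin_numE//.
  by apply: lt_le_trans KSj _; exact: leey.
have [h3 h3h h3KS] : exists2 h3 : R, h < h3 & (h3%:E < KS_entropy (mu j.+1) (T j.+1))%E.
  move: KSj; rewrite hE; case: KS_entropy => [r|_|//].
    by rewrite lte_fin => hr; exists ((h + r) / 2); [|rewrite lte_fin]; lra.
  by exists (h + 1); [lra|exact: ltry].
have h0 : 0 <= h by rewrite -lee_fin -hE.
(* The common scale of the boundaries: strictly above [h], so that the cells of the earlier maps are
   thick at this scale, and strictly below [h3], so that the cells of the next map are shorter. *)
pose h1 := (h + h3) / 2.
have hh1 : h < h1 by rewrite /h1; lra.
have h13 : h1 < h3 by rewrite /h1; lra.
have h10 : 0 <= h1 by lra.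
have [Cq [Cq0 hq]] := thick_quasi_independent (clT jk) (@pB j.+1 jk) h10 h13 h3KS.
have i0k : (0 <= k)%N by [].
have [D [D0 hD]] := bdd_equiv_le (bdmu i0k) (bdmu jk).
have [D' [D'0 hD']] := bdd_equiv_le (bdmu jk) (bdmu i0k).
have /choice[F hF] (i : nat) : exists F : R, 0 < F /\ ((i <= j)%N -> forall A, measurable A ->
    pr (mu 0%N) A <= F * pr (mu i) A).
  have [ij|ij] := leqP i j; last by exists 1.
  have [F [F0 hF]] := bdd_equiv_le (bdmu (leq_trans ij (ltnW jk))) (bdmu i0k).
  by exists F.
have /choice[G hG] (i : nat) : exists G : R, 0 < G /\ ((i <= j)%N -> forall A, measurable A ->
    pr (mu j.+1) A <= G * pr (mu i) A).
  have [ij|ij] := leqP i j; last by exists 1.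
  have [G [G0 hG]] := bdd_equiv_le (bdmu (leq_trans ij (ltnW jk))) (bdmu jk).
  by exists G.
exists (D' * Cq * D * C); split; first by rewrite !mulr_ge0//; exact: ltW.
move=> A mA e e0.
(* An error [dl] occurs with the factors [D' * Cq * D] (twice), [D'] and 1; their sum is at most
   [4 * K]. *)
pose K := D' * Cq * D + D' + 1.
have K0 : 0 < K by rewrite /K !ltr_wpDl// ?addr_ge0// ?mulr_ge0// ltW.
pose dl := e / (4 * K); have dl0 : 0 < dl by rewrite divr_gt0// mulr_gt0.
have j0 : 0 < j.+1%:R :> R by rewrite ltr0n.
have /choice[B hB] (i : nat) : exists B : set R, (i <= j)%N -> exists l S,
    B = name (T i) (ilabel (J i) (I i)) l @^-1` S /\
    F i * pr (mu i) (symdiff (A i) B) <= dl / j.+1%:R.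
  have [ij|ij] := leqP i j; last by exists setT.
  have ik : (i <= k)%N by apply: leq_trans ij (ltnW jk).
  have F0 : 0 < F i by case: (hF i).
  have dF : 0 < dl / j.+1%:R / F i by apply: divr_gt0 => //; exact: divr_gt0.
  have [l [S hS]] := name_approx (clT ik) (mA i) dF.
  exists (name (T i) (ilabel (J i) (I i)) l @^-1` S) => _; exists l, S; split => //.
  by rewrite mulrC -ler_pdivlMr.
pose A' i := if (i <= j)%N then B i else A i.
have mA' i : measurable (A' i).
  rewrite /A'; case: leqP => // ij; have [l [S [-> _]]] := hB i ij.
  have ik : (i <= k)%N by apply: leq_trans ij (ltnW jk).
  exact: (measurable_name (mpT ik) (measurable_ilabel (clT ik))).
have msd i : measurable (symdiff (A i) (A' i)).
  by apply: measurableU; exact: measurableD.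
have thE : thick (mu j.+1) (box A' j) h1.
  suff : forall i, (i <= j)%N -> thick (mu j.+1) (box A' i) h1 by exact.
  have one i : (i <= j)%N -> thick (mu j.+1) (fun n => iter n (T i) @^-1` A' i) h1.
    move=> ij; have ik : (i <= k)%N by apply: leq_trans ij (ltnW jk).
    apply: (@thick_le _ (mu i) _ _ _ (G i)); [by case: (hG i)|by case: (hG i) => _; exact|].
    rewrite /A' ij; have [l [S [-> _]]] := hB i ij.
    apply: (thick_cells (clT ik) (h := h)) => //.
    by rewrite -hE; exact: (KS_mono ij (ltnW jk)).
  elim=> [|i IHi] ij; first exact: one.
  by apply: thickI; [exact/IHi/ltnW|exact: one].
have mbox X i n : (i <= j)%N -> (forall i, measurable (X i)) -> measurable (box X i n).
  by move=> ij; apply: measurable_box; exact: leq_trans ij (ltnW jk).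
(* Uniform in [n] because each [T i] preserves [mu i]. *)
have swap X Y n : (forall i, measurable (X i)) -> (forall i, measurable (Y i)) ->
    (forall i x, (i <= j)%N -> X i x -> ~ Y i x -> symdiff (A i) (A' i) x) ->
    pr (mu 0%N) (box X j n `\` box Y j n) <= dl.
  move=> mX mY XY; pose H i := if (i <= j)%N then iter n (T i) @^-1` symdiff (A i) (A' i) else set0.
  have mH i : measurable (H i).
    rewrite /H; case: leqP => // ij.
    have ik : (i <= k)%N by apply: leq_trans ij (ltnW jk).
    exact: (preimage_iter_measurable (mpT ik)).
  apply: (@le_trans _ _ (\sum_(i <- iota 0 j.+1) pr (mu 0%N) (H i))).
    apply: le_pr_bigcup_seq => //; first by apply: measurableD; exact: mbox.
    move=> x [/boxP Xx /boxP nY]; apply: contrapT => hn; apply: nY => i ij.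
    apply: contrapT => nYi; apply: hn; exists i; first by rewrite mem_iota.
    by rewrite /H ij; apply: XY => //; exact: Xx.
  apply: (@le_trans _ _ (\sum_(i <- iota 0 j.+1) dl / j.+1%:R)).
    rewrite !big_seq; apply: ler_sum => i; rewrite mem_iota add0n ltnS => /andP[_ ij].
    have ik : (i <= k)%N by apply: leq_trans ij (ltnW jk).
    rewrite /H ij; have [_ /(_ ij) h'] := hF i.
    apply: le_trans (h' _ _) _; first exact: (preimage_iter_measurable (mpT ik)).
    rewrite (pr_iter (mpT ik))//; have [l [S [_ ]]] := hB i ij.
    by rewrite /A' ij.
  by rewrite big_const_seq count_predT size_iota iter_addr_0 -[leLHS]mulr_natr divfK ?lt0r_neq0.
have [N1 hN1] := hC A mA dl dl0.
have [N2 hN2] := hq _ (fun n => mbox A' j n (leqnn j) mA') thE (A j.+1) (mA _) dl dl0.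
exists (maxn N1 N2) => n; rewrite geq_max => /andP[/hN1 {}hN1 /hN2 {}hN2].
have mTA : measurable (iter n (T j.+1) @^-1` A j.+1) by exact: (preimage_iter_measurable (mpT jk)).
have mb := mbox A j n (leqnn j) mA; have mb' := mbox A' j n (leqnn j) mA'.
have s1 : pr (mu 0%N) (box A j.+1 n) <=
    pr (mu 0%N) (box A' j n `&` iter n (T j.+1) @^-1` A j.+1) + dl.
  have := swap A A' n mA mA' (fun i x _ h1 h2 => or_introl (conj h1 h2)).
  move=> sw; apply: le_trans (lerD (lexx _) sw); apply: le_prU.
  - exact: measurableI.
  - exact: measurableD.
  - exact: (@measurable_box A j.+1).
  - move=> x [bx Tx]; have [b'x|b'x] := pselect (box A' j n x); first by left.
    by right.
have s2 : pr (mu 0%N) (box A' j n) <= pr (mu 0%N) (box A j n) + dl.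
  have := swap A' A n mA' mA (fun i x _ h1 h2 => or_intror (conj h1 h2)).
  move=> sw; apply: le_trans (lerD (lexx _) sw); apply: le_prU => //.
    exact: measurableD.
  by move=> x b'x; have [bx|bx] := pselect (box A j n x); [left|right].
have s3 := hD' _ (measurableI _ _ mb' mTA).
have s4 := hD _ mb'.
rewrite big_ord_recr/=; set P := \prod_(i < j.+1) _ in hN1 *.
set a := pr (mu j.+1) (A j.+1) in hN2 *.
have a0 : 0 <= a by exact: pr_ge0.
have a1 : a <= 1 by exact: pr_le1.
have t1 : Cq * pr (mu j.+1) (box A' j n) * a <= Cq * D * C * P * a + Cq * D * (dl + dl).
  apply: (@le_trans _ _ (Cq * (D * (C * P + dl + dl)) * a)).
    rewrite ler_wpM2r// ler_wpM2l//; apply: le_trans s4 _; rewrite ler_pM2l//; lra.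
  have : Cq * D * (dl + dl) * a <= Cq * D * (dl + dl).
    by rewrite ler_piMr// !mulr_ge0// ?ltW// addr_gt0.
  by rewrite !mulrDr !mulrDl !mulrA; lra.
have t2 : D' * pr (mu j.+1) (box A' j n `&` iter n (T j.+1) @^-1` A j.+1) <=
    D' * (Cq * D * C * P * a + Cq * D * (dl + dl) + dl).
  by rewrite ler_pM2l//; lra.
have t3 : 4 * K * dl = e by rewrite /dl mulrC divfK// gt_eqF// mulr_gt0.
have t4 : 0 <= D' * Cq * D * dl by exact: (mulr_ge0 (mulr_ge0 (mulr_ge0 (ltW D'0) Cq0) (ltW D0)) (ltW dl0)).
have t5 : 0 <= D' * dl by exact: (mulr_ge0 (ltW D'0) (ltW dl0)).
set u := D' * Cq * D * dl in t4; set v := D' * dl in t5.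
have {}t3 : 4 * u + 4 * v + 4 * dl = e by rewrite -t3 /u /v /K; ring.
have {}t2 : D' * pr (mu j.+1) (box A' j n `&` iter n (T j.+1) @^-1` A j.+1) <=
    D' * Cq * D * C * (P * a) + u + u + v.
  by apply: le_trans t2 _; rewrite le_eqVlt; apply/orP; left; apply/eqP; rewrite /u /v; ring.
clearbody dl u v P a.
by lra.
Qed.

End Boxes.

(** * The product system *)

Section ProductMeasure.
Context {R : realType}.

Definition cylinder n (A : 'I_n -> set R) : set (n.-tuple R) :=
  [set x | forall i, A i (tnth x i)].

Lemma measurable_cylinder n (A : 'I_n -> set R) :
  (forall i, measurable (A i)) -> measurable (cylinder A).
Proof.
move=> mA; rewrite (_ : cylinder A = \big[setI/setT]_(i < n) ((@tnth n R) ^~ i @^-1` A i)).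
  apply: bigsetI_measurable => i _; rewrite -[X in measurable X]setTI.
  exact: measurable_tnth.
rewrite -bigcap_seq; apply/seteqP; split=> x h i; first by move=> _; exact: h.
by apply: (h i); rewrite /= mem_index_enum.
Qed.

(** The ergodicity assumption speaks of every measure with product values on boxes; this provides
    one to which it can be applied. *)
Lemma product_probability_exists n (mu : nat -> probability R R) :
  exists P : probability (n.-tuple R) R,
    forall A : 'I_n -> set R, (forall i, measurable (A i)) ->
      P (cylinder A) = (\prod_(i < n) mu i (A i))%E.
Proof.
elim: n mu => [|n IH] mu.
  exists (\d_ ([tuple] : 0.-tuple R)) => A mA; rewrite big_ord0 /= diracE mem_set//.
  by case.
have [P hP] := IH (fun i => mu i.+1).
pose phi (x : R * n.-tuple R) : n.+1.-tuple R := [the n.+1.-tuple R of x.1 :: x.2].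
have mphi : measurable_fun setT phi by apply: measurable_cons.
pose X := MeasurableFun.Pack (MeasurableFun.Class (isMeasurableFun.Build _ _ _ _ _ mphi)).
exists (distribution (mu 0%N \x P)%E X) => A mA.
rewrite /distribution /pushforward /=.
rewrite (_ : _ @^-1` _ = A ord0 `*` cylinder (fun i => A (lift ord0 i))).
  rewrite product_measure1E//; last by apply: measurable_cylinder.
  by rewrite big_ord_recl; congr (_ * _)%E; apply: hP => i.
apply/seteqP; split=> -[x t] /=.
  by move=> h; split=> [|i]; [exact: (h ord0)|have := h (lift ord0 i); rewrite tnthS].
move=> [x0 h] i; have [->//|i0] := eqVneq i ord0.
have [j ->] : exists j, i = lift ord0 j by case: (unliftP ord0 i) i0 => [j ->|->]; [exists j|rewrite eqxx].
by rewrite tnthS.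
Qed.

Section ProductMap.
Variables (k : nat) (mu : nat -> probability R R) (T : nat -> R -> R).
Variable P : probability (k.+1.-tuple R) R.
Hypothesis mpT : forall i, (i <= k)%N -> mpreserving (mu i) (T i).
Hypothesis prodP : is_product_measure mu P.

Lemma tnth_iter_prod_map n x (i : 'I_k.+1) :
  tnth (iter n (@prod_map R k T) x) i = iter n (T i) (tnth x i).
Proof. by elim: n => //= n IH; rewrite tnth_mktuple IH. Qed.

(** Boxes are stable under intersection and generate the sigma-algebra, and on a box the image
    measure is computed coordinate by coordinate. *)
Lemma prod_map_mpreserving : mpreserving P (@prod_map R k T).
Proof.
have mT (i : 'I_k.+1) : measurable_fun setT (T i) by apply: (proj1 (mpT (leq_ord i))).
have mpm : measurable_fun setT (@prod_map R k T).
  apply/measurable_fun_tnthP => i.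
  rewrite (_ : _ \o _ = T i \o (@tnth _ R ^~ i)); last first.
    by apply/funext => x /=; rewrite tnth_mktuple.
  by apply: measurableT_comp; [exact: mT|exact: measurable_tnth].
split=> // A mA.
pose X := MeasurableFun.Pack (MeasurableFun.Class (isMeasurableFun.Build _ _ _ _ _ mpm)).
pose G : set (set (k.+1.-tuple R)) :=
  [set B | exists2 A : 'I_k.+1 -> set R, (forall i, measurable (A i)) & B = cylinder A].
have GT : G setT.
  by exists (fun=> setT) => //; apply/seteqP; split.
change (distribution P X A = P A).
apply: (measure_unique G (fun=> setT)) => //.
- apply/seteqP; split.
    apply: smallest_sub; first exact: smallest_sigma_algebra.
    rewrite -bigcup_seq => B [i _ [C mC <-]]; apply: sub_sigma_algebra.
    exists (fun j => if j == i then C else setT).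
      by move=> j; case: ifP.
    rewrite setTI; apply/seteqP; split=> x /= h; last by have := h i; rewrite eqxx.
    by move=> j; case: eqP => // ->.
  apply: smallest_sub; first exact: sigma_algebra_measurable.
  by move=> B [C mC ->]; exact: measurable_cylinder.
- move=> _ _ [A1 mA1 ->] [A2 mA2 ->]; exists (fun i => A1 i `&` A2 i).
    by move=> i; exact: measurableI.
  apply/seteqP; split=> x /=; first by move=> [h1 h2] i; split.
  by move=> h; split=> i; have [] := h i.
- by apply/seteqP; split=> x // _; exists 0%N.
- move=> _ [B mB ->]; change (P (prod_map T @^-1` cylinder B) = P (cylinder B)).
  rewrite (_ : _ @^-1` _ = cylinder (fun i : 'I_k.+1 => T i @^-1` B i)); last first.
    by apply/seteqP; split=> x /= h i; have := h i; rewrite tnth_mktuple.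
  have mTB (i : 'I_k.+1) : measurable (T i @^-1` B i).
    by rewrite -[X in measurable X]setTI; exact: mT.
  rewrite !prodP//; apply: eq_bigr => i _.
  exact: (proj2 (mpT (leq_ord i))).
- move=> _; change (P (prod_map T @^-1` setT) < +oo)%E.
  by rewrite preimage_setT probability_setT ltry.
Qed.

End ProductMap.

End ProductMeasure.

Section AbsoluteContinuity.
Context {R : realType} {d : measure_display} {X : measurableType d}.

(** A Borel-Cantelli argument: otherwise there are sets [F n] of [mu]-measure at most [2^-1 ^+ n]
    and [nu]-measure above [e]. Their limsup [Z] is null for [mu], hence for [nu], whereas the tails
    [G n] decreasing to it keep [nu]-measure above [e]. *)
Lemma pr_absolutely_continuous (mu nu : probability X R) :
  (forall A, measurable A -> pr mu A = 0 -> pr nu A = 0) ->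
  forall e, 0 < e -> exists2 dl, 0 < dl &
    forall A, measurable A -> pr mu A <= dl -> pr nu A <= e.
Proof.
move=> ac e e0; apply: contrapT => hn.
have /choice[F hF] (n : nat) : exists A : set X,
    [/\ measurable A, pr mu A <= 2^-1 ^+ n & e < pr nu A].
  apply: contrapT => h; apply: hn; exists (2^-1 ^+ n); first by rewrite exprn_gt0// invr_gt0.
  move=> A mA pA; rewrite leNgt; apply/negP => eA; apply: h.
  by exists A.
have mF n : measurable (F n) by case: (hF n).
pose G n := \bigcup_(j in [set j | (n <= j)%N]) F j.
have mG n : measurable (G n) by exact: bigcup_measurable.
have niG n m : (n <= m)%N -> G m `<=` G n.
  by move=> nm x [j /= mj Fj]; exists j => //=; exact: leq_trans mj.
pose Z := \bigcap_n G n.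
have mZ : measurable Z by exact: bigcapT_measurable.
have pG n : pr mu (G n) <= 2 * 2^-1 ^+ n.
  apply/ler_addgt0Pr => e' e'0.
  pose H K := \big[setU/set0]_(j < K) F (n + j)%N.
  have HP K x : H K x <-> exists2 j, (j < K)%N & F (n + j)%N x.
    rewrite /H -bigcup_seq; split=> [[j _ Fj]|[j jk Fj]]; first by exists j.
    by exists (Ordinal jk) => //=; rewrite mem_index_enum.
  have mH K : measurable (H K) by exact: bigsetU_measurable.
  have [||K /(_ K (leqnn _)) hK] := pr_cvg mu mH (mG n) _ _ e'0.
  - by move=> k l kl x /HP[j jk Fj]; apply/HP; exists j => //; exact: leq_trans kl.
  - move=> x [j /= nj Fj]; exists (j - n).+1 => //; apply/HP; exists (j - n)%N => //.
    by rewrite subnKC.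
  apply: le_trans hK _; rewrite lerD2r.
  suff : forall K, pr mu (H K) <= 2 * 2^-1 ^+ n - 2 * 2^-1 ^+ (n + K).
    move=> /(_ K) h; apply: le_trans h _; rewrite gerBl mulr_ge0// exprn_ge0// invr_ge0//.
  elim=> [|K' IH]; first by rewrite /H big_ord0 pr0 addn0 subrr.
  rewrite /H big_ord_recr /=; apply: le_trans (prU_le mu (mH K') (mF _)) _.
  have [_ h _] := hF (n + K')%N; apply: le_trans (lerD IH h) _.
  by rewrite addnS exprS; lra.
have Z0 : pr mu Z = 0.
  apply/eqP; rewrite eq_le pr_ge0 andbT; apply/ler_addgt0Pr => e' e'0; rewrite add0r.
  have ln2 : 0 < ln (2 : R) by apply: ln_gt0; rewrite ltr1n.
  have e'2 : 0 < e' / 2 by rewrite divr_gt0.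
  have [N hN] := expRN_small ln2 e'2.
  apply: (@le_trans _ _ (pr mu (G N))); first by apply: le_pr => // x /(_ N I).
  apply: le_trans (pG N) _; have := hN N (leqnn _).
  rewrite expRN expRM_natl lnK ?posrE// exprVn; lra.
have := ac Z mZ Z0 => nZ.
have e2 : 0 < e / 2 by rewrite divr_gt0.
have [|||N hN] := @pr_cvg0 _ _ _ nu (fun n => G n `\` Z) (e / 2) _ _ _ e2.
- by move=> n; exact: measurableD.
- by move=> n m nm x [Gx nZx]; split => //; exact: niG Gx.
- move=> x; have [Zx|] := pselect (Z x); first by exists 0%N; case.
  by move=> /existsNP[n /not_implyP[_ h]]; exists n; case.
have [_ _ h] := hF N.
have : pr nu (F N) <= pr nu Z + pr nu (G N `\` Z).
  apply: le_prU => //; first exact: measurableD.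
  move=> x Fx; have [|nZx] := pselect (Z x); [by left|right; split => //].
  by exists N => /=.
by have := hN N (leqnn _); lra.
Qed.

End AbsoluteContinuity.

(** * Averages of products *)

Section Elementary.
Context {R : realType}.

Lemma normr_prod_le n (a : 'I_n -> R) B : 0 <= B -> (forall i, `|a i| <= B) ->
  `|\prod_(i < n) a i| <= B ^+ n.
Proof.
move=> B0 aB; rewrite normr_prod -[n in leRHS](card_ord n) -prodr_const.
by apply: ler_prod => i _; rewrite normr_ge0 aB.
Qed.

(** The factors are exchanged one at a time; [1 <= B] allows every partial product to be bounded by
    the full power of [B]. *)
Lemma prod_approx n (a b : 'I_n -> R) B eta : 1 <= B -> 0 <= eta ->
  (forall i, `|a i| <= B) -> (forall i, `|b i| <= B) ->
  (forall i, `|a i - b i| <= eta) ->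
  `|\prod_(i < n) a i - \prod_(i < n) b i| <= n%:R * B ^+ n * eta.
Proof.
move=> B1 e0; have B0 : 0 <= B by exact: le_trans B1.
elim: n a b => [|n IH] a b aB bB ab.
  by rewrite !big_ord0 subrr normr0 !mul0r.
rewrite !big_ord_recr /=; set p := \prod_(i < n) _; set q := \prod_(i < n) _.
have -> : p * a ord_max - q * b ord_max = p * (a ord_max - b ord_max) + (p - q) * b ord_max by ring.
apply: le_trans (ler_normD _ _) _; rewrite !normrM.
have hp : `|p| <= B ^+ n by apply: normr_prod_le.
have h1 : `|p| * `|a ord_max - b ord_max| <= B ^+ n * eta by apply: ler_pM.
have h2 : `|p - q| * `|b ord_max| <= (n%:R * B ^+ n * eta) * B.
  by apply: ler_pM => //; apply: IH.
have h3 : B ^+ n * eta <= B ^+ n.+1 * eta.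
  by apply: ler_wpM2r => //; rewrite exprS ler_peMl// exprn_ge0.
apply: le_trans (lerD h1 h2) _; rewrite -natr1 exprS in h3 *; lra.
Qed.

Lemma shift_sum (u : nat -> R) B M N h : (forall n, `|u n| <= B) -> (M <= N)%N ->
  `|\sum_(M <= n < N) u (n + h)%N - \sum_(M <= n < N) u n| <= 2 * B * h%:R.
Proof.
move=> uB MN; elim: h => [|h IH].
  by under eq_bigr do rewrite addn0; rewrite subrr normr0 mulr0.
have E : \sum_(M <= n < N) u (n + h.+1)%N - \sum_(M <= n < N) u (n + h)%N =
    u (N + h)%N - u (M + h)%N.
  rewrite -sumrB; under eq_bigr do rewrite addnS -addSn.
  by rewrite (telescope_sumr (fun n => u (n + h)%N)).
rewrite -[X in `|X|](subrKA (\sum_(M <= n < N) u (n + h)%N)) E.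
have -> : 2 * B * h.+1%:R = 2 * B + 2 * B * h%:R by rewrite -natr1; ring.
apply: le_trans (ler_normD _ _) _; apply: lerD => //.
by apply: le_trans (ler_normB _ _) _; have := uB (N + h)%N; have := uB (M + h)%N; lra.
Qed.

(** The sum is averaged over its [H] shifts, and the two summations are exchanged. A shift by
    [h < H] changes only terms at the two ends, at a cost of at most [2 * B * H%:R]. *)
Lemma window_average (u : nat -> R) B c M N H : (forall n, `|u n| <= B) -> (M <= N)%N ->
  H%:R * `|\sum_(M <= n < N) u n - (N - M)%:R * c| <=
  2 * B * H%:R * H%:R + \sum_(M <= n < N) `|\sum_(h < H) u (n + h)%N - H%:R * c|.
Proof.
move=> uB MN; have B0 : 0 <= B by apply: le_trans (uB 0%N).
pose S := \sum_(M <= n < N) u n.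
have -> : H%:R * `|S - (N - M)%:R * c| =
    `|\sum_(h < H) (S - \sum_(M <= n < N) u (n + h)%N) +
      \sum_(M <= n < N) (\sum_(h < H) u (n + h)%N - H%:R * c)|.
  rewrite -[H%:R in LHS]normr_nat -normrM; congr `|_|.
  rewrite sumrB big_const_ord iter_addr_0 -[S *+ H]mulr_natl.
  rewrite [X in _ - X + _]exchange_big /= sumrB big_const_nat iter_addr_0.
  by rewrite -[H%:R * c *+ _]mulr_natl mulrBr; ring.
apply: le_trans (ler_normD _ _) _; apply: lerD; last exact: ler_norm_sum.
apply: le_trans (ler_norm_sum _ _ _) _.
apply: (@le_trans _ _ (\sum_(h < H) 2 * B * H%:R)).
  apply: ler_sum => h _; rewrite distrC; apply: le_trans (shift_sum h uB MN) _.
  by apply: ler_wpM2l; [rewrite mulr_ge0|rewrite ler_nat ltnW].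
by rewrite big_const_ord iter_addr_0 -[leLHS]mulr_natr.
Qed.

Lemma sum_lt_le M N N0 : \sum_(M <= n < N) (n < N0)%:R <= N0%:R :> R.
Proof.
apply: (@le_trans _ _ (\sum_(0 <= n < N) (n < N0)%:R)).
  have [MN|NM] := leqP M N; last by rewrite big_geq ?sumr_ge0// ltnW.
  by rewrite [leRHS](big_cat_nat (n := M))//= lerDr sumr_ge0.
have : \sum_(0 <= n < N) (n < N0)%:R <= (minn N N0)%:R :> R.
  elim: N => [|N IH]; first by rewrite big_nil min0n.
  rewrite big_nat_recr//=; case: ltnP => h.
    by rewrite (minn_idPl h) -natr1 lerD// (le_trans IH)// (minn_idPl (ltnW h)).
  by rewrite addr0 (le_trans IH)// ler_nat !(minn_idPr _)// ltnW.
by move=> /le_trans; apply; rewrite ler_nat geq_minr.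
Qed.

End Elementary.

(** * Mean convergence for functions with finitely many values *)

Section JointErgodicity.
Context {R : realType}.
Variables (k : nat) (mu : nat -> probability R R) (T : nat -> R -> R).
Variables (J : nat -> set nat) (I : nat -> nat -> interval R).
Hypothesis clT : forall i, (i <= k)%N -> classT (mu i) (T i) (J i) (I i).
Hypothesis pB : forall i, (1 <= i <= k)%N -> propertyB (mu i) (T i) (J i) (I i).
Hypothesis KS0 : (0 <= KS_entropy (mu 0%N) (T 0%N))%E.
Hypothesis KSlt : forall i, (i < k)%N ->
  (KS_entropy (mu i) (T i) < KS_entropy (mu i.+1) (T i.+1))%E.
Hypothesis ergP : forall P : probability ((k.+1).-tuple R) R,
  is_product_measure mu P -> ergodic P (@prod_map R k T).

Let mpT i : (i <= k)%N -> mpreserving (mu i) (T i).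
Proof. by move=> /clT[_ [_ []]]. Qed.

Section Simple.
Variables (m : nat) (p : 'I_k.+1 -> R -> 'I_m) (v : 'I_m -> R).
Hypothesis mp : forall i a, measurable (p i @^-1` [set a]).

Let bmf_label i : bmf (fun x => v (p i x)).
Proof.
split.
  move=> _ Y _; rewrite setTI.
  exact: (countable_fiber_measurable (mp i) [set a | Y (v a)]).
exists (\sum_a `|v a|) => x; rewrite (bigD1 (p i x))//= lerDl.
exact: sumr_ge0.
Qed.

Definition orbit_prod n x := \prod_(i < k.+1) v (p i (iter n (T i) x)).
Definition simple_mean := \prod_(i < k.+1) Ex (mu i) (fun x => v (p i x)).

Lemma bmf_orbit_prod n : bmf (orbit_prod n).
Proof.
apply: bmf_prod => i; apply: (bmf_comp _ (bmf_label i)).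
exact: (measurable_iter (mpT (leq_ord i))).
Qed.

Lemma product_Ex (P : probability (k.+1.-tuple R) R) : is_product_measure mu P ->
  Ex P (fun x => \prod_(i < k.+1) v (p i (tnth x i))) = simple_mean.
Proof.
move=> prodP.
pose cyl (a : {ffun 'I_k.+1 -> 'I_m}) := cylinder (fun i => p i @^-1` [set a i]).
have mcyl a : measurable (cyl a) by exact: measurable_cylinder.
have E x : \prod_(i < k.+1) v (p i (tnth x i)) =
    \sum_(a : {ffun 'I_k.+1 -> 'I_m}) (\prod_(i < k.+1) v (a i)) * \1_(cyl a) x.
  rewrite (bigD1 [ffun i => p i (tnth x i)])//= indicE mem_set; last first.
    by move=> i; rewrite /= ffunE.
  rewrite mulr1 [X in _ + X]big1 ?addr0; first by apply: eq_bigr => i _; rewrite ffunE.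
  move=> a ax; rewrite indicE memNset ?mulr0// => h; move/eqP: ax; apply.
  by apply/ffunP => i; rewrite ffunE; exact/esym/(h i).
rewrite (_ : (fun _ => _) = fun x => \sum_(a : {ffun 'I_k.+1 -> 'I_m})
   (\prod_(i < k.+1) v (a i)) * \1_(cyl a) x); last by apply/funext.
rewrite Ex_sum => [|a]; last by apply: bmfZ; exact: bmf_indic.
have Ei (i : 'I_k.+1) : Ex (mu i) (fun x => v (p i x)) =
    \sum_(a : 'I_m) v a * pr (mu i) (p i @^-1` [set a]).
  rewrite (_ : (fun _ => _) = fun x => \sum_(a : 'I_m) v a * \1_(p i @^-1` [set a]) x).
    rewrite Ex_sum => [|a]; last by apply: bmfZ; exact: bmf_indic.
    by apply: eq_bigr => a _; rewrite ExZ ?Ex_indic//; exact: bmf_indic.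
  apply/funext => x; rewrite (bigD1 (p i x))//= indicE mem_set// mulr1 big1 ?addr0//.
  by move=> a ax; rewrite indicE memNset ?mulr0//=; exact/nesym/eqP.
rewrite /simple_mean; under [RHS]eq_bigr do rewrite Ei.
rewrite bigA_distr_bigA; apply: eq_bigr => a _.
rewrite ExZ ?Ex_indic//; last exact: bmf_indic.
rewrite big_split; congr (_ * _); apply: EFin_inj.
rewrite -prE// prodP => [|i]; last exact: mp.
transitivity (\prod_(i < k.+1) (pr (mu i) (p i @^-1` [set a i]))%:E)%E.
  by apply: eq_bigr => i _; rewrite prE.
by rewrite prodEFin.
Qed.

(** With finitely many values, a window depends only on the words of length [H] read in each
    coordinate. The bad event is thus a finite union of boxes, in number independent of the starting
    time, and [box_bound] applies to each of them. *)
Lemma window_small (e dl : R) : 0 < e -> 0 < dl ->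
  exists H N, (0 < H)%N /\ forall n, (N <= n)%N ->
  pr (mu 0%N) [set y | H%:R * e <
    `|\sum_(h < H) orbit_prod (n + h) y - H%:R * simple_mean|] <= dl.
Proof.
move=> e0 dl0.
have [C [C0 hC]] := box_bound clT pB KSlt KS0 (leqnn k).
have [P prodP] := product_probability_exists k.+1 mu.
have mpP := prod_map_mpreserving mpT prodP.
pose F (x : k.+1.-tuple R) := \prod_(i < k.+1) v (p i (tnth x i)).
have bF : bmf F.
  apply: bmf_prod => i; apply: (bmf_comp _ (bmf_label i)).
  exact: measurable_tnth.
have EF : Ex P F = simple_mean by exact: product_Ex.
(* [C] is known before the window length [H], so the product measure of the bad boxes can be made
   small enough for [C * e1 <= dl / 2]. *)
pose e1 := Num.min e (dl / (2 * (C + 1))).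
have C1 : 0 < 2 * (C + 1) by lra.
have e10 : 0 < e1 by rewrite lt_min e0 divr_gt0.
have [H' hH'] := ergodic_theorem mpP (ergP prodP) bF e10.
pose H := maxn 1 H'; have H0 : (0 < H)%N by rewrite leq_max.
have {hH'} := hH' H (leq_maxr _ _); rewrite EF => hH.
pose Nm i x : H.-tuple 'I_m := [tuple p i (iter h (T i) x) | h < H].
have mNm (i : 'I_k.+1) t : measurable (Nm i @^-1` [set t]).
  rewrite (_ : _ @^-1` _ = \big[setI/setT]_(h < H) (iter h (T i) @^-1` (p i @^-1` [set tnth t h]))).
    apply: bigsetI_measurable => h _.
    by apply: (preimage_iter_measurable (mpT (leq_ord i))); exact: mp.
  rewrite -bigcap_seq; apply/seteqP; split=> x /=.
    by move=> <- h _ /=; rewrite tnth_mktuple.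
  move=> h; apply: eq_from_tnth => j; rewrite tnth_mktuple.
  by apply: (h j); rewrite /= mem_index_enum.
pose Phi (w : {ffun 'I_k.+1 -> H.-tuple 'I_m}) :=
  \sum_(h < H) \prod_(i < k.+1) v (tnth (w i) h).
pose bad w := H%:R * e1 < `|Phi w - H%:R * simple_mean|.
(* Boxes are indexed by all natural numbers; coordinates beyond [k] get the full line. *)
pose A (w : {ffun 'I_k.+1 -> H.-tuple 'I_m}) (i : nat) : set R :=
  if insub i is Some j then Nm j @^-1` [set w j] else setT.
have mA w i : measurable (A w i) by rewrite /A; case: insub.
have AE w (i : 'I_k.+1) : A w i = Nm i @^-1` [set w i] by rewrite /A valK.
pose l := [seq w <- enum {ffun 'I_k.+1 -> H.-tuple 'I_m} | bad w].
(* The additive errors of the [size l] bad boxes sum to at most [dl / 2]; the added 1 covers an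
   empty list. *)
pose e2 := dl / (2 * ((size l)%:R + 1)).
have s0 : 0 < (size l)%:R + 1 :> R by rewrite ltr_wpDl.
have e20 : 0 < e2 by rewrite divr_gt0// mulr_gt0.
have /choice[N hN] w := hC (A w) (mA w) e2 e20.
exists H, (\max_(w in {ffun 'I_k.+1 -> H.-tuple 'I_m}) N w); split => // n nN.
have bS : bmf (fun y => \sum_(h < H) orbit_prod (n + h) y - H%:R * simple_mean).
  apply: bmfB; last exact: bmf_cst.
  by apply: bmf_sum => h; exact: bmf_orbit_prod.
apply: (@le_trans _ _ (\sum_(w <- l) pr (mu 0%N) (box T (A w) k n))).
  apply: le_pr_bigcup_seq.
  - by move=> w; apply: (measurable_box clT).
  - exact: measurable_gt (proj1 (bmf_norm bS)).
  - move=> y /= hy; pose w := [ffun i : 'I_k.+1 => Nm i (iter n (T i) y)].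
    exists w; last first.
      apply/boxP => i ik; rewrite (_ : i = Ordinal (ik : (i < k.+1)%N))// AE.
      by rewrite /preimage /= /w ffunE.
    rewrite mem_filter mem_enum andbT /bad.
    have -> : Phi w = \sum_(h < H) orbit_prod (n + h) y.
      apply: eq_bigr => h _; apply: eq_bigr => i _.
      by rewrite /w ffunE tnth_mktuple -iterD addnC.
    by apply: le_lt_trans hy; rewrite ler_wpM2l// ge_min lexx.
apply: (@le_trans _ _ (\sum_(w <- l) (C * \prod_(i < k.+1) pr (mu i) (A w i) + e2))).
  apply: ler_sum => w _; apply: hN; apply: leq_trans nN.
  exact: leq_bigmax.
rewrite big_split/= -mulr_sumr big_const_seq count_predT iter_addr_0.
have h1 : e2 *+ size l <= dl / 2.
  rewrite -mulr_natr /e2 invfM mulrA mulrAC ler_pdivrMr// ler_wpM2l//; last lra.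
  by rewrite ltW// divr_gt0.
have h2 : \sum_(w <- l) \prod_(i < k.+1) pr (mu i) (A w i) <= e1.
  apply: le_trans hH.
  have mcyl w : measurable (cylinder (fun i => Nm i @^-1` [set w i])).
    by apply: measurable_cylinder.
  apply: (@le_trans _ _ (\sum_(w <- l) pr P (cylinder (fun i => Nm i @^-1` [set w i])))).
    rewrite le_eqVlt; apply/orP; left; apply/eqP; apply: eq_bigr => w _.
    apply: EFin_inj; rewrite -prE// prodP//.
    by rewrite -prodEFin; apply: eq_bigr => i _; rewrite AE -prE.
  apply: pr_bigcup_seq => //.
  - by rewrite filter_uniq ?enum_uniq.
  - apply: measurable_gt; apply: (proj1 (bmf_norm _)); apply: bmfB; last exact: bmf_cst.
    exact: (bmf_bsum mpP).
  - move=> w w' x h h'; apply/ffunP => i.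
    by rewrite -(h i : Nm i (tnth x i) = w i) -(h' i : Nm i (tnth x i) = w' i).
  - move=> w; rewrite mem_filter => /andP[hw _] x hx /=.
    rewrite (_ : bsum _ _ _ _ = Phi w)//; apply: eq_bigr => h _; apply: eq_bigr => i _.
    by rewrite tnth_iter_prod_map -(hx i : Nm i (tnth x i) = w i) tnth_mktuple.
have h3 : C * e1 <= dl / 2.
  apply: (@le_trans _ _ (C * (dl / (2 * (C + 1))))).
    by apply: ler_wpM2l => //; rewrite ge_min lexx orbT.
  rewrite mulrA ler_pdivrMr// (_ : dl / 2 * _ = C * dl + dl); last by field.
  by rewrite lerDl ltW.
have h4 := ler_wpM2l C0 h2.
by lra.
Qed.

(** Windows are controlled under [mu 0], and absolute continuity carries this to [nu]. Only starting
    times below [N0] escape control; they number at most [N0] whatever [M] is, which gives the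
    uniformity in [M]. *)
Lemma simple_L1 (nu : probability R R) (e : R) :
  (forall A, measurable A -> pr (mu 0%N) A = 0 -> pr nu A = 0) -> 0 < e ->
  exists L, forall M N, (M < N)%N -> (L <= N - M)%N ->
  Ex nu (fun y => `|(N - M)%:R^-1 * \sum_(M <= n < N) orbit_prod n y - simple_mean|) <= e.
Proof.
move=> ac e0.
pose V : R := \sum_a `|v a| + 1.
have V0 : 0 <= V by rewrite addr_ge0// sumr_ge0.
have vV a : `|v a| <= V.
  by rewrite /V (bigD1 a)//= -addrA lerDl addr_ge0// sumr_ge0.
pose B := V ^+ k.+1; have B0 : 0 <= B by exact: exprn_ge0.
have oB n y : `|orbit_prod n y| <= B by apply: normr_prod_le.
have cB : `|simple_mean| <= B.
  apply: normr_prod_le => // i; have := bmf_label i => bi.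
  rewrite ler_norml; apply/andP; split.
    rewrite -(Ex_cst (mu i) (- V)); apply: le_Ex => //; first exact: bmf_cst.
    by move=> x; have := vV (p i x); rewrite ler_norml => /andP[].
  rewrite -[leRHS](Ex_cst (mu i)); apply: le_Ex => //; first exact: bmf_cst.
  by move=> x; have := vV (p i x); rewrite ler_norml => /andP[].
clearbody B.
have e4 : 0 < e / 4 by rewrite divr_gt0.
(* Chosen so that bad points, where a window deviates by at most [2 * B] per term, contribute at
   most [e / 4] per term. *)
pose d' := e / (8 * (B + 1)).
have B1 : 0 < 8 * (B + 1) by lra.
have d'0 : 0 < d' by rewrite divr_gt0.
have Bd' : 2 * B * d' <= e / 4.
  have E : 8 * (B + 1) * d' = e by rewrite /d' mulrC divfK// gt_eqF.
  by have := ltW d'0; lra.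
have [dl dl0 hdl] := pr_absolutely_continuous ac d'0.
have [H [N0 [H0 hH]]] := window_small e4 dl0.
have H0' : 0 < H%:R :> R by rewrite ltr0n.
(* A long range absorbs the two costs that do not grow with it: the ends lost by shifting and the
   early starting times. *)
have [L hL] := eventually_linear (2 * B * H%:R + 2 * B * N0%:R) e4.
exists L => M N MN LMN.
have D0 : 0 < (N - M)%:R :> R by rewrite ltr0n subn_gt0.
have bo n : bmf (orbit_prod n) by exact: bmf_orbit_prod.
pose g n y := `|\sum_(h < H) orbit_prod (n + h) y - H%:R * simple_mean|.
have bg n : bmf (g n).
  apply: bmf_norm; apply: bmfB; last exact: bmf_cst.
  by apply: bmf_sum => h; exact: bo.
have gB n y : g n y <= 2 * H%:R * B.
  apply: le_trans (ler_normB _ _) _; rewrite normrM normr_nat.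
  have : `|\sum_(h < H) orbit_prod (n + h) y| <= H%:R * B.
    apply: le_trans (ler_norm_sum _ _ _) _.
    apply: (@le_trans _ _ (\sum_(h < H) B)); first by apply: ler_sum => h _.
    by rewrite big_const_ord iter_addr_0 -[leLHS]mulr_natl.
  by have := ler_wpM2l (ltW H0') cB; lra.
have Eg n : Ex nu (g n) <= H%:R * (e / 4 + e / 4) + 2 * H%:R * B * (n < N0)%:R.
  case: ltnP => nN0.
    apply: (@le_trans _ _ (2 * H%:R * B)).
      rewrite -[leRHS](Ex_cst nu); apply: le_Ex => //; exact: bmf_cst.
    by rewrite mulr1 lerDr mulr_ge0 ?(ltW H0')// addr_ge0// ltW.
  pose bad := [set y | H%:R * (e / 4) < g n y].
  have mbad : measurable bad by exact: measurable_gt (proj1 (bg n)).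
  have pbad : pr nu bad <= d' by apply: hdl => //; exact: hH.
  have bI : bmf (\1_bad : R -> R) by exact: bmf_indic.
  apply: (@le_trans _ _ (Ex nu (fun y => H%:R * (e / 4) + 2 * H%:R * B * \1_bad y))).
    apply: le_Ex => //; first by apply: bmfD; [exact: bmf_cst|exact: bmfZ].
    move=> y; rewrite indicE; have [yb|yb] := pselect (bad y).
      rewrite mem_set// mulr1; apply: le_trans (gB n y) _.
      by rewrite lerDr mulr_ge0// ltW.
    by rewrite memNset// mulr0 addr0 leNgt; exact/negP.
  rewrite ExD; [|exact: bmf_cst|exact: bmfZ].
  rewrite Ex_cst ExZ// Ex_indic// mulr0 addr0 mulrDr lerD2l.
  apply: (@le_trans _ _ (H%:R * (2 * B * d'))); last by rewrite ler_pM2l.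
  have -> : 2 * H%:R * B * pr nu bad = H%:R * (2 * B * pr nu bad) by ring.
  by rewrite ler_pM2l// ler_wpM2l// mulr_ge0.
have bSum : bmf (fun y => \sum_(M <= n < N) orbit_prod n y) by exact: bmf_sum.
have Esum : H%:R * Ex nu (fun y => `|\sum_(M <= n < N) orbit_prod n y - (N - M)%:R * simple_mean|)
    <= 2 * B * H%:R * H%:R + \sum_(M <= n < N) Ex nu (g n).
  have b1 : bmf (fun y => `|\sum_(M <= n < N) orbit_prod n y - (N - M)%:R * simple_mean|).
    by apply: bmf_norm; apply: bmfB => //; exact: bmf_cst.
  rewrite -ExZ// -Ex_sum// -[X in X + _](Ex_cst nu) -ExD; [|exact: bmf_cst|exact: bmf_sum].
  apply: le_Ex.
  - exact: bmfZ.
  - by apply: bmfD; [exact: bmf_cst|exact: bmf_sum].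
  - by move=> y; apply: window_average => //; exact: ltnW.
have {}Esum : Ex nu (fun y => `|\sum_(M <= n < N) orbit_prod n y - (N - M)%:R * simple_mean|)
    <= 2 * B * H%:R + (N - M)%:R * (e / 4 + e / 4) + 2 * B * N0%:R.
  rewrite -(ler_pM2l H0'); apply: le_trans Esum _.
  have : \sum_(M <= n < N) Ex nu (g n) <=
      \sum_(M <= n < N) (H%:R * (e / 4 + e / 4) + 2 * H%:R * B * (n < N0)%:R).
    by apply: ler_sum => n _; exact: Eg.
  rewrite big_split/= -mulr_sumr big_const_nat iter_addr_0 -[_ *+ (N - M)]mulr_natl.
  have : 2 * H%:R * B * \sum_(M <= n < N) (n < N0)%:R <= 2 * H%:R * B * N0%:R.
    by apply: ler_wpM2l (sum_lt_le _ _ _); rewrite !mulr_ge0// ltW.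
  move=> h1 h2; apply: (@le_trans _ _ (2 * B * H%:R * H%:R +
    ((N - M)%:R * (H%:R * (e / 4 + e / 4)) + 2 * H%:R * B * N0%:R))).
    rewrite lerD2l; apply: le_trans h2 _. by rewrite mulrCA lerD2l -mulr_sumr.
  by rewrite le_eqVlt; apply/orP; left; apply/eqP; ring.
have -> : (fun y => `|(N - M)%:R^-1 * \sum_(M <= n < N) orbit_prod n y - simple_mean|) =
    (fun y => (N - M)%:R^-1 * `|\sum_(M <= n < N) orbit_prod n y - (N - M)%:R * simple_mean|).
  apply/funext => y; rewrite -[X in X * `|_|]gtr0_norm ?invr_gt0// -normrM; congr `|_|.
  by rewrite mulrBr mulrA mulVf ?mul1r// gt_eqF.
rewrite ExZ; last by apply: bmf_norm; apply: bmfB => //; exact: bmf_cst.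
rewrite mulrC ler_pdivrMr//; apply: le_trans Esum _.
have := hL _ LMN; have : 0 < (N - M)%:R * e by exact: mulr_gt0.
lra.
Qed.

End Simple.

End JointErgodicity.

Section Quantization.
Context {R : realType} {d : measure_display} {X : measurableType d}.

(** [g + B] is nonnegative and is rounded down to a multiple of [eta]; the bound on [j] makes every
    quotient fit in ['I_j.+1], so [inord] never falls back on its default. *)
Lemma uniform_quantization (g : X -> R) (B : R) (j : nat) (eta : R) :
  measurable_fun setT g -> (forall x, `|g x| <= B) -> 0 < eta -> 2 * B / eta < j%:R ->
  forall x (q := fun x => inord (Num.trunc ((g x + B) / eta)) : 'I_j.+1),
    (forall a, measurable (q @^-1` [set a])) /\
    `|g x - ((q x)%:R * eta - B)| <= eta.
Proof.
move=> mg gB e0 hj x q.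
have t0 y : 0 <= (g y + B) / eta.
  apply: divr_ge0 (ltW e0).
  by have := gB y; rewrite ler_norml => /andP[]; lra.
have tj y : (g y + B) / eta < j%:R.
  apply: le_lt_trans hj; rewrite ler_pM2r ?invr_gt0//.
  by have := gB y; rewrite ler_norml => /andP[]; lra.
split=> [a|].
  apply: (@countable_fiber_measurable _ _ _ (fun y => Num.trunc ((g y + B) / eta)) _
    [set s | inord s = a]) => s.
  have mt : measurable_fun setT (fun y => (g y + B) / eta).
    apply: measurable_funM => //; apply: measurable_funD => //.
  rewrite (_ : _ @^-1` _ = [set y | (g y + B) / eta < s.+1%:R] `\` [set y | (g y + B) / eta < s%:R]).
    by apply: measurableD; exact: measurable_lt.
  apply/seteqP; split=> y /=.
    move=> /eqP; rewrite truncn_eq// => /andP[h1 h2]; split => //.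
    by apply/negP; rewrite -leNgt.
  move=> [h1 /negP]; rewrite -leNgt => h2; apply/eqP.
  by rewrite truncn_eq// h2.
have /andP[h1 h2] := truncn_itv (t0 x).
have qx : q x = Num.trunc ((g x + B) / eta) :> nat.
  rewrite /q inordK// ltnS -(ler_nat R); apply: le_trans h1 (ltW (tj x)).
rewrite qx; move: h1 h2; set s := Num.trunc _; rewrite ler_pdivlMr// ltr_pdivrMr// -natr1 => h1 h2.
by rewrite ler_norml; apply/andP; split; lra.
Qed.

End Quantization.

(** The deviation is bounded, so its square is at most a constant times its absolute value and
    convergence in [L^1] suffices. For that the functions are truncated to be bounded everywhere and
    then rounded to finitely many values. *)
Theorem theorem5p1 (R : realType) (k : nat)
  (mu : nat -> probability R R) (T : nat -> R -> R)
  (J : nat -> set nat) (I : nat -> nat -> interval R) :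
  (forall i, (i <= k)%N -> mpreserving (mu i) (T i) /\ ergodic (mu i) (T i)) ->
  (forall i, (i <= k)%N -> classT (mu i) (T i) (J i) (I i)) ->
  (forall i, (1 <= i <= k)%N -> propertyB (mu i) (T i) (J i) (I i)) ->
  (0 <= KS_entropy (mu 0%N) (T 0%N))%E ->
  (forall i, (i < k)%N -> (KS_entropy (mu i) (T i) < KS_entropy (mu i.+1) (T i.+1))%E) ->
  (KS_entropy (mu k) (T k) < +oo)%E ->
  (forall P : probability ((k.+1).-tuple R) R,
      is_product_measure mu P -> ergodic P (@prod_map R k T)) ->
  forall (nu : probability R R) (f : nat -> R -> R),
    equiv_lam nu ->
    (forall i, (i <= k)%N -> Linfty (f i)) ->
    forall eps : R, 0 < eps -> exists L : nat, forall M N : nat,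
      (M < N)%N -> (L <= N - M)%N ->
      (\int[nu]_x ((erg_avg k T f M N x
          - \prod_(i < k.+1) fine (\int[mu i]_y (f i y)%:E)) ^+ 2)%:E
        <= eps%:E)%E.
Proof.
move=> _ clT pB KS0 KSlt _ ergP nu f nuE fE eps eps0.
have mpT i : (i <= k)%N -> mpreserving (mu i) (T i) by move=> /clT[_ [_ []]].
have bdmu i : (i <= k)%N -> bdd_equiv (mu i) by move=> /clT[].
have nu0 i A : (i <= k)%N -> measurable A -> pr (mu i) A = 0 -> pr nu A = 0.
  move=> ik mA A0; have [c [c1 hc]] := bdd_equivP (bdmu i ik).
  have l0 : lam01 A = 0%E.
    rewrite -(fineK (lam01_fin mA)); congr EFin; apply/eqP.
    rewrite eq_le fine_ge0 ?andbT; last exact: measure_ge0.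
    by have := (hc A mA).2; rewrite A0 mulr0.
  by rewrite /pr ((nuE A mA).2 l0).
have /choice[Cf hCf] (i : nat) : exists C : R, (i <= k)%N ->
    lebesgue_measure [set x : R | 0 <= x <= 1 /\ C < `|f i x|] = 0%E.
  have [ik|ik] := leqP i k; last by exists 0.
  by have [_ [C hC]] := fE i ik; exists C.
have mf (i : 'I_k.+1) : measurable_fun setT (f i) by exact: (fE i (leq_ord i)).1.
pose B : R := 1 + \sum_(i < k.+1) `|Cf i|.
have B1 : 1 <= B by rewrite lerDl sumr_ge0.
have B0 : 0 <= B by exact: le_trans B1.
have CB (i : 'I_k.+1) : Cf i <= B.
  apply: le_trans (ler_norm _) _; rewrite /B (bigD1 i)//= addrCA lerDl.
  by rewrite addr_ge0// sumr_ge0.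
clearbody B.
(* [f i] is essentially bounded on the unit interval only; the truncation is bounded on the whole
   line and agrees with [f i] off the [mu i]-null set [Z i]. *)
pose ft (i : 'I_k.+1) x := Num.max (- B) (Num.min B (f i x)).
have mft i : measurable_fun setT (ft i).
  by apply: measurable_maxr => //; apply: measurable_minr.
have ftB i x : `|ft i x| <= B.
  rewrite ler_norml /ft le_max lexx/= ge_max ge_min lexx/= andbT.
  by rewrite lerNl (le_trans _ B0)// oppr_le0.
have bft i : bmf (ft i) by split; [exact: mft|exists B].
pose Z (i : 'I_k.+1) := [set x | B < `|f i x|].
have mZ i : measurable (Z i) by apply: measurable_gt; exact: measurableT_comp.
have ftE i x : ~ Z i x -> f i x = ft i x.
  rewrite /Z /= => /negP; rewrite -leNgt ler_norml => /andP[h1 h2].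
  by rewrite /ft (min_idPr h2) (max_idPr h1).
have Z0 (i : 'I_k.+1) : pr (mu i) (Z i) = 0.
  apply: (lam01_null (clT i (leq_ord i))) => //; rewrite /lam01.
  have mC : measurable [set x : R | 0 <= x <= 1 /\ Cf i < `|f i x|].
    rewrite (_ : [set _ | _] = `[0, 1]%classic `&` [set x | Cf i < `|f i x|]).
      apply: measurableI => //; apply: measurable_gt; exact: measurableT_comp.
    by apply/seteqP; split=> x /=; rewrite in_itv.
  apply/eqP; rewrite eq_le measure_ge0 andbT -(hCf i (leq_ord i)).
  apply: le_measure; rewrite ?inE//; first exact: (measurableI _ _ (mZ i) (measurable_itv _)).
  by move=> x [h]; rewrite /= in_itv/= => x01; split => //; exact: le_lt_trans (CB i) h.
pose ct := \prod_(i < k.+1) Ex (mu i) (ft i).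
have ctE : \prod_(i < k.+1) fine (\int[mu i]_y (f i y)%:E)%E = ct.
  apply: eq_bigr => i _; rewrite /Ex /Rintegral; congr fine.
  apply: ae_eq_integral => //; try by apply/measurable_EFinP.
  exists (Z i); split => //; first by have := prE (mu i) (mZ i); rewrite Z0.
  by move=> x /= h; apply: contrapT => nZ; apply: h => _; rewrite (ftE i x nZ).
pose orb n x := \prod_(i < k.+1) ft i (iter n (T i) x).
have borb n : bmf (orb n).
  apply: bmf_prod => i; apply: (bmf_comp _ (bft i)).
  exact: (measurable_iter (mpT i (leq_ord i))).
pose g M N x := (N - M)%:R^-1 * \sum_(M <= n < N) orb n x - ct.
have bg M N : bmf (g M N).
  by apply: bmfB; [apply: bmfZ; exact: bmf_sum|exact: bmf_cst].
have intE M N : (\int[nu]_x ((erg_avg k T f M N x - ct) ^+ 2)%:E)%E =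
    (Ex nu (fun x => g M N x * g M N x))%:E.
  have bgg : bmf (fun x => g M N x * g M N x) by exact: bmfM.
  (* Off [W] the truncation is not felt before time [N]. [W] is [nu]-null: each [T i] preserves
     [mu i], and [mu i]-null sets are Lebesgue null, hence [nu]-null. *)
  pose W := [set x | exists n (i : 'I_k.+1), (n < N)%N /\ Z i (iter n (T i) x)].
  have mTZ n (i : 'I_k.+1) : measurable (iter n (T i) @^-1` Z i).
    exact: (preimage_iter_measurable (mpT i (leq_ord i))).
  have mW : measurable W.
    rewrite (_ : W = \bigcup_(n in [set n | (n < N)%N]) \bigcup_(i in [set: 'I_k.+1])
        (iter n (T i) @^-1` Z i)).
      apply: bigcup_measurable => n _; apply: fin_bigcup_measurable => //.
    apply/seteqP; split=> x; first by move=> [n [i [nN h]]]; exists n => //; exists i.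
    by move=> [n nN [i _ h]]; exists n, i.
  have W0 : pr nu W = 0.
    apply/eqP; rewrite eq_le pr_ge0 andbT.
    apply: le_trans (le_pr_bigcup_seq nu (l := [seq (n, i) | n <- iota 0 N, i <- enum 'I_k.+1])
      (F := fun c : nat * 'I_k.+1 => iter c.1 (T c.2) @^-1` Z c.2) _ mW _) _.
    - by move=> [n i]; exact: mTZ.
    - move=> x [n [i [nN h]]]; exists (n, i) => //.
      by apply/allpairsP; exists (n, i); rewrite mem_iota mem_enum.
    - rewrite big1// => -[n i] _ /=; apply: (nu0 i _ (leq_ord i)) => //.
      by rewrite (pr_iter (mpT i (leq_ord i))).
  rewrite /Ex /Rintegral fineK; last first.
    exact: (integrable_fin_num measurableT (bmf_integrable nu bgg)).
  have mavg : measurable_fun setT (erg_avg k T f M N).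
    apply: measurable_funM => //; apply: measurable_sum => n.
    apply: measurable_prod => i _; apply: (measurableT_comp (mf i)).
    exact: (measurable_iter (mpT i (leq_ord i))).
  apply: ae_eq_integral => //.
  - apply/measurable_EFinP; apply: measurable_funX; exact: measurable_funB.
  - by apply/measurable_EFinP; exact: (proj1 bgg).
  - exists W; split => //; first by have := prE nu mW; rewrite W0.
    move=> x /= h; apply: contrapT => nW; apply: h => _; congr EFin.
    rewrite -expr2 /g /erg_avg; congr ((_ * _ - _) ^+ 2).
    rewrite !big_nat; apply: eq_bigr => n /andP[_ nN]; apply: eq_bigr => i _.
    by apply: ftE => h; apply: nW; exists n, i.
pose Q := B ^+ k.+1; have Q0 : 0 <= Q by exact: exprn_ge0.
have orbQ n x : `|orb n x| <= Q by apply: normr_prod_le.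
have gQ M N x : (M < N)%N -> `|g M N x| <= 2 * Q.
  move=> MN; have D0 : 0 < (N - M)%:R :> R by rewrite ltr0n subn_gt0.
  have h1 : `|(N - M)%:R^-1 * \sum_(M <= n < N) orb n x| <= Q.
    rewrite normrM gtr0_norm ?invr_gt0// mulrC ler_pdivrMr//.
    apply: le_trans (ler_norm_sum _ _ _) _.
    apply: (@le_trans _ _ (\sum_(M <= n < N) Q)); first by apply: ler_sum => n _.
    by rewrite big_const_nat iter_addr_0 -[leLHS]mulr_natr.
  have h2 : `|ct| <= Q.
    apply: normr_prod_le => // i; rewrite ler_norml; apply/andP; split.
      rewrite -(Ex_cst (mu i) (- B)); apply: le_Ex => //; first exact: bmf_cst.
      by move=> y; have := ftB i y; rewrite ler_norml => /andP[].
    rewrite -[leRHS](Ex_cst (mu i)); apply: le_Ex => //; first exact: bmf_cst.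
    by move=> y; have := ftB i y; rewrite ler_norml => /andP[].
  by apply: le_trans (ler_normB _ _) _; lra.
have Q1 : 0 < 8 * (Q + 1) by lra.
(* Three errors of size [e1] occur, from the simple averages, the rounded products and the rounded
   means; the factor [2 * Q] comes from bounding the square. *)
pose e1 := eps / (8 * (Q + 1)); have e10 : 0 < e1 by exact: divr_gt0.
have e1E : e1 * (8 * (Q + 1)) = eps by rewrite /e1 divfK// gt_eqF.
(* The Lipschitz constant of [prod_approx]; since [eta <= 1], rounded values are bounded by
   [B + 1]. *)
pose Kc : R := k.+1%:R * (B + 1) ^+ k.+1.
have Kc0 : 0 < Kc by rewrite mulr_gt0// exprn_gt0//; lra.
pose eta := Num.min 1 (e1 / Kc).
have eta0 : 0 < eta by rewrite lt_min ltr01 divr_gt0.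
have eta1 : eta <= 1 by rewrite ge_min lexx.
have etaK : Kc * eta <= e1.
  by rewrite mulrC -ler_pdivlMr// ge_min lexx orbT.
pose m := Num.bound (2 * B / eta).
have hm : 2 * B / eta < m%:R.
  by apply: archi_boundP; rewrite divr_ge0 ?mulr_ge0// ltW.
pose p (i : 'I_k.+1) x : 'I_m.+1 := inord (Num.trunc ((ft i x + B) / eta)).
pose v (a : 'I_m.+1) : R := a%:R * eta - B.
have mp i a : measurable (p i @^-1` [set a]).
  by have [h _] := uniform_quantization (mft i) (ftB i) eta0 hm point; exact: h.
have pv i x : `|ft i x - v (p i x)| <= eta.
  by have [_ h] := uniform_quantization (mft i) (ftB i) eta0 hm x; exact: h.
have vB i x : `|v (p i x)| <= B + 1.
  have -> : v (p i x) = ft i x - (ft i x - v (p i x)) by ring.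
  apply: le_trans (ler_normB _ _) _; apply: lerD => //.
  exact: le_trans (pv i x) eta1.
have [L hL] := simple_L1 clT pB KS0 KSlt ergP (m := m.+1) v mp
  (fun A mA A0 => nu0 0%N A (leq0n k) mA A0) e10.
exists L => M N MN LMN; rewrite ctE intE lee_fin.
have D0 : 0 < (N - M)%:R :> R by rewrite ltr0n subn_gt0.
have {hL} := hL M N MN LMN; set s := (fun y => `| _ |) => hs.
have bov n : bmf (orbit_prod T p v n) by exact: (bmf_orbit_prod clT).
have bs : bmf s.
  apply: bmf_norm; apply: bmfB; last exact: bmf_cst.
  by apply: bmfZ; exact: bmf_sum.
have B11 : 1 <= B + 1 by lra.
have ftB1 i x : `|ft i x| <= B + 1 by apply: le_trans (ftB i x) _; lra.
have bv i : bmf (fun x => v (p i x)).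
  split; last by exists (B + 1) => x; exact: vB.
  move=> _ Y _; rewrite setTI.
  exact: (countable_fiber_measurable (mp i) [set a | Y (v a)]).
have dorb n x : `|orb n x - orbit_prod T p v n x| <= e1.
  by apply: le_trans etaK; apply: prod_approx => //; exact: ltW.
have dct : `|ct - simple_mean mu p v| <= e1.
  apply: le_trans etaK; apply: prod_approx => //; first exact: ltW.
  - move=> i; rewrite ler_norml; apply/andP; split.
      rewrite -(Ex_cst (mu i) (- (B + 1))); apply: le_Ex => //; first exact: bmf_cst.
      by move=> y; have := ftB1 i y; rewrite ler_norml => /andP[].
    rewrite -[leRHS](Ex_cst (mu i)); apply: le_Ex => //; first exact: bmf_cst.
    by move=> y; have := ftB1 i y; rewrite ler_norml => /andP[].
  - move=> i; rewrite ler_norml; apply/andP; split.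
      rewrite -(Ex_cst (mu i) (- (B + 1))); apply: le_Ex => //; first exact: bmf_cst.
      by move=> y; have := vB i y; rewrite ler_norml => /andP[].
    rewrite -[leRHS](Ex_cst (mu i)); apply: le_Ex => //; first exact: bmf_cst.
    by move=> y; have := vB i y; rewrite ler_norml => /andP[].
  - move=> i; rewrite -ExB//; have bd := bmfB (bft i) (bv i).
    rewrite ler_norml; apply/andP; split.
      rewrite -(Ex_cst (mu i) (- eta)); apply: le_Ex => //; first exact: bmf_cst.
      by move=> y; have := pv i y; rewrite ler_norml => /andP[].
    rewrite -[leRHS](Ex_cst (mu i)); apply: le_Ex => //; first exact: bmf_cst.
    by move=> y; have := pv i y; rewrite ler_norml => /andP[].
have gs x : `|g M N x| <= s x + (e1 + e1).
  have -> : g M N x = ((N - M)%:R^-1 * \sum_(M <= n < N) orbit_prod T p v n x - simple_mean mu p v)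
      + ((N - M)%:R^-1 * \sum_(M <= n < N) (orb n x - orbit_prod T p v n x)
         - (ct - simple_mean mu p v)).
    by rewrite /g sumrB mulrBr; ring.
  apply: le_trans (ler_normD _ _) _; rewrite /s lerD2l.
  apply: le_trans (ler_normB _ _) _; apply: lerD => //.
  rewrite normrM gtr0_norm ?invr_gt0// mulrC ler_pdivrMr//.
  apply: le_trans (ler_norm_sum _ _ _) _.
  apply: (@le_trans _ _ (\sum_(M <= n < N) e1)); first by apply: ler_sum => n _.
  by rewrite big_const_nat iter_addr_0 -[leLHS]mulr_natr.
have bse : bmf (fun x => s x + (e1 + e1)) by apply: bmfD => //; exact: bmf_cst.
(* One factor of the square is bounded by [2 * Q], the other by the deviation [s] of the rounded
   averages plus the two rounding errors. *)
apply: (@le_trans _ _ (Ex nu (fun x => 2 * Q * (s x + (e1 + e1))))).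
  apply: le_Ex; [exact: bmfM|exact: bmfZ|move=> x].
  apply: le_trans (ler_norm _) _; rewrite normrM.
  by apply: ler_pM => //; exact: gQ.
rewrite ExZ// ExD//; last exact: bmf_cst.
rewrite Ex_cst; apply: (@le_trans _ _ (2 * Q * (e1 + (e1 + e1)))).
  by apply: ler_wpM2l; [rewrite mulr_ge0|rewrite lerD2r].
rewrite -e1E; have : 0 <= Q * e1 by rewrite mulr_ge0// ltW.
by move=> h; lra.
Qed.
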